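(* Let $m_1\ge3$, $m_2\ge3$, $m_3\ge3$, $m_4\ge3$, let $G_0$ be the group of type $\mathcal{D}_5$ $$G_0=\langle t_1,t_2,t_3,x,y\mid t_1^{2^{m_1}}=t_2^{2^{m_2}}=t_3^{2^{m_3}}=1,\ x^2=t_2,\ y^2=t_3,\ t_1,t_2,t_3\text{ central},\ (x,y)=t_1^{2^{m_1-1}}=s\rangle,$$ and let $G=G_0\times\langle t_4\rangle$ with $t_4$ of order $2^{m_4}$, so that the centre of $G$ is the direct product of four cyclic groups of orders $2^{m_1},2^{m_2},2^{m_3},2^{m_4}$, respectively. Denote by $N_1$ the number of cyclic subgroups of the centre $\mathcal{Z}(G)$ and by $N_2,N_3,N_4$ the numbers of $\mathbb{Q}$-classes of $G$ involving $x$, $y$ and $xy$, respectively. Let $N=N_1+N_2+N_3+N_4$ and let $N_0$ be the number of cyclic subgroups of $G/G'$. Then $\mathbb{Q}G$ is the direct sum of $N_0$ fields and $N-N_0$ quaternion algebras. Let $K$ be a finite field of odd order $q$. Then there are at least $M=2N-136$ simple components in the Wedderburn decomposition of $KG$. This minimal number is realized if $q\equiv3\pmod8$, in which case $KG$ is the direct sum of $M_0=2N_0-136$ fields and $M-M_0=2(N-N_0)$ quaternion algebras, each necessarily a $2\times2$ matrix ring (over a field).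
   Context: $(x,y)$ denotes the group commutator; $G'=\{1,s\}$ is the commutator subgroup. The conjugacy classes of $G$ are $\{a\}$ for $a\in\mathcal{Z}(G)$ and $\{w,sw\}$ for $w\notin\mathcal{Z}(G)$. $K$-classes: let $G$ be a finite group of exponent $e$, $K$ a field with characteristic not dividing $|G|$ and $\zeta$ a primitive $e$th root of unity. Each $\sigma\in\mathrm{Gal}(K(\zeta)/K)$ satisfies $\sigma(\zeta)=\zeta^r$ for some $r$, and the maps $g\mapsto g^r$ so obtained act on the set of conjugacy classes of $G$; the orbits are the $K$-classes of $G$. For a noncentral element $z$ of $G$, the $\mathbb{Q}$-classes ''involving $z$'' are those corresponding to (consisting of) conjugacy classes of the form $\{az,saz\}$ with $a\in\mathcal{Z}(G)$. A quaternion algebra means a $4$-dimensional central simple algebra over its centre (a field extension of the ground field); $2\times2$ matrix rings over fields are included. *)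

(* Defs.v *)
From HB Require Import structures.
From mathcomp Require Import all_boot all_order all_algebra.
From mathcomp Require Import all_fingroup all_solvable all_field all_character.

Set Implicit Arguments.
Unset Strict Implicit.
Unset Printing Implicit Defensive.

Import GRing.Theory.
Local Open Scope ring_scope.

Section Algebras.

(* Finite-dimensional F-algebras are handled as in mxalgebra: R : 'A[F]_(m, n)
   stands for the subspace of 'M[F]_n spanned by its rows, and it need not
   contain the identity matrix of 'M[F]_n.  An ideal of the group ring, seen as
   an algebra with its own identity, is therefore again of this form. *)
Variables (F : fieldType) (n : nat).

Definition simple_algebra (m : nat) (R : 'A[F]_(m, n)) : Prop :=
  mxring R /\
  forall J : 'A[F]_n, (J <= R)%MS -> mx_ideal R J -> J != 0 -> (J :=: R)%MS.

Definition Wedderburn_decomposition (m : nat) (A : 'A[F]_(m, n))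
    (I : finType) (R : I -> 'A[F]_n) : Prop :=
  [/\ (\sum_i R i :=: A)%MS, mxdirect (\sum_i R i)%MS,
      forall i, mx_ideal A (R i) & forall i, simple_algebra (R i)].

(* R is isomorphic to B as an F-algebra, where iota : F -> B is the structure
   map of B; f is the isomorphism B -> R followed by the inclusion in 'M_n. *)
Definition algebra_iso (B : nzRingType) (iota : F -> B)
    (m : nat) (R : 'A[F]_(m, n)) : Prop :=
  exists f : {additive B -> 'M[F]_n},
    [/\ injective f,
        forall a b, f (a * b) = f a *m f b,
        forall k b, f (iota k * b) = k *: f b
      & forall X, (X \in R)%MS <-> exists b, f b = X].

Definition is_field_algebra (m : nat) (R : 'A[F]_(m, n)) : Prop :=
  exists L : fieldExtType F, algebra_iso (fun k => k%:A : L) R.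

Definition is_matrix2_algebra (m : nat) (R : 'A[F]_(m, n)) : Prop :=
  exists L : fieldExtType F, algebra_iso (fun k => (k%:A : L)%:M : 'M[L]_2) R.

(* The dimension of R over its centre Z is (\rank R) / (\rank Z). *)
Definition is_quaternion_algebra (m : nat) (R : 'A[F]_(m, n)) : Prop :=
  [/\ simple_algebra R, is_field_algebra 'Z(R)%MS
    & \rank R = (4 * \rank 'Z(R)%MS)%N].

End Algebras.

Section KClasses.

Local Open Scope group_scope.

(* Here L = K(zeta), zeta being a primitive root of unity of order the exponent
   of G.  For a conjugacy class C of g, the set of all r-th powers of elements
   of C is the conjugacy class of g ^+ r. *)
Variables (K : fieldType) (L : splittingFieldType K) (zeta : L).
Variables (gT : finGroupType) (G : {group gT}).

Definition Kclass (C : {set gT}) : {set {set gT}} :=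
  [set D : {set gT} | [exists sigma in 'Gal({:L} / 1),
     exists r : 'I_(exponent G),
       (sigma zeta == (zeta ^+ r)%R) && (D == [set g ^+ r | g in C])]].

Definition Kclasses : {set {set {set gT}}} := [set Kclass C | C in classes G].

Definition Kclasses_involving (s z : gT) : {set {set {set gT}}} :=
  [set Q in Kclasses | Q \subset [set [set a * z; s * a * z] | a in 'Z(G)]].

End KClasses.

Section Groups.

Local Open Scope group_scope.

Definition cyclic_subgroups (gT : finGroupType) (A : {set gT})
    : {set {group gT}} :=
  [set C : {group gT} | (C \subset A) && cyclic C].

(* The presented group is finite, so "\isog Grp" does characterize it.  As the
   given elements generate G0 and satisfy the relations, they are the images
   of the generators under an isomorphism with the presented group. *)
Definition type_D5 (gT : finGroupType) (m1 m2 m3 : nat) (G0 : {group gT})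
    (t1 t2 t3 x y : gT) : Prop :=
  [/\ G0 :=: <<[set t1; t2; t3; x; y]>>,
      [/\ t1 ^+ (2 ^ m1) = 1, t2 ^+ (2 ^ m2) = 1, t3 ^+ (2 ^ m3) = 1,
          x ^+ 2 = t2 & y ^+ 2 = t3],
      [/\ t1 \in 'Z(G0), t2 \in 'Z(G0) & t3 \in 'Z(G0)],
      [~ x, y] = t1 ^+ (2 ^ m1.-1)
    & G0 \isog Grp (t1 : t2 : t3 : x : y :
        t1 ^+ (2 ^ m1), t2 ^+ (2 ^ m2), t3 ^+ (2 ^ m3),
        x ^+ 2 = t2, y ^+ 2 = t3,
        [~ t1, t2], [~ t1, t3], [~ t1, x], [~ t1, y],
        [~ t2, t3], [~ t2, x], [~ t2, y], [~ t3, x], [~ t3, y],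
        [~ x, y] = t1 ^+ (2 ^ m1.-1))].

End Groups.

(* Main.v *)
(* Let F be Q or K, and let E contain the roots of unity of order exp(G).  The
   central idempotents (1 + s)/2 and (1 - s)/2 split F[G] into two ideals.  On
   the first s acts as 1, so that it is the group ring of the abelian group G/G'
   and a sum of fields, one for each Galois orbit of E-valued characters of
   G/G'.  On the second yx = -xy, and each Galois orbit of characters chi of Z(G)
   with chi(s) = -1 cuts out a quaternion algebra (t2, t3) over the field
   generated by the values of chi; over a finite field it splits, since
   a c^2 + b d^2 = 1 has solutions.

   Finite abelian groups have symmetric perfect pairings, hence characters can
   be indexed by group elements, and Galois acts by powers.  Over Q the orbits
   are then the cyclic subgroups, and over K the orbits of b |-> b^q.  Each
   cyclic 2-group of order at least 8 breaks into at least two such orbits, as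
   the odd residues modulo 8 are not cyclic, and into exactly two if q = 3 mod 8,
   as -1 and q then generate all odd residues.  The cyclic subgroups of G/G' of
   order at most 4 number 1 + 15 + 120 = 136, while b^4 = 1 is impossible for
   chi_b(s) = -1 because s is a fourth power in Z(G).

   As G/G' is the union of the images of the cosets of Z(G), N0 is the sum of N2,
   N3, N4 and the number of cyclic subgroups of Z(G)/<s>; by duality the latter
   are as many as the cyclic subgroups generated by those b with chi_b(s) = 1. *)


(* The statement counts cyclic subgroups and classes and prescribes the index types, while the
   algebra produces Galois orbits of characters. So the decomposition is proved once, for any field
   [F] and any map [f] whose fibres are the orbits; the rational and the finite case differ only in
   [f]. The set of characters of Z(G) with chi(s) = -1 depends on the splitting field and on the
   chosen pairing. The sets obtained for Q and for K are therefore compared only through their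
   numbers of cyclic subgroups, which a count inside Z(G) determines.

   Components are built over E as sums of character idempotents along an orbit and descended to F by
   Galois invariance. The lower bound speaks of arbitrary decompositions, so it also needs that none
   has fewer components than the one constructed.

   The relations alone bound the order of G0 only from above, through the normal form z x^i y^j. An
   explicit group satisfying them bounds it from below. Once both bounds meet, the direct
   decompositions of Z(G) and of G/G' follow by counting. *)
Require Import Defs.
From HB Require Import structures.
From mathcomp Require Import all_boot all_order all_algebra.
From mathcomp Require Import all_fingroup all_solvable all_field all_character.
From mathcomp Require Import ring zify.

Set Implicit Arguments.
Unset Strict Implicit.
Unset Printing Implicit Defensive.

Import GRing.Theory.

(** * Wedderburn decompositions *)

Section MatrixAlgebras.

Local Open Scope ring_scope.

Variables (F : fieldType) (n : nat).
Implicit Types (J : 'A[F]_n) (X Y e : 'M[F]_n).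

(** An element of [R i] that is also a sum of elements of the other spaces is both fixed and killed
    by [p i]. *)
Lemma mxdirect_proj (I : finType) (R : I -> 'A[F]_n)
    (p : I -> {additive 'M[F]_n -> 'M[F]_n}) :
    (forall i X, (X \in R i)%MS -> p i X = X) ->
    (forall i j X, i != j -> (X \in R j)%MS -> p i X = 0) ->
  mxdirect (\sum_i R i)%MS.
Proof.
move=> pid p0; apply/mxdirect_sumsP=> i _; apply/eqP; rewrite -submx0.
apply/memmx_subP=> X; rewrite sub_capmx => /andP[RiX /memmx_sumsP[B defX RB]].
suff ->: X = 0 by rewrite linear0 sub0mx.
rewrite -(pid i X RiX) defX raddf_sum big1 // => j; move: (RB j).
by case: (eqVneq j i) => [-> | ji] RBj // _; apply: p0 RBj; rewrite eq_sym.
Qed.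

Section Idempotent.

Variables (m : nat) (A : 'A[F]_(m, n)) (e : 'M[F]_n).
Hypotheses (mulA : (A * A <= A)%MS) (Ae : (e \in A)%MS) (ee : e *m e = e).

(** [mxvec e] is a single row, so as a space it is the line through [e], and the product of spaces
    consists of the right multiples of [e] by [A]. All components below are given in this form, and
    membership is tested by this criterion. *)
Lemma mem_corner X : (X \in A * mxvec e)%MS = (X \in A)%MS && (X *m e == X).
Proof.
apply/idP/andP=> [|[AX /eqP<-]]; last exact: mem_mulsmx.
case/mulsmxP=> A1 AA1 [A2 eA2 ->].
have{eA2} eA2 i : exists k, A2 i = k *: e.
  case/submxP: (eA2 i) => u Du; exists (u 0 0).
  by apply: (can_inj mxvecK); rewrite Du [u]mx11_scalar mul_scalar_mx linearZ mxE eqxx.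
split.
  rewrite linear_sum summx_sub // => i _; case: (eA2 i) => k ->.
  by rewrite -scalemxAr linearZ scalemx_sub // (mulsmx_subP mulA).
apply/eqP; rewrite mulmx_suml; apply: eq_bigr => i _; case: (eA2 i) => k ->.
by rewrite -mulmxA -scalemxAl ee.
Qed.

End Idempotent.

Lemma Wedderburn_idempotents (I : finType) (m : nat) (A : 'A[F]_(m, n))
    (e : I -> 'M[F]_n) :
    (A * A <= A)%MS ->
    (forall i, (e i \in A)%MS) -> (forall i, e i *m e i = e i) ->
    (forall i j, i != j -> e i *m e j = 0) ->
    (forall i X, (X \in A)%MS -> X *m e i = e i *m X) ->
    \sum_i e i = 1%:M ->
    (forall i, simple_algebra (A * mxvec (e i))%MS) ->
  Wedderburn_decomposition A (fun i => A * mxvec (e i))%MS.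
Proof.
move=> mulA Ae ee ee0 ce sume simpl.
have memE i X : (X \in A * mxvec (e i))%MS = (X \in A)%MS && (X *m e i == X).
  exact: mem_corner.
split=> // [||i].
- apply/eqmxP/andP; split.
    by apply/sumsmx_subP=> i _; apply/memmx_subP=> X; rewrite memE => /andP[].
  apply/memmx_subP=> X AX; apply/memmx_sumsP; exists (fun i => X *m e i).
    by rewrite -mulmx_sumr sume mulmx1.
  by move=> i; rewrite memE -mulmxA ee eqxx (mulsmx_subP mulA).
- apply: (@mxdirect_proj _ _ (fun i => mulmxr (e i))) => [i X | i j X ij].
    by rewrite memE => /andP[_ /eqP].
  by rewrite memE => /andP[_ /eqP<-] /=; rewrite -mulmxA ee0 ?mulmx0 // eq_sym.
apply/andP; split; apply/mulsmx_subP=> X Y.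
  move=> AX; rewrite !memE => /andP[AY /eqP eY].
  by rewrite (mulsmx_subP mulA) // -mulmxA eY eqxx.
rewrite !memE => /andP[AX /eqP eX] AY.
by rewrite (mulsmx_subP mulA) // -mulmxA ce // mulmxA eX eqxx.
Qed.

Lemma mxring_mem_id m (R : 'A[F]_(m, n)) : mxring R -> exists e, mxring_id R e.
Proof. by case/andP=> _ /mxring_idP. Qed.

Lemma simple_ideal_eq m (A : 'A[F]_(m, n)) (R J : 'A[F]_n) :
    simple_algebra R -> mx_ideal A R -> (R <= A)%MS ->
    mx_ideal A J -> (J <= R)%MS -> J != 0 ->
  (J :=: R)%MS.
Proof.
move=> [_ minR] _ RA idJ sJR nzJ; apply: minR => //.
case/andP: idJ => lJ rJ; apply/andP; split.
  by apply: submx_trans lJ; apply: mulsmxS.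
by apply: submx_trans rJ; apply: mulsmxS.
Qed.

(* Each component of one decomposition meets, hence equals, a component of the
   other one. *)
Lemma Wedderburn_card_leq (I I' : finType) m (A : 'A[F]_(m, n))
    (R : I -> 'A[F]_n) (R' : I' -> 'A[F]_n) :
    Wedderburn_decomposition A R -> Wedderburn_decomposition A R' ->
  (#|I| <= #|I'|)%N.
Proof.
move=> [sumR dxR idR simR] [sumR' dxR' idR' simR'].
have sRA i : (R i <= A)%MS by rewrite -sumR (sumsmx_sup i).
have sRA' i : (R' i <= A)%MS by rewrite -sumR' (sumsmx_sup i).
have nzR i : R i != 0.
  case: (simR i) => /mxring_mem_id[e [nze Re _ _]] _.
  by apply: contraNneq nze => R0; rewrite R0 eqmx0 in Re; rewrite (memmx0 Re).
have ex i : exists j, (R' j :=: R i)%MS.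
  case: (simR i) => /mxring_mem_id[e [nze Re ide _]] _.
  have: (e \in A)%MS by apply: submx_trans Re _.
  rewrite -sumR' => /memmx_sumsP[B defe RB].
  (* The identity [e] of [R i] is the sum of the [e *m B j], so one of them is nonzero. For that [j]
     the ideal [R i * R' j] is nonzero and lies in both simple ideals, which forces them to
     coincide. *)
  have [j nzBj]: exists j, e *m B j != 0.
    apply/existsP; apply: contraNT nze; rewrite negb_exists => /forallP B0.
    rewrite -(ide e Re) {2}defe mulmx_sumr big1 // => j _.
    by apply/eqP; have:= B0 j; rewrite negbK.
  exists j; pose J := (R i * R' j)%MS.
  case/andP: (idR i) => lR rR; case/andP: (idR' j) => lR' rR'.
  have idJ: mx_ideal A J.
    apply/andP; split; rewrite /left_mx_ideal /right_mx_ideal /J.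
      by rewrite mulsmxA mulsmxS.
    by rewrite -mulsmxA mulsmxS.
  have sJR: (J <= R i)%MS.
    by apply: submx_trans rR; apply: mulsmxS.
  have sJR': (J <= R' j)%MS.
    by apply: submx_trans lR'; apply: mulsmxS.
  have nzJ: J != 0.
    apply: contraNneq nzBj => J0; rewrite [_ *m _]memmx0 //.
    by move: (mem_mulsmx Re (RB j)); rewrite -/J J0.
  have E1 := simple_ideal_eq (simR i) (idR i) (sRA i) idJ sJR nzJ.
  have E2 := simple_ideal_eq (simR' j) (idR' j) (sRA' j) idJ sJR' nzJ.
  by apply: eqmx_trans (eqmx_sym E2) E1.
pose f i := [pick j | (R' j == R i)%MS].
have fP i : exists2 j, f i = Some j & (R' j :=: R i)%MS.
  rewrite /f; case: pickP => [j /eqmxP ? | no]; first by exists j.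
  by case: (ex i) => j /eqmxP; rewrite no.
suff inj_f : injective f.
  have: (#|[set f i | i in I]| <= #|[set Some j | j in I']|)%N.
    apply/subset_leq_card/subsetP=> _ /imsetP[i _ ->].
    by case: (fP i) => j -> _; apply: imset_f.
  by rewrite !card_imset //; apply: Some_inj.
move=> i i' eqf; case: (fP i) => j fi Ej; case: (fP i') => j'.
rewrite -eqf fi => -[<-] Ej'; apply/eqP; apply/idPn => ne.
case/negP: (nzR i); rewrite -submx0.
rewrite -(mxdirect_sumsP dxR i isT) sub_capmx submx_refl /=.
by rewrite (sumsmx_sup i') ?(eq_sym i') // -Ej -Ej'.
Qed.

Lemma algebra_iso_id (B : nzRingType) (iota : F -> B) m (R : 'A[F]_(m, n)) :
    algebra_iso iota R -> mxring R.
Proof.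
case=> f [injf fM fZ fR]; apply/andP; split.
  apply/mulsmx_subP=> X Y /fR[a <-] /fR[b <-].
  by apply/fR; exists (a * b).
apply/mxring_idP; exists (f 1); split.
- by rewrite -(raddf0 f) (inj_eq injf) oner_eq0.
- by apply/fR; exists 1.
- by move=> X /fR[a <-]; rewrite -fM mul1r.
by move=> X /fR[a <-]; rewrite -fM mulr1.
Qed.

Lemma field_algebra_simple m (R : 'A[F]_(m, n)) :
  is_field_algebra R -> simple_algebra R.
Proof.
case=> L isoR; split; first exact: algebra_iso_id isoR.
case: isoR => f [injf fM fZ fR] J sJR /andP[lJ rJ] nzJ.
have /rowV0Pn[v Jv nzv] := nzJ.
have JM: (vec_mx v \in J)%MS by rewrite vec_mxK.
have /fR[a fa]: (vec_mx v \in R)%MS by apply: submx_trans sJR.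
have nza: a != 0.
  apply: contraNneq nzv => a0; rewrite -(vec_mxK v) -fa a0.
  by rewrite raddf0 linear0.
apply/eqmxP; rewrite sJR; apply/memmx_subP=> X /fR[b <-].
rewrite -(mulr1 b) -(mulVf nza) mulrA fM fa (mulsmx_subP lJ) //.
by apply/fR; exists (b / a).
Qed.

(** Right multiplication by [Y] is injective on [V], with inverse [Y']. The elements of [V] commute
    with [C] and those of [V Y] anticommute with it, so [C] kills the intersection when 2 is
    invertible. *)
Lemma mxrank_twist (V : 'A[F]_n) C Y Y' :
    (2%:R : F) != 0 ->
    (forall X, (X \in V)%MS -> X *m Y *m Y' = X) ->
    (forall X, (X \in V)%MS -> C *m X = X *m C) ->
    (forall X, (X \in V)%MS -> C *m (X *m Y) = - (X *m Y *m C)) ->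
    (forall X, (X \in V)%MS -> X *m C = 0 -> X = 0) ->
  (\rank (V + V *m lin_mx (mulmxr Y))%MS = (2 * \rank V)%N).
Proof.
move=> nz2 VY cV aV injC.
have VYP X : (X \in V *m lin_mx (mulmxr Y))%MS -> exists2 Z, (Z \in V)%MS & X = Z *m Y.
  case/submxP=> u Du; exists (vec_mx (u *m V)); first by rewrite vec_mxK submxMl.
  by apply: (can_inj mxvecK); rewrite Du mulmxA mul_rV_lin /=.
rewrite mxrank_disjoint_sum ?mul2n -?addnn.
  congr (_ + _)%N; apply/eqP; rewrite eqn_leq mxrankM_maxl /=.
  have {1}->: V = V *m lin_mx (mulmxr Y) *m lin_mx (mulmxr Y').
    apply/row_matrixP=> i; rewrite -mulmxA !row_mul.
    have Vi: (vec_mx (row i V) \in V)%MS by rewrite vec_mxK row_sub.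
    by rewrite mulmxA !mul_rV_lin /= mxvecK VY // vec_mxK.
  exact: mxrankM_maxl.
apply/eqP; rewrite -submx0; apply/memmx_subP=> X.
rewrite sub_capmx => /andP[VX /VYP[Z VZ defX]].
suff ->: X = 0 by rewrite linear0 sub0mx.
apply: (injC X) => //; have := aV Z VZ; rewrite -defX cV // => /eqP.
by rewrite -subr_eq0 opprK -mulr2n -scaler_nat scaler_eq0 (negPf nz2) => /eqP.
Qed.

End MatrixAlgebras.

(** * Quaternion algebras *)

Section QuaternionAlgebras.

Local Open Scope ring_scope.

Variables (F : fieldType) (n : nat) (L : fieldExtType F).
Variable f : {additive L -> 'M[F]_n}.
Variables (X Y : 'M[F]_n) (a b : L) (R : 'A[F]_n).
Hypothesis nz2 : (2%:R : F) != 0.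
Hypothesis injf : injective f.
Hypothesis fM : forall u v, f (u * v) = f u *m f v.
Hypothesis fZ : forall k v, f (k%:A * v) = k *: f v.
Hypotheses (nza : a != 0) (nzb : b != 0).
Hypotheses (fX : f 1 *m X = X) (fY : f 1 *m Y = Y).
Hypothesis cX : forall u, X *m f u = f u *m X.
Hypothesis cY : forall u, Y *m f u = f u *m Y.
Hypotheses (XX : X *m X = f a) (YY : Y *m Y = f b) (YX : Y *m X = - (X *m Y)).

(** The general element of the quaternion algebra (a, b) over [L]. Scalars enter through [f], and
    the identity is the idempotent [f 1], which is why [f 1 *m X = X] is among the hypotheses. *)
Definition quat u0 u1 u2 u3 := f u0 + f u1 *m X + f u2 *m Y + f u3 *m (X *m Y).

Local Notation q := quat.

Hypothesis mulR : (R * R <= R)%MS.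
Hypothesis memR : forall M,
  (M \in R)%MS <-> exists u0 u1 u2 u3, M = q u0 u1 u2 u3.

Lemma quat_XM u0 u1 u2 u3 : X *m q u0 u1 u2 u3 = q (u1 * a) u0 (u3 * a) u2.
Proof.
rewrite /quat !mulmxDr !fM -XX !mulmxA !cX -!mulmxA.
by rewrite [LHS](ACl (2*1*4*3)).
Qed.

Lemma quat_MX u0 u1 u2 u3 : q u0 u1 u2 u3 *m X = q (u1 * a) u0 (- (u3 * a)) (- u2).
Proof.
rewrite /quat !mulmxDl !raddfN !fM -XX /= -!mulmxA YX !mulmxN !mulNmx -!mulmxA.
by rewrite [LHS](ACl (2*1*4*3)).
Qed.

Lemma quat_MY u0 u1 u2 u3 : q u0 u1 u2 u3 *m Y = q (u2 * b) (u3 * b) u0 u1.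
Proof.
rewrite /quat !mulmxDl !fM -!mulmxA YY cX.
by rewrite [LHS](ACl (3*4*1*2)).
Qed.

Lemma quat_YM u0 u1 u2 u3 : Y *m q u0 u1 u2 u3 = q (u2 * b) (- (u3 * b)) u0 (- u1).
Proof.
rewrite /quat !mulmxDr !raddfN !mulNmx !fM /= !mulmxA !cY -!mulmxA (mulmxA Y X Y) YX.
rewrite !mulmxN !mulNmx -!mulmxA YY cX.
by rewrite [LHS](ACl (3*4*1*2)) /= mulmxN.
Qed.

Lemma quat_D u0 u1 u2 u3 v0 v1 v2 v3 :
  q u0 u1 u2 u3 + q v0 v1 v2 v3 = q (u0 + v0) (u1 + v1) (u2 + v2) (u3 + v3).
Proof.
rewrite /quat !raddfD !mulmxDl.
by rewrite [RHS](AC (2*2*2*2) ((1*3*5*7)*(2*4*6*8))).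
Qed.

Lemma quat_fM w u0 u1 u2 u3 :
  f w *m q u0 u1 u2 u3 = q (w * u0) (w * u1) (w * u2) (w * u3).
Proof. by rewrite /quat !mulmxDr !fM !mulmxA. Qed.

Lemma quat_f u : f u = q u 0 0 0.
Proof. by rewrite /quat raddf0 !mul0mx !addr0. Qed.

Lemma mem_quat u0 u1 u2 u3 : (q u0 u1 u2 u3 \in R)%MS.
Proof. by apply/memR; exists u0, u1, u2, u3. Qed.

Lemma mem_quatX : (X \in R)%MS.
Proof. by apply/memR; exists 0, 1, 0, 0; rewrite /quat raddf0 !mul0mx fX add0r !addr0. Qed.

Lemma mem_quatY : (Y \in R)%MS.
Proof. by apply/memR; exists 0, 0, 1, 0; rewrite /quat raddf0 !mul0mx fY !add0r addr0. Qed.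

Lemma mem_quatf u : (f u \in R)%MS.
Proof. by rewrite quat_f mem_quat. Qed.

Section Ideal.

Variable J : 'A[F]_n.
Hypothesis idJ : mx_ideal R J.

Let JM M N : (M \in R)%MS -> (N \in J)%MS -> (M *m N \in J)%MS.
Proof. by case/andP: idJ => /mulsmx_subP lJ _; apply: lJ. Qed.

Let MJ M N : (M \in R)%MS -> (N \in J)%MS -> (N *m M \in J)%MS.
Proof. by case/andP: idJ => _ /mulsmx_subP rJ RM JN; apply: rJ. Qed.

Let JD M N : (M \in J)%MS -> (N \in J)%MS -> (M + N \in J)%MS.
Proof. by move=> *; rewrite linearD addmx_sub. Qed.

Let Jdiv (w u : L) : w != 0 -> (f (u * w)%R \in J)%MS -> (f u \in J)%MS.
Proof.
by move=> nzw /(MJ (mem_quatf w^-1)); rewrite -fM mulfK.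
Qed.

Let nz2L : (2%:R : L) != 0.
Proof. by rewrite -(rmorph_nat (in_alg L)) fmorph_eq0. Qed.

(* [qX + Xq] and then [(qX + Xq)Y + Y(qX + Xq)] kill all the coefficients but
   one. *)
Lemma quat_ideal_coef1 u0 u1 u2 u3 :
  (q u0 u1 u2 u3 \in J)%MS -> (f u1 \in J)%MS.
Proof.
move=> Jq; have := JD (MJ mem_quatX Jq) (JM mem_quatX Jq).
rewrite quat_MX quat_XM quat_D !addNr => Jq1.
have := MJ mem_quatY (JD (MJ mem_quatY Jq1) (JM mem_quatY Jq1)).
rewrite quat_MY quat_YM quat_D !mul0r oppr0 addr0 subrr quat_MY !mul0r -quat_f.
move/(Jdiv nzb); rewrite -mulr2n -mulr_natr => /(Jdiv nz2L).
by rewrite -mulr2n -mulr_natr => /(Jdiv nz2L) /(Jdiv nza).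
Qed.

(** Right multiplication by [X], by [Y] then [X], or by [Y] moves the coefficient [u0], [u2] or [u3]
    into position 1, up to a unit of [L]. *)
Lemma quat_ideal_coef u0 u1 u2 u3 : (q u0 u1 u2 u3 \in J)%MS ->
  [/\ f u0 \in J, f u1 \in J, f u2 \in J & f u3 \in J]%MS.
Proof.
move=> Jq; have JqX := MJ mem_quatX Jq; have JqY := MJ mem_quatY Jq.
split.
- by move: JqX; rewrite quat_MX => /quat_ideal_coef1.
- exact: quat_ideal_coef1 Jq.
- have:= MJ mem_quatX JqY; rewrite quat_MY quat_MX.
  by move/quat_ideal_coef1/(Jdiv nzb).
by move: JqY; rewrite quat_MY => /quat_ideal_coef1/(Jdiv nzb).
Qed.

End Ideal.

(** Independence of 1, X, Y, XY over [L] is the coefficient lemma applied to the zero ideal. *)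
Lemma quat_eq0 u0 u1 u2 u3 : q u0 u1 u2 u3 = 0 ->
  [/\ u0 = 0, u1 = 0, u2 = 0 & u3 = 0].
Proof.
move=> q0; pose J : 'A[F]_n := 0.
have f0 u : (f u \in J)%MS -> u = 0.
  by rewrite /J => /memmx0 fu0; apply: injf; rewrite raddf0.
have idJ: mx_ideal R J.
  apply/andP; split; apply/mulsmx_subP=> M N.
    by move=> _; rewrite /J => /memmx0->; rewrite mulmx0 linear0 sub0mx.
  by rewrite /J => /memmx0-> _; rewrite mul0mx linear0 sub0mx.
have Jq: (q u0 u1 u2 u3 \in J)%MS by rewrite q0 linear0 sub0mx.
by case: (quat_ideal_coef idJ Jq) => /f0 ? /f0 ? /f0 ? /f0 ?.
Qed.

Lemma quat_simple : simple_algebra R.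
Proof.
have id1 M : (M \in R)%MS -> f 1 *m M = M.
  by case/memR=> u0 [u1 [u2 [u3 ->]]]; rewrite quat_fM !mul1r.
have idr1 M : (M \in R)%MS -> M *m f 1 = M.
  case/memR=> u0 [u1 [u2 [u3 ->]]].
  by rewrite /quat !mulmxDl -!mulmxA !(cX, cY) fX fY -fM mulr1.
split.
  rewrite /mxring /left_mx_ideal mulR; apply/mxring_idP; exists (f 1).
  split=> //; last exact: mem_quatf.
  by rewrite -(raddf0 f) (inj_eq injf) oner_eq0.
move=> J sJR idJ nzJ; apply/eqmxP; rewrite sJR; apply/memmx_subP=> M RM.
suff J1: (f 1 \in J)%MS by case/andP: idJ => /mulsmx_subP lJ _; rewrite -(idr1 M) ?lJ.
have Jf u : (f u \in J)%MS -> u != 0 -> (f 1 \in J)%MS.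
  move=> Ju nzu; rewrite -(mulVf nzu) fM.
  by case/andP: idJ => /mulsmx_subP lJ _; rewrite lJ ?mem_quatf.
have /rowV0Pn[v Jv nzv] := nzJ.
have JN: (vec_mx v \in J)%MS by rewrite vec_mxK.
have /memR[u0 [u1 [u2 [u3 Du]]]]: (vec_mx v \in R)%MS by apply: submx_trans sJR.
rewrite Du in JN; case: (quat_ideal_coef idJ JN) => J0 J1 J2 J3.
have [z0|] := eqVneq u0 0; last exact: Jf.
have [z1|] := eqVneq u1 0; last exact: Jf.
have [z2|] := eqVneq u2 0; last exact: Jf.
have [z3|] := eqVneq u3 0; last exact: Jf.
case/eqP: nzv; rewrite -(vec_mxK v) Du z0 z1 z2 z3 -quat_f raddf0.
exact: linear0.
Qed.

Lemma quat_center M : (M \in 'Z(R))%MS <-> exists u, f u = M.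
Proof.
split=> [/center_mxP[/memR[u0 [u1 [u2 [u3 ->]]]] cR]|[u <-]]; last first.
  apply/center_mxP; split=> [|_ /memR[u0 [u1 [u2 [u3 ->]]]]]; first exact: mem_quatf.
  rewrite quat_fM /quat !mulmxDl -!mulmxA !(cX, cY) (mulmxA X (f u)) cX.
  by rewrite !mulmxA -!fM !(mulrC u).
have q0 v0 v1 v2 v3 w0 w1 w2 w3 : q v0 v1 v2 v3 = q w0 w1 w2 w3 ->
    [/\ v0 = w0, v1 = w1, v2 = w2 & v3 = w3].
  move=> E; have: q (v0 - w0) (v1 - w1) (v2 - w2) (v3 - w3) = 0.
    rewrite -quat_D E quat_D !subrr; exact: etrans (esym (quat_f 0)) (raddf0 f).
  by case/quat_eq0=> /subr0_eq-> /subr0_eq-> /subr0_eq-> /subr0_eq->.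
have two0 (u : L) : - u = u -> u = 0.
  move/eqP; rewrite -subr_eq0 -opprD oppr_eq0 -mulr2n -mulr_natr mulf_eq0.
  by rewrite -(rmorph_nat (in_alg L)) fmorph_eq0 (negPf nz2) orbF => /eqP.
(* Commuting with [X] kills [u2] and [u3]; commuting with [Y] kills [u1]. *)
have:= cR X mem_quatX; rewrite quat_MX quat_XM => /q0[_ _ E3 /esym/two0 z2].
have:= cR Y mem_quatY; rewrite quat_MY quat_YM => /q0[_ _ _ /two0 z1].
have /eqP := two0 _ (esym E3).
rewrite mulf_eq0 (negPf nza) orbF => /eqP z3.
by exists u0; rewrite z1 z2 z3 -quat_f.
Qed.

(** The rank doubles twice: from the centre Z to V = Z + Z X, where [Y] tells the two summands
    apart, then from V to V + V Y, where [X] does. *)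
Lemma quat_rank : \rank R = (4 * \rank 'Z(R)%MS)%N.
Proof.
pose Z := 'Z(R)%MS; pose V := (Z + Z *m lin_mx (mulmxr X))%MS.
pose W := (V + V *m lin_mx (mulmxr Y))%MS.
have memM (U : 'A[F]_n) T M :
    (M \in U *m lin_mx (mulmxr T))%MS <-> exists2 N, (N \in U)%MS & M = N *m T.
  split=> [/submxP[u Du]|[N /submxP[u Du] ->]].
    exists (vec_mx (u *m U)); first by rewrite vec_mxK submxMl.
    by apply: (can_inj mxvecK); rewrite Du mulmxA mul_rV_lin /=.
  by apply/submxP; exists u; rewrite mulmxA -Du mul_rV_lin /= mxvecK.
have memV M : (M \in V)%MS <-> exists u0 u1, M = f u0 + f u1 *m X.
  split=> [/memmx_addsP[[A B] /= [/quat_center[u <-] /memM[N /quat_center[v <-] ->] ->]]|].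
    by exists u, v.
  case=> u [v ->]; apply/memmx_addsP; exists (f u, f v *m X); split=> //=.
    by apply/quat_center; exists u.
  by apply/memM; exists (f v) => //; apply/quat_center; exists v.
have memW M : (M \in W)%MS <-> (M \in R)%MS.
  split=> [/memmx_addsP[[A B] /= [/memV[u0 [u1 ->]] /memM[N /memV[v0 [v1 ->]] ->] ->]]|].
    apply/memR; exists u0, u1, v0, v1.
    by rewrite /quat mulmxDl !mulmxA !addrA.
  case/memR=> u0 [u1 [u2 [u3 ->]]]; apply/memmx_addsP.
  exists (f u0 + f u1 *m X, (f u2 + f u3 *m X) *m Y); split=> /=.
  - by apply/memV; exists u0, u1.
  - by apply/memM; exists (f u2 + f u3 *m X) => //; apply/memV; exists u2, u3.
  by rewrite /quat mulmxDl !mulmxA !addrA.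
have ->: \rank R = \rank W.
  by apply: eqmx_rank; apply/memmx_eqP=> M; apply/idP/idP=> /memW.
have ->: \rank W = (2 * \rank V)%N.
  apply: (@mxrank_twist _ _ V X Y (Y *m f b^-1)) => // M /memV[u [v ->]].
  - by rewrite -mulmxA (mulmxA Y) YY -fM divff // mulmxDl -fM -mulmxA cX fX mulr1.
  - by rewrite mulmxDr mulmxDl cX mulmxA cX.
  - rewrite -!mulmxA YX mulmxN opprK !mulmxA; congr (_ *m _).
    by rewrite mulmxDr mulmxDl cX mulmxA cX.
  rewrite mulmxDl -mulmxA XX -fM => E.
  have: q (v * a) u 0 0 = 0 by rewrite /quat raddf0 !mul0mx !addr0 addrC.
  case/quat_eq0=> /eqP + -> _ _; rewrite mulf_eq0 (negPf nza) orbF => /eqP->.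
  by rewrite raddf0 mul0mx addr0.
rewrite (@mxrank_twist _ _ Z Y X (X *m f a^-1)) ?mulnA // => M /quat_center[u <-].
- by rewrite -mulmxA (mulmxA X) XX -!fM divff // mulr1.
- by rewrite cY.
- by rewrite mulmxA cY -mulmxA YX mulmxN mulmxA.
move=> E; have: q 0 0 u 0 = 0 by rewrite /quat raddf0 !mul0mx !add0r addr0.
by case/quat_eq0=> _ _ -> _; rewrite raddf0.
Qed.

Lemma quat_algebra : is_quaternion_algebra R.
Proof.
split; [exact: quat_simple | | exact: quat_rank].
by exists L, f; split=> // M; apply: quat_center.
Qed.

End QuaternionAlgebras.

(** * Splitting of quaternion algebras *)

Section SplitQuaternion.

Local Open Scope ring_scope.

Variables (F : fieldType) (n : nat) (L : fieldExtType F).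
Variable f : {additive L -> 'M[F]_n}.
Hypothesis nz2 : (2%:R : F) != 0.
Hypothesis injf : injective f.
Hypothesis fM : forall u v, f (u * v) = f u *m f v.
Hypothesis fZ : forall k v, f (k%:A * v) = k *: f v.

Section UnitSquare.

Variables (X Y : 'M[F]_n) (b : L) (R : 'A[F]_n).
Hypothesis nzb : b != 0.
Hypotheses (fX : f 1 *m X = X) (fY : f 1 *m Y = Y).
Hypothesis cX : forall u, X *m f u = f u *m X.
Hypothesis cY : forall u, Y *m f u = f u *m Y.
Hypotheses (XX : X *m X = f 1) (YY : Y *m Y = f b) (YX : Y *m X = - (X *m Y)).

Local Notation q := (quat f X Y).

Hypothesis memR : forall M,
  (M \in R)%MS <-> exists u0 u1 u2 u3, M = q u0 u1 u2 u3.

Let nz2L : (2%:R : L) != 0.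
Proof. by rewrite -(rmorph_nat (in_alg L)) fmorph_eq0. Qed.

Let qM u0 u1 u2 u3 v0 v1 v2 v3 :
  q u0 u1 u2 u3 *m q v0 v1 v2 v3 =
  q (u0 * v0 + u1 * v1 + b * u2 * v2 - b * u3 * v3)
    (u0 * v1 + u1 * v0 - b * u2 * v3 + b * u3 * v2)
    (u0 * v2 + u2 * v0 + u1 * v3 - u3 * v1)
    (u0 * v3 + u3 * v0 + u1 * v2 - u2 * v1).
Proof.
rewrite {1}/q !mulmxDl -!mulmxA.
rewrite (quat_YM fM cX cY YY YX) !(quat_XM Y fM cX XX) !(quat_fM _ _ fM).
by rewrite !quat_D; congr (q _ _ _ _); ring.
Qed.

(** Coordinates of a matrix in the basis 1, X, Y, XY when X is diag(1, -1) and Y has rows (0, 1) and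
    (b, 0), so that X^2 = 1 and Y^2 = b. *)
Definition split_quat (M : 'M[L]_2) : 'M[F]_n :=
  q ((M 0 0 + M 1 1) / 2%:R) ((M 0 0 - M 1 1) / 2%:R)
    ((M 0 1 + M 1 0 / b) / 2%:R) ((M 0 1 - M 1 0 / b) / 2%:R).

Fact split_quat_is_zmod_morphism : zmod_morphism split_quat.
Proof.
move=> M N; rewrite /split_quat !mxE.
have qB u0 u1 u2 u3 v0 v1 v2 v3 :
    q u0 u1 u2 u3 - q v0 v1 v2 v3 = q (u0 - v0) (u1 - v1) (u2 - v2) (u3 - v3).
  by apply/eqP; rewrite subr_eq quat_D !subrK.
by rewrite qB; congr (q _ _ _ _); field; rewrite ?nz2L ?nzb.
Qed.

HB.instance Definition _ := GRing.isZmodMorphism.Build _ _ split_quat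
  split_quat_is_zmod_morphism.

Lemma split_quat_iso : algebra_iso (fun k => (k%:A : L)%:M : 'M[L]_2) R.
Proof.
have half0 (u : L) : u / 2%:R = 0 -> u = 0.
  by move/eqP; rewrite mulf_eq0 invr_eq0 (negPf nz2L) orbF => /eqP.
have two0 (u : L) : u + u = 0 -> u = 0.
  by rewrite -mulr2n -mulr_natr => /eqP; rewrite mulf_eq0 (negPf nz2L) orbF => /eqP.
have ord2 (P : 'I_2 -> Prop) : P 0 -> P 1 -> forall i, P i.
  move=> P0 P1 [[|[|i]] lti] //.
    by rewrite (_ : Ordinal _ = 0) //; apply: val_inj.
  by rewrite (_ : Ordinal _ = 1) //; apply: val_inj.
exists split_quat; split.
- apply: raddf_inj => M E.
  have [] := quat_eq0 nz2 injf fM (oner_neq0 _) nzb fX fY cX cY XX YY YX memR E.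
  move=> /half0 e0 /half0 e1 /half0 e2 /half0 e3.
  have z0 : M 0 0 = 0 by apply: two0; rewrite -[RHS](addr0 0) -{1}e0 -e1; ring.
  have z1 : M 0 1 = 0 by apply: two0; rewrite -[RHS](addr0 0) -{1}e2 -e3; ring.
  move: e0 e2; rewrite z0 z1 !add0r => z3 /eqP.
  rewrite mulf_eq0 invr_eq0 (negPf nzb) orbF => /eqP z2.
  apply/matrixP=> i j; rewrite mxE; move: i j.
  by apply: (ord2 (fun i => forall j, M i j = 0)); apply: (ord2 (fun j => M _ j = 0)).
- move=> M N; rewrite /= /split_quat qM -mulmxE !mxE !big_ord_recl !big_ord0.
  rewrite (_ : lift ord0 ord0 = 1) ?addr0; last exact: val_inj.
  by congr (q _ _ _ _); field; rewrite ?nz2L ?nzb.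
- move=> k M; rewrite /= /split_quat -mulmxE mul_scalar_mx !mxE.
  have qZ u0 u1 u2 u3 : k *: q u0 u1 u2 u3 =
      q (k%:A * u0) (k%:A * u1) (k%:A * u2) (k%:A * u3).
    by rewrite /quat !fZ !scalerDr -!scalemxAl.
  by rewrite qZ; congr (q _ _ _ _); field; rewrite ?nz2L ?nzb.
move=> T; split=> [/memR[u0 [u1 [u2 [u3 ->]]]]|[M <-]]; last first.
  by apply/memR; do 4!eexists.
pose M := \matrix_(i < 2, j < 2) (if i == 0 then (if j == 0 then u0 + u1 else u2 + u3)
          else (if j == 0 then b * (u2 - u3) else u0 - u1)) : 'M[L]_2.
by exists M; rewrite /= /split_quat !mxE /=; congr (q _ _ _ _); field; rewrite ?nz2L ?nzb.
Qed.

End UnitSquare.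

(** The element p = cX + dY has square a c^2 + b d^2 = 1 and anticommutes with w = XY, whose square
    is -ab. Hence (a, b) is also (1, -ab), which is a matrix ring by [split_quat_iso]. *)
Lemma quat_split (X Y : 'M[F]_n) (a b : L) (R : 'A[F]_n) :
    a != 0 -> b != 0 -> f 1 *m X = X -> f 1 *m Y = Y ->
    (forall u, X *m f u = f u *m X) -> (forall u, Y *m f u = f u *m Y) ->
    X *m X = f a -> Y *m Y = f b -> Y *m X = - (X *m Y) ->
    (forall M, (M \in R)%MS <-> exists u0 u1 u2 u3, M = quat f X Y u0 u1 u2 u3) ->
    (exists c d : L, a * c ^+ 2 + b * d ^+ 2 = 1) ->
  is_matrix2_algebra R.
Proof.
move=> nza nzb fX fY cX cY XX YY YX memR [c [d cd1]].
have [p Dp]: exists p, p = f c *m X + f d *m Y by eexists.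
have [w Dw]: exists w, w = X *m Y by eexists.
have YfX u : Y *m (f u *m X) = - (f u *m (X *m Y)).
  by rewrite mulmxA cY -mulmxA YX mulmxN.
have wX : w *m X = - (f a *m Y).
  by rewrite Dw -mulmxA YX mulmxN mulmxA XX.
have Xw : X *m w = f a *m Y by rewrite Dw mulmxA XX.
have wY : w *m Y = f b *m X by rewrite Dw -mulmxA YY cX.
have Yw : Y *m w = - (f b *m X) by rewrite Dw mulmxA YX mulNmx -mulmxA YY cX.
have cw u : w *m f u = f u *m w by rewrite Dw -mulmxA cY mulmxA cX -mulmxA.
have ww : w *m w = f (- (a * b)).
  by rewrite {2}Dw mulmxA wX mulNmx -mulmxA YY -fM raddfN.
have fw : f 1 *m w = w by rewrite Dw mulmxA fX.
have pp : p *m p = f 1.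
  have E u v S T : (forall t, S *m f t = f t *m S) ->
      f u *m S *m (f v *m T) = f (u * v) *m (S *m T).
    by move=> cS; rewrite fM -!mulmxA (mulmxA S) cS !mulmxA.
  rewrite -cd1 Dp !mulmxDl !mulmxDr !E // XX YY YX !mulmxN -!fM (mulrC d c).
  by rewrite addrA addrK -raddfD; congr (f _); ring.
have wp : w *m p = - (p *m w).
  by rewrite Dp mulmxDr mulmxDl !mulmxA !cw -!mulmxA wX wY Xw Yw !mulmxN opprD opprK.
exists L; apply: (@split_quat_iso p w (- (a * b))) => //.
- by rewrite oppr_eq0 mulf_neq0.
- by rewrite Dp mulmxDr !mulmxA -!fM !mul1r.
- by move=> u; rewrite Dp mulmxDl mulmxDr -!mulmxA cX cY !mulmxA -!fM !(mulrC u).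
move=> M; rewrite memR.
have pw : p *m w = f (a * c) *m Y - f (b * d) *m X.
  by rewrite Dp mulmxDl -!mulmxA Xw Yw mulmxN !mulmxA -!fM (mulrC c) (mulrC d).
have E u0 v1 v2 v3 : quat f p w u0 v1 v2 v3 =
    quat f X Y u0 (v1 * c - v3 * (b * d)) (v1 * d + v3 * (a * c)) v2.
  rewrite /quat pw Dp -Dw !mulmxDr !mulmxN !mulmxA -!fM raddfB raddfD !mulmxDl mulNmx.
  rewrite -!addrA; congr (_ + (_ + _)).
  by rewrite !addrA [LHS](ACl (4*1*3*2)).
split=> [[u0 [u1 [u2 [u3 ->]]]]|[u0 [u1 [u2 [u3 ->]]]]]; last first.
  by rewrite E; do 4!eexists.
(* In [E] the pair (v1, v3) determines the coefficients of X and Y by a 2 by 2 matrix of determinant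
   a c^2 + b d^2 = 1; this is its inverse. *)
exists u0, (u1 * a * c + u2 * b * d), u3, (u2 * c - u1 * d); rewrite E.
congr (quat _ _ _ _ _ _ _).
  by rewrite -[LHS]mulr1 -cd1; ring.
by rewrite -[LHS]mulr1 -cd1; ring.
Qed.

End SplitQuaternion.

(** * Group rings and Galois orbits of characters *)

Section GaloisDescent.

Local Open Scope ring_scope.

Variables (F : fieldType) (E : splittingFieldType F).
Hypothesis galE : galois 1 {:E}.

(** A retraction of the inclusion of [F] in [E]. Its values are meaningful only on [F], but being
    [F]-linear on all of [E] it passes through sums whose single terms are not Galois invariant. *)
Definition descend (u : E) : F := coord [tuple 1] ord0 u.

HB.instance Definition _ :=
  GRing.isSemilinear.Build F E F _ descend
    (GRing.semilinear_linear (@coord_is_scalar F E 1 [tuple 1] ord0)).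

Lemma descend_alg k : descend k%:A = k.
Proof.
rewrite /descend linearZ /= -[X in coord _ _ X]/([tuple (1 : E)]`_(ord0 : 'I_1)).
by rewrite coord_free ?seq1_free ?oner_neq0 // eqxx; apply: mulr1.
Qed.

Lemma descendK n (A : 'M[E]_n) :
    (forall x : gal_of {:E}, x \in 'Gal({:E} / 1)%g -> map_mx x A = A) ->
  map_mx (in_alg E) (map_mx descend A) = A.
Proof.
move=> fixA; apply/matrixP=> i j; rewrite !mxE /=.
have: A i j \in fixedField 'Gal({:E} / 1)%g.
  apply/fixedFieldP=> [|x Gx]; first exact: memvf.
  by rewrite -{2}(fixA x Gx) mxE.
have -> := galois_fixedField galE; case/vlineP=> k ->.
by rewrite descend_alg.
Qed.

Lemma map_descend_lin n (I : finType) (P : pred I) (c : I -> E) (A : I -> 'M[F]_n) :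
  map_mx descend (\sum_(i | P i) c i *: map_mx (in_alg E) (A i)) =
  \sum_(i | P i) descend (c i) *: A i.
Proof.
apply/matrixP=> i j; rewrite mxE !summxE raddf_sum; apply: eq_bigr => k _.
by rewrite !mxE /= mulrC -scalerAl mul1r linearZ mulrC.
Qed.

Variables (gT : finGroupType) (G H : {group gT}).
Hypothesis sHG : H \subset G.
Hypothesis nzG : (#|G|%:R : F) != 0.

Local Notation aF := (regular_repr F G).
Local Notation aE := (regular_repr E G).

Variables (bT : finType) (S : {set bT}) (chi : bT -> gT -> E).
Hypothesis chi1 : forall b, b \in S -> chi b 1%g = 1.
Hypothesis chiM : forall b, b \in S ->
  {in H &, forall g h, chi b (g * h)%g = chi b g * chi b h}.
Hypothesis chi_inj : {in S &, forall b c, {in H, chi b =1 chi c} -> b = c}.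
Hypothesis chi_gal : forall (x : gal_of {:E}) b, x \in 'Gal({:E} / 1)%g ->
  b \in S -> exists2 c, c \in S & forall h, h \in H -> x (chi b h) = chi c h.

Definition gal_conj (b c : bT) : bool :=
  [exists (x | x \in 'Gal({:E} / 1)%g), [forall h in H, x (chi b h) == chi c h]].

Lemma gal_conjP b c :
  reflect (exists2 x : gal_of {:E}, x \in 'Gal({:E} / 1)%g
             & forall h, h \in H -> x (chi b h) = chi c h) (gal_conj b c).
Proof.
apply: (iffP exists_inP) => [[x Gx /forall_inP e]|[x Gx e]]; exists x => //.
  by move=> h /e/eqP.
by apply/forall_inP=> h /e ->.
Qed.

Let nzH : (#|H|%:R : E) != 0.
Proof.
rewrite -(rmorph_nat (in_alg E)) fmorph_eq0.
by apply: contraNneq nzG => H0; rewrite -(Lagrange sHG) natrM H0 mul0r.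
Qed.

Let aFE h : map_mx (in_alg E) (aF h) = aE h.
Proof. exact: map_regular_mx. Qed.

(** The idempotent of the group algebra of [H] attached to the linear character [chi b], inside the
    regular representation of [G]. *)
Definition chi_idem b : 'M[E]_#|G| :=
  #|H|%:R^-1 *: \sum_(h in H) chi b h^-1%g *: aE h.

Local Notation e := chi_idem.

Let GH h : h \in H -> h \in G. Proof. exact: subsetP. Qed.

Lemma mul_chi_idem b h : b \in S -> h \in H -> aE h *m e b = chi b h *: e b.
Proof.
move=> Sb Hh; rewrite /e -scalemxAr scalerA mulrC -scalerA; congr (_ *: _).
rewrite mulmx_sumr scaler_sumr (reindex_inj (mulgI h^-1%g)) /=.
apply: eq_big => [g | g Hg]; first by rewrite groupMl ?groupV.
have Hg' : g \in H by rewrite groupMl ?groupV in Hg.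
by rewrite -scalemxAr -repr_mxM ?GH // ?groupM ?groupV // mulKVg scalerA invMg invgK
  chiM ?groupV // mulrC.
Qed.

Lemma chi_idem_mul b h : b \in S -> h \in H -> e b *m aE h = chi b h *: e b.
Proof.
move=> Sb Hh; rewrite /e -scalemxAl scalerA mulrC -scalerA; congr (_ *: _).
rewrite mulmx_suml scaler_sumr (reindex_inj (mulIg h^-1%g)) /=.
apply: eq_big => [g | g Hg]; first by rewrite groupMr ?groupV.
have Hg' : g \in H by rewrite groupMr ?groupV in Hg.
by rewrite -scalemxAl -repr_mxM ?GH // ?mulgKV ?scalerA // invMg invgK chiM ?groupV.
Qed.

Lemma chi_orthogonal b c : b \in S -> c \in S ->
  \sum_(h in H) chi b h^-1%g * chi c h = if b == c then #|H|%:R else 0.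
Proof.
move=> Sb Sc; case: eqP => [-> | ne].
  rewrite -sum1_card natr_sum; apply: eq_bigr => h Hh.
  by rewrite -chiM ?groupV // mulVg chi1.
have [g Hg neg]: exists2 g, g \in H & chi b g != chi c g.
  apply/exists_inP; apply: contra_notT ne; rewrite negb_exists_in => /forall_inP E'.
  by apply: chi_inj => // h Hh; apply/eqP; have := E' h Hh; rewrite negbK.
(* The sum is multiplied by the nonzero [chi b g - chi c g]; the substitution of g h for h shows
   that the product vanishes. *)
apply/eqP; rewrite -(mulIr_eq0 _ (mulIf (_ : chi b g - chi c g != 0))) ?subr_eq0 //.
rewrite mulrBr subr_eq0; apply/eqP; rewrite !mulr_suml.
rewrite [LHS](reindex_inj (mulgI g)) /=.
apply: eq_big => [h | h Hh]; first by rewrite groupMl.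
have Hh' : h \in H by rewrite groupMl in Hh.
have k: chi b g^-1%g * chi b g = 1 by rewrite -chiM ?groupV // mulVg chi1.
by rewrite invMg !chiM ?groupV // -[RHS]mul1r -k; ring.
Qed.

Lemma chi_idemM b c : b \in S -> c \in S ->
  e b *m e c = if b == c then e b else 0.
Proof.
move=> Sb Sc; rewrite {1}/e -scalemxAl mulmx_suml.
under eq_bigr => h Hh do rewrite -scalemxAl mul_chi_idem // scalerA.
rewrite -scaler_suml chi_orthogonal //; case: eqP => [-> | _].
  by rewrite scalerA mulVf // scale1r.
by rewrite scale0r scaler0.
Qed.

(** Its coefficient at the identity of the group, read off by [gring_proj 1], is the inverse of
    [#|H|]. *)
Lemma chi_idem_neq0 b : b \in S -> e b != 0.
Proof.
move=> Sb; apply: contraNneq (oner_neq0 E) => /(congr1 (gring_proj 1%g)).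
rewrite linear0 linearZ linear_sum (bigD1 1%g) //= big1 => [|h /andP[Hh ne]].
  rewrite linearZ /= gring_projE // eqxx invg1 chi1 // scale1r addr0.
  move/matrixP/(_ 0 0); rewrite !mxE /= mulr1 => /eqP.
  by rewrite invr_eq0 (negPf nzH).
by rewrite linearZ /= gring_projE ?GH // eq_sym (negPf ne) scaler0.
Qed.

(** The index of the conjugate character; by [chi_actP] the default [b] is never reached for a
    Galois [x] and [b] in [S]. *)
Definition chi_act (x : gal_of {:E}) b : bT :=
  odflt b [pick c in S | [forall h in H, x (chi b h) == chi c h]].

Lemma chi_actP x b : x \in 'Gal({:E} / 1)%g -> b \in S ->
  chi_act x b \in S /\ forall h, h \in H -> x (chi b h) = chi (chi_act x b) h.
Proof.
move=> Gx Sb; rewrite /chi_act; case: pickP => [c /andP[Sc /forall_inP e']|no].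
  by split=> // h /e'/eqP.
have [c Sc e'] := chi_gal Gx Sb.
have /negP[] := negbT (no c); rewrite Sc; apply/forall_inP=> h Hh.
by rewrite e'.
Qed.

Lemma chi_act_inj x : x \in 'Gal({:E} / 1)%g -> {in S &, injective (chi_act x)}.
Proof.
move=> Gx b c Sb Sc eqx; apply: chi_inj => // h Hh; apply: (fmorph_inj x).
have [_ e1] := chi_actP Gx Sb; have [_ e2] := chi_actP Gx Sc.
by apply: etrans (e1 h Hh) _; rewrite eqx -e2.
Qed.

Lemma map_chi_idem x b : x \in 'Gal({:E} / 1)%g -> b \in S ->
  map_mx x (e b) = e (chi_act x b).
Proof.
move=> Gx Sb; rewrite /e map_mxZ fmorphV rmorph_nat; congr (_ *: _).
rewrite raddf_sum; apply: eq_bigr => h Hh /=; rewrite map_mxZ.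
have [_ <-] := chi_actP Gx Sb; last by rewrite groupV.
by congr (_ *: _); apply: map_regular_mx.
Qed.

Lemma gal_conj_refl b : gal_conj b b.
Proof. by apply/gal_conjP; exists 1%g => // h _; rewrite gal_id. Qed.

Lemma gal_conj_act x b c : x \in 'Gal({:E} / 1)%g -> c \in S ->
  gal_conj b c -> gal_conj b (chi_act x c).
Proof.
move=> Gx Sc /gal_conjP[y Gy e']; apply/gal_conjP; exists (y * x)%g.
  by rewrite groupM.
by move=> h Hh; rewrite galM ?memvf // e' //; case: (chi_actP Gx Sc) => _ ->.
Qed.

Definition chi_orbit b : {set bT} := [set c in S | gal_conj b c].

Lemma chi_act_orbit x b : x \in 'Gal({:E} / 1)%g -> chi_act x @: chi_orbit b = chi_orbit b.
Proof.
move=> Gx; apply/eqP; rewrite eqEcard card_in_imset => [|c d]; last first.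
  by rewrite !inE => /andP[Sc _] /andP[Sd _]; apply: chi_act_inj.
rewrite leqnn andbT; apply/subsetP=> _ /imsetP[c + ->]; rewrite !inE.
by case/andP=> Sc cc; rewrite gal_conj_act //; case: (chi_actP Gx Sc) => ->.
Qed.

Section OrbitField.

Variable b0 : bT.
Hypothesis Sb0 : b0 \in S.

(** The fixed field [L] of this stabilizer contains the values of [chi b0] and will be the field
    attached to the orbit. *)
Let Stab := [set x : gal_of {:E} in 'Gal({:E} / 1)%g | [forall h in H, x (chi b0 h) == chi b0 h]].
Let L := subvs_of (fixedField Stab).

Let tau b : gal_of {:E} :=
  odflt 1%g [pick x in 'Gal({:E} / 1)%g | [forall h in H, x (chi b0 h) == chi b h]].

Let tauP b : b \in chi_orbit b0 -> tau b \in 'Gal({:E} / 1)%g /\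
  forall h, h \in H -> tau b (chi b0 h) = chi b h.
Proof.
rewrite inE => /andP[_ /gal_conjP[x Gx e']]; rewrite /tau.
case: pickP => [y /andP[Gy /forall_inP ey]|no].
  by split=> // h /ey/eqP.
have /negP[] := negbT (no x); rewrite Gx; apply/forall_inP=> h Hh.
by rewrite e'.
Qed.

Let orbS b : b \in chi_orbit b0 -> b \in S. Proof. by rewrite inE => /andP[]. Qed.

(** The embedding of [L] in the group algebra over [E]: on the factor of a conjugate character
    [chi b], [u] acts by its conjugate under the element [tau b] that carries [chi b0] to
    [chi b]. *)
Let Phi (u : E) := \sum_(b in chi_orbit b0) tau b u *: e b.

(** [x] permutes the idempotents of the orbit. The two Galois elements [tau b * x] and
    [tau (chi_act x b)] both carry [chi b0] to the same character, so they differ by an element of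
    [Stab], which fixes [u]. *)
Let Phi_fix x u : x \in 'Gal({:E} / 1)%g -> u \in fixedField Stab -> map_mx x (Phi u) = Phi u.
Proof.
move=> Gx /mem_fixedFieldP[_ fixu].
rewrite /Phi raddf_sum -{2}(chi_act_orbit b0 Gx) big_imset /=; last first.
  by move=> c d /orbS Sc /orbS Sd; apply: chi_act_inj.
apply: eq_bigr => b Ob; have Sb := orbS Ob; rewrite map_mxZ map_chi_idem //.
have Oxb: chi_act x b \in chi_orbit b0 by rewrite -(chi_act_orbit b0 Gx) imset_f.
have [Gt tE] := tauP Ob; have [Gt' tE'] := tauP Oxb.
congr (_ *: _); transitivity ((tau b * x)%g u); first by rewrite galM ?memvf.
set t' := tau (chi_act x b) in Gt' tE' *.
have St: (tau b * x * t'^-1)%g \in Stab.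
  rewrite inE !groupM ?groupV //=; apply/forall_inP=> h Hh; apply/eqP.
  rewrite !galM ?memvf // tE //; have [_ ->] := chi_actP Gx Sb; rewrite // -tE' //.
  by rewrite -galM ?memvf // mulgV gal_id.
by rewrite -[in RHS](fixu _ St) -galM ?memvf // mulgKV.
Qed.

Definition orbit_idem : 'M[F]_#|G| := map_mx descend (\sum_(b in chi_orbit b0) e b).

Let f (u : L) : 'M[F]_#|G| := map_mx descend (Phi (vsval u)).

Fact f_is_zmod_morphism : zmod_morphism f.
Proof.
move=> u v; rewrite /f -raddfB; congr (map_mx _ _).
by rewrite /Phi -sumrB; apply: eq_bigr => b _; rewrite -scalerBl -raddfB.
Qed.

HB.instance Definition _ := GRing.isZmodMorphism.Build L _ f f_is_zmod_morphism.

Let iota := map_mx (in_alg E) : 'M[F]_#|G| -> 'M[E]_#|G|.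

Let iota_inj : injective iota.
Proof. exact: map_mx_inj. Qed.

Let iota_f u : iota (f u) = Phi (vsval u).
Proof. by apply: descendK => x Gx; apply: Phi_fix => //; apply: subvsP. Qed.

Let PhiM u v : Phi u *m Phi v = Phi (u * v).
Proof.
rewrite /Phi mulmx_suml; apply: eq_bigr => b Ob; rewrite mulmx_sumr (bigD1 b) //=.
rewrite big1 => [|c /andP[Oc ne]].
  by rewrite -scalemxAl -scalemxAr chi_idemM ?orbS // eqxx scalerA -rmorphM addr0.
rewrite -scalemxAl -scalemxAr chi_idemM ?orbS //.
by rewrite eq_sym (negPf ne) !scaler0.
Qed.

Let orb_refl : b0 \in chi_orbit b0.
Proof. by rewrite inE Sb0 gal_conj_refl. Qed.

Let vsval1 : vsval (1 : L) = 1.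
Proof. exact: rmorph1. Qed.

Let f1 : f 1 = orbit_idem.
Proof.
rewrite /f /orbit_idem; congr (map_mx _ _); apply: eq_bigr => b Ob.
by rewrite vsval1 rmorph1 scale1r.
Qed.

Lemma orbit_field : exists (L : fieldExtType F) (f : {additive L -> 'M[F]_#|G|}),
  [/\ injective f, forall u v, f (u * v) = f u *m f v,
      forall k v, f (k%:A * v) = k *: f v, f 1 = orbit_idem &
      (forall h, h \in H -> exists u, f u = aF h *m f 1) /\
      (forall u, exists c : gT -> F, f u = \sum_(h in H) c h *: aF h)].
Proof.
exists L, f; split.
- apply: raddf_inj => u fu0; apply: val_inj => /=.
  (* Multiplying by [e b0] isolates one term, whose coefficient is a Galois conjugate of [u]. *)
  have: Phi (vsval u) *m e b0 = 0 by rewrite -iota_f /= fu0 /iota map_mx0 mul0mx.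
  rewrite /Phi mulmx_suml (bigD1 b0) //= big1 => [|c /andP[Oc ne]]; last first.
    by rewrite -scalemxAl chi_idemM ?orbS // (negPf ne) scaler0.
  rewrite -scalemxAl chi_idemM // eqxx addr0 => /eqP.
  by rewrite scaler_eq0 (negPf (chi_idem_neq0 Sb0)) orbF fmorph_eq0 => /eqP.
- move=> u v; apply: iota_inj; rewrite iota_f /iota map_mxM -!/(iota _) !iota_f.
  by rewrite PhiM.
- move=> k v; apply: iota_inj; rewrite iota_f /iota map_mxZ -!/(iota _) iota_f.
  rewrite /Phi scaler_sumr; apply: eq_bigr => b _; rewrite [RHS]scalerA.
  congr (_ *: e b); rewrite mulr_algl; transitivity (k *: tau b (vsval v)).
    by rewrite -linearZ.
  by rewrite /= mulr_algl.
- exact: f1.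
split=> [h Hh | u].
  have Lh: chi b0 h \in fixedField Stab.
    apply/fixedFieldP=> [|x]; first exact: memvf.
    by rewrite inE => /andP[_ /forall_inP/(_ h Hh)/eqP].
  exists (Subvs Lh); apply: iota_inj; rewrite iota_f /iota map_mxM -!/(iota _) iota_f vsval1 /=.
  rewrite /iota aFE /Phi mulmx_sumr; apply: eq_bigr => b Ob.
  rewrite rmorph1 scale1r mul_chi_idem ?orbS //.
  by have [_ ->] := tauP Ob.
(* The coefficient of [h] in [Phi u], after expanding each idempotent. *)
exists (fun h => descend (\sum_(b in chi_orbit b0) tau b (vsval u) * (#|H|%:R^-1 * chi b h^-1%g))).
rewrite /f -map_descend_lin; congr (map_mx _ _).
rewrite /Phi /e; under [RHS]eq_bigr do rewrite aFE scaler_suml.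
rewrite [RHS]exchange_big; apply: eq_bigr => b Ob /=.
by rewrite !scaler_sumr; apply: eq_bigr => h Hh; rewrite !scalerA mulrA.
Qed.

Lemma orbit_idemE : map_mx (in_alg E) orbit_idem = \sum_(b in chi_orbit b0) e b.
Proof.
rewrite -f1 -/(iota (f 1)) iota_f vsval1; apply: eq_bigr => b _.
by rewrite rmorph1 scale1r.
Qed.

(** Identifies the image of the field exactly: it is the group algebra of [H] over [F] cut by the
    orbit idempotent. *)
Lemma orbit_field_span :
  exists (L : fieldExtType F) (f : {additive L -> 'M[F]_#|G|}),
  [/\ injective f, forall u v, f (u * v) = f u *m f v,
      forall k v, f (k%:A * v) = k *: f v, f 1 = orbit_idem &
      (forall u, exists c : gT -> F, f u = \sum_(h in H) c h *: aF h) /\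
      (forall M, (exists u, f u = M) <->
        exists c : gT -> F, M = (\sum_(h in H) c h *: aF h) *m orbit_idem)].
Proof.
have [K [g [injg gM gZ g1 [gH gc]]]] := orbit_field.
exists K, g; split=> //; split=> // M; split=> [[u <-]|[c ->]].
  by have [c Dc] := gc u; exists c; rewrite -Dc -g1 -gM mulr1.
have /fin_all_exists[v Dv] (h : gT) : exists v, h \in H -> g v = aF h *m orbit_idem.
  case Hh: (h \in H); last by exists 0.
  by have [v Dv] := gH h Hh; exists v; rewrite Dv g1.
exists (\sum_(h in H) (c h)%:A * v h); rewrite raddf_sum mulmx_suml.
by apply: eq_bigr => h Hh; rewrite gZ Dv // -scalemxAl.
Qed.

End OrbitField.

End GaloisDescent.

(** * Field and quaternion components of the group ring *)

Section GroupRingDecomposition.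

Local Open Scope ring_scope.

Variables (F : fieldType) (E : splittingFieldType F).
Hypothesis galE : galois 1 {:E}.
Variables (gT : finGroupType) (G Z : {group gT}) (s x y : gT).
Hypothesis nzG : (#|G|%:R : F) != 0.
Hypothesis nz2 : (2%:R : F) != 0.
Hypothesis sZG : Z \subset 'Z(G)%g.
Hypotheses (Zs : s \in Z) (Gx : x \in G) (Gy : y \in G).
Hypotheses (Zx2 : (x * x)%g \in Z) (Zy2 : (y * y)%g \in Z).
Hypothesis yx : (y * x = s * (x * y))%g.
Hypothesis cosets : forall g, g \in G ->
  exists2 z, z \in Z & [\/ g = z, g = (z * x)%g, g = (z * y)%g | g = (z * (x * y))%g].

Local Notation aF := (regular_repr F G).
Local Notation aE := (regular_repr E G).

Let sZG' : Z \subset G. Proof. exact: subset_trans sZG (center_sub G). Qed.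

Section Characters.

Variables (H : {group gT}) (bT : finType) (S : {set bT}) (chi : bT -> gT -> E).

Definition galois_characters : Prop :=
  [/\ forall b, b \in S -> chi b 1%g = 1,
      forall b, b \in S -> {in H &, forall g h, chi b (g * h)%g = chi b g * chi b h},
      {in S &, forall b c, {in H, chi b =1 chi c} -> b = c}
    & forall (u : gal_of {:E}) b, u \in 'Gal({:E} / 1)%g ->
        b \in S -> exists2 c, c \in S & forall h, h \in H -> u (chi b h) = chi c h].

(** Uniqueness is stated through a common member [b] of two orbits, the form in which orthogonality
    of the orbit idempotents and the computation of their sum consume it. *)
Definition orbit_reps (I : finType) (rep : I -> bT) : Prop :=
  [/\ forall i, rep i \in S,
      forall b, b \in S -> exists i, gal_conj H chi (rep i) b
    & forall i j b, b \in S -> gal_conj H chi (rep i) b -> gal_conj H chi (rep j) b ->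
        i = j].

Hypothesis chiP : galois_characters.
Hypothesis sHG : H \subset G.
Hypothesis central : forall g b, g \in G -> b \in S ->
  aE g *m chi_idem G H chi b = chi_idem G H chi b *m aE g.
Variables (I : finType) (rep : I -> bT).
Hypothesis repP : orbit_reps rep.

Local Notation eps i := (orbit_idem G H S chi (rep i)).

Let repS i : rep i \in S. Proof. by case: repP. Qed.

Let inj_iota : injective (map_mx (in_alg E) : 'M[F]_#|G| -> _).
Proof. exact: map_mx_inj. Qed.

Let aFE g : map_mx (in_alg E) (aF g) = aE g.
Proof. exact: map_regular_mx. Qed.

Let epsE i : map_mx (in_alg E) (eps i) =
  \sum_(b in chi_orbit H S chi (rep i)) chi_idem G H chi b.
Proof. by case: chiP => *; apply: orbit_idemE. Qed.

Let orbS i b : b \in chi_orbit H S chi (rep i) -> b \in S.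
Proof. by rewrite inE => /andP[]. Qed.

Lemma orbit_idem_idem i : eps i *m eps i = eps i.
Proof.
case: chiP => c1 cM cI cG.
apply: inj_iota; rewrite map_mxM epsE mulmx_suml; apply: eq_bigr => b Ob.
rewrite mulmx_sumr (bigD1 b) //= big1 => [|c /andP[Oc ne]].
  by rewrite (chi_idemM sHG nzG c1 cM cI) ?(orbS Ob) // eqxx addr0.
by rewrite (chi_idemM sHG nzG c1 cM cI) ?(orbS Ob) ?(orbS Oc) // eq_sym (negPf ne).
Qed.

Lemma orbit_idem_orth i j : i != j -> eps i *m eps j = 0.
Proof.
case: chiP => c1 cM cI cG ij.
apply: inj_iota; rewrite map_mxM !epsE map_mx0 mulmx_suml big1 // => b Ob.
rewrite mulmx_sumr big1 // => c Oc.
rewrite (chi_idemM sHG nzG c1 cM cI) ?(orbS Ob) ?(orbS Oc) //; case: eqP => // bc.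
case/eqP: ij; case: repP => _ _ un; move: Ob Oc; rewrite -bc !inE.
by case/andP=> Sb ib /andP[_ jb]; apply: un ib jb.
Qed.

Lemma orbit_idem_central i g : g \in G -> aF g *m eps i = eps i *m aF g.
Proof.
move=> Gg; apply: inj_iota; rewrite !map_mxM aFE epsE mulmx_sumr mulmx_suml.
by apply: eq_bigr => b Ob; rewrite central // (orbS Ob).
Qed.

Lemma orbit_idem_scalar i (k : F) h : h \in H -> (forall b, b \in S -> chi b h = k%:A) ->
  aF h *m eps i = k *: eps i.
Proof.
case: chiP => c1 cM cI cG Hh ck.
apply: inj_iota; rewrite map_mxM map_mxZ aFE !epsE mulmx_sumr scaler_sumr.
by apply: eq_bigr => b Ob; rewrite (mul_chi_idem sHG cM) ?(orbS Ob) // ck // (orbS Ob).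
Qed.

Lemma sum_orbit_idem : map_mx (in_alg E) (\sum_i eps i) = \sum_(b in S) chi_idem G H chi b.
Proof.
case: repP => _ ex un.
rewrite raddf_sum /=; under eq_bigr do rewrite epsE.
rewrite (exchange_big_dep (fun b => b \in S)) /= => [|i b _]; last exact: orbS.
apply: eq_bigr => b Sb; have [i ib] := ex b Sb.
rewrite (big_pred1 i) // => j; rewrite inE Sb /=.
by apply/idP/eqP=> [jb | ->]; [apply: un jb ib |].
Qed.

Lemma orbit_span i :
  exists (L : fieldExtType F) (f : {additive L -> 'M[F]_#|G|}),
  [/\ injective f, forall u v, f (u * v) = f u *m f v,
      forall k v, f (k%:A * v) = k *: f v, f 1 = eps i &
      (forall u, exists c : gT -> F, f u = \sum_(h in H) c h *: aF h) /\
      (forall M, (exists u, f u = M) <->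
        exists c : gT -> F, M = (\sum_(h in H) c h *: aF h) *m eps i)].
Proof. by case: chiP => *; apply: orbit_field_span. Qed.

Lemma sum_mem_group_ring (c : gT -> F) : (\sum_(h in H) c h *: aF h \in group_ring F G)%MS.
Proof.
rewrite linear_sum summx_sub // => h Hh.
by rewrite linearZ scalemx_sub //= envelop_mx_id // (subsetP sHG).
Qed.

Lemma mem_orbit_idem i : (eps i \in group_ring F G)%MS.
Proof.
have [L [f [_ _ _ <- [/(_ 1)[c ->] _]]]] := orbit_span i.
exact: sum_mem_group_ring.
Qed.

Lemma orbit_idem_center i M : (M \in group_ring F G)%MS -> M *m eps i = eps i *m M.
Proof.
case/envelop_mxP=> c ->; rewrite mulmx_suml mulmx_sumr; apply: eq_bigr => g Gg.
by rewrite -scalemxAl orbit_idem_central // scalemxAr.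
Qed.

Lemma mem_orbit_component i M :
  (M \in group_ring F G * mxvec (eps i))%MS = (M \in group_ring F G)%MS && (M *m eps i == M).
Proof.
apply: mem_corner; [exact/mulsmx_subP/envelop_mxM | exact: mem_orbit_idem |].
exact: orbit_idem_idem.
Qed.

End Characters.

Section Linear.

Variables (bT : finType) (S : {set bT}) (chi : bT -> gT -> E).
Hypothesis chiP : galois_characters G S chi.

Lemma linear_idem_central g b : g \in G -> b \in S ->
  aE g *m chi_idem G G chi b = chi_idem G G chi b *m aE g.
Proof.
by case: chiP => c1 cM cI cG Gg Sb; rewrite (mul_chi_idem _ cM) // (chi_idem_mul _ cM).
Qed.

Variables (I : finType) (rep : I -> bT).
Hypothesis repP : orbit_reps G S chi rep.

Lemma linear_component i :
  is_field_algebra (group_ring F G * mxvec (orbit_idem G G S chi (rep i)))%MS.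
Proof.
have [L [f [injf fM fZ f1 [fc fspan]]]] := orbit_span chiP (subxx _) repP i.
exists L, f; split=> // M.
rewrite (mem_orbit_component chiP) //; split=> [/andP[/envelop_mxP[c ->] /eqP<-]|Mf].
  by apply/fspan; exists c.
have /fspan[c DM] := Mf; case: Mf => u Du; apply/andP; split.
  by rewrite -Du; have [d ->] := fc u; apply: sum_mem_group_ring.
by rewrite DM -mulmxA (orbit_idem_idem chiP (subxx _)).
Qed.

End Linear.

Section Quaternion.

Variables (bT : finType) (S : {set bT}) (chi : bT -> gT -> E).
Hypothesis chiP : galois_characters Z S chi.
Hypothesis chis : forall b, b \in S -> chi b s = - 1.
Variables (I : finType) (rep : I -> bT).
Hypothesis repP : orbit_reps Z S chi rep.

Let commZ g h : g \in G -> h \in Z -> aF g *m aF h = aF h *m aF g.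
Proof.
move=> Gg Zh; have /centerP[Gh cGh] := subsetP sZG h Zh.
by rewrite -!repr_mxM // cGh.
Qed.

Lemma quaternion_idem_central g b : g \in G -> b \in S ->
  aE g *m chi_idem G Z chi b = chi_idem G Z chi b *m aE g.
Proof.
move=> Gg Sb; rewrite /chi_idem -scalemxAr -scalemxAl; congr (_ *: _).
rewrite mulmx_sumr mulmx_suml; apply: eq_bigr => h Zh.
rewrite -scalemxAr -scalemxAl; congr (_ *: _).
have /centerP[Gh cGh] := subsetP sZG h Zh.
by rewrite -!repr_mxM // cGh.
Qed.

Local Notation eps i := (orbit_idem G Z S chi (rep i)).
Local Notation R i := (group_ring F G * mxvec (eps i))%MS.

(** Take [X] and [Y] to be the images of x and y. On this component s acts as -1, so yx = sxy
    becomes anticommutation; x^2 and y^2 are central and become scalars of the field; the four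
    cosets of Z give the four coordinates. *)
Lemma quaternion_presentation i :
  exists (L : fieldExtType F) (f : {additive L -> 'M[F]_#|G|})
         (X Y : 'M[F]_#|G|) (a b : L),
  [/\ [/\ injective f, forall u v, f (u * v) = f u *m f v &
          forall k v, f (k%:A * v) = k *: f v],
      [/\ a != 0, b != 0, f 1 *m X = X & f 1 *m Y = Y],
      (forall u, X *m f u = f u *m X) /\ (forall u, Y *m f u = f u *m Y),
      [/\ X *m X = f a, Y *m Y = f b & Y *m X = - (X *m Y)]
    & forall M, (M \in R i)%MS <-> exists u0 u1 u2 u3, M = quat f X Y u0 u1 u2 u3].
Proof.
have [L [f [injf fM fZ f1 [fc fspan]]]] := orbit_span chiP sZG' repP i.
have epsC g : g \in G -> aF g *m eps i = eps i *m aF g.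
  by move=> Gg; apply: (orbit_idem_central chiP) => //; apply: quaternion_idem_central.
have eps2 : eps i *m eps i = eps i := orbit_idem_idem chiP sZG' rep i.
have epsM g h : g \in G -> h \in G -> aF g *m eps i *m (aF h *m eps i) = aF (g * h)%g *m eps i.
  by move=> Gg Gh; rewrite [aF h *m _]epsC // -mulmxA (mulmxA (eps i)) eps2
    -epsC // mulmxA repr_mxM.
(* The scalar of a central group element is nonzero because that element is invertible in the group
   ring. *)
have fz z : z \in Z -> exists2 u, u != 0 & f u = aF z *m eps i.
  move=> Zz; have /fspan[u Du]: exists c : gT -> F,
      aF z *m eps i = (\sum_(h in Z) c h *: aF h) *m eps i.
    exists (fun h => (h == z)%:R); rewrite (bigD1 z) //= eqxx scale1r big1 ?addr0 //.
    by move=> h /andP[_ /negPf->]; rewrite scale0r.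
  exists u => //; apply: contraNneq (oner_neq0 L) => u0; apply/eqP/injf.
  have Gz := subsetP sZG' z Zz.
  by rewrite f1 raddf0 -[LHS]mul1mx -(repr_mx1 aF) -(mulVg z) repr_mxM ?groupV //
    -mulmxA -Du u0 raddf0 mulmx0.
have cf g u : g \in G -> aF g *m f u = f u *m aF g.
  move=> Gg; have [c ->] := fc u; rewrite mulmx_sumr mulmx_suml.
  by apply: eq_bigr => h Zh; rewrite -scalemxAr -scalemxAl commZ.
have [a nza fa] := fz _ Zx2; have [b nzb fb] := fz _ Zy2.
pose X := aF x *m eps i; pose Y := aF y *m eps i.
have XY : X *m Y = aF (x * y)%g *m eps i by apply: epsM.
have fX g : g \in G -> f 1 *m (aF g *m eps i) = aF g *m eps i.
  by move=> Gg; rewrite f1 epsC // mulmxA eps2.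
have cX g u : g \in G -> (aF g *m eps i) *m f u = f u *m (aF g *m eps i).
  by move=> Gg; rewrite -mulmxA -f1 -fM mul1r mulmxA -cf // -mulmxA -fM mulr1.
exists L, f, X, Y, a, b; split=> //.
- by split=> //; apply: fX.
- by split=> u; apply: cX.
- rewrite XY fa fb; split; try exact: epsM.
  have Gs := subsetP sZG' s Zs.
  rewrite epsM // yx (repr_mxM aF Gs (groupM Gx Gy)) -(commZ (groupM Gx Gy) Zs) -mulmxA.
  rewrite (orbit_idem_scalar chiP sZG' rep i (k := -1)) //.
    by rewrite scaleN1r mulmxN.
  by move=> c Sc; rewrite chis // scaleN1r.
have AR M : (M \in R i)%MS = (M \in group_ring F G)%MS && (M *m eps i == M).
  exact: mem_orbit_component.
move=> M; rewrite AR; split=> [/andP[/envelop_mxP[c ->] /eqP<-]|].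
  rewrite mulmx_suml; apply: (big_ind (fun M => exists u0 u1 u2 u3, M = quat f X Y u0 u1 u2 u3)).
  - by exists 0, 0, 0, 0; rewrite /quat raddf0 !mul0mx !addr0.
  - move=> _ _ [u0 [u1 [u2 [u3 ->]]]] [v0 [v1 [v2 [v3 ->]]]].
    by rewrite quat_D; do 4!eexists.
  move=> g Gg; rewrite -scalemxAl; move: (c g) => k; have [z Zz gz] := cosets Gg.
  have Gz := subsetP sZG' z Zz.
  have [u _ fu] := fz z Zz.
  have E1 h : h \in G -> aF (z * h)%g *m eps i = f u *m (aF h *m eps i).
    by move=> Gh; rewrite fu epsM.
  case: gz => ->; rewrite ?E1 ?groupM // -?fu -?XY.
  - by exists (k%:A * u), 0, 0, 0; rewrite /quat raddf0 !mul0mx !addr0 fZ.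
  - by exists 0, (k%:A * u), 0, 0; rewrite /quat raddf0 !mul0mx add0r !addr0 fZ scalemxAl.
  - by exists 0, 0, (k%:A * u), 0; rewrite /quat raddf0 !mul0mx !add0r addr0 fZ scalemxAl.
  by exists 0, 0, 0, (k%:A * u); rewrite /quat raddf0 !mul0mx !add0r fZ scalemxAl.
case=> u0 [u1 [u2 [u3 ->]]]; rewrite /quat XY.
have fA u : (f u \in group_ring F G)%MS by have [d ->] := fc u; apply: sum_mem_group_ring.
have epsA : (eps i \in group_ring F G)%MS by rewrite -f1.
have aA g : g \in G -> (aF g *m eps i \in group_ring F G)%MS.
  by move=> Gg; rewrite envelop_mxM ?envelop_mx_id.
apply/andP; split.
  by rewrite !linearD !addmx_sub ?fA // envelop_mxM ?aA ?groupM.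
by rewrite !mulmxDl -!mulmxA !eps2 -f1 -fM mulr1 f1.
Qed.

Lemma quaternion_component i : is_quaternion_algebra (R i).
Proof.
have [L [f [X [Y [a [b [[injf fM fZ] [nza nzb fX fY] [cX cY] [XX YY YX] memR]]]]]]]
  := quaternion_presentation i.
apply: (quat_algebra nz2 injf fM fZ nza nzb fX fY cX cY XX YY YX _ memR).
apply/mulsmx_subP=> M N; rewrite !(mem_orbit_component chiP sZG' repP).
case/andP=> AM _ /andP[AN /eqP eN].
by rewrite envelop_mxM //= -mulmxA eN.
Qed.

(** Solvability is asked over every extension because the field [L] of the component is known only
    existentially. *)
Lemma split_quaternion_component i :
    (forall (L : fieldExtType F) (a b : L), a != 0 -> b != 0 ->
      exists c d : L, a * c ^+ 2 + b * d ^+ 2 = 1) ->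
  is_matrix2_algebra (R i).
Proof.
move=> solvable.
have [L [f [X [Y [a [b [[injf fM fZ] [nza nzb fX fY] [cX cY] [XX YY YX] memR]]]]]]]
  := quaternion_presentation i.
apply: (quat_split nz2 injf fM fZ nza nzb fX fY cX cY XX YY YX memR).
exact: solvable.
Qed.

End Quaternion.

Section Decomposition.

Variables (b1T : finType) (S1 : {set b1T}) (chi1 : b1T -> gT -> E).
Hypothesis chi1P : galois_characters G S1 chi1.
Hypothesis chi1s : forall b, b \in S1 -> chi1 b s = 1.
Variables (I1 : finType) (rep1 : I1 -> b1T).
Hypothesis rep1P : orbit_reps G S1 chi1 rep1.

Variables (b2T : finType) (S2 : {set b2T}) (chi2 : b2T -> gT -> E).
Hypothesis chi2P : galois_characters Z S2 chi2.
Hypothesis chi2s : forall b, b \in S2 -> chi2 b s = - 1.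
Variables (I2 : finType) (rep2 : I2 -> b2T).
Hypothesis rep2P : orbit_reps Z S2 chi2 rep2.

Hypothesis sum_idem :
  \sum_(b in S1) chi_idem G G chi1 b + \sum_(b in S2) chi_idem G Z chi2 b = 1%:M.

Definition component_idem (i : I1 + I2) : 'M[F]_#|G| :=
  match i with
  | inl i1 => orbit_idem G G S1 chi1 (rep1 i1)
  | inr i2 => orbit_idem G Z S2 chi2 (rep2 i2)
  end.

Definition component (i : I1 + I2) : 'A[F]_#|G| :=
  (group_ring F G * mxvec (component_idem i))%MS.

Lemma component_Wedderburn : Wedderburn_decomposition (group_ring F G) component.
Proof.
have Gs := subsetP sZG' s Zs.
have A2 i : aF s *m component_idem (inr i) = - component_idem (inr i).
  have c b : b \in S2 -> chi2 b s = (-1)%:A by move=> Sb; rewrite chi2s // scaleN1r.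
  by rewrite /= (orbit_idem_scalar chi2P sZG' rep2 i Zs c) scaleN1r.
have A1 i : aF s *m component_idem (inl i) = component_idem (inl i).
  have c b : b \in S1 -> chi1 b s = 1%:A by move=> Sb; rewrite chi1s // scale1r.
  by rewrite /= (orbit_idem_scalar chi1P (subxx _) rep1 i Gs c) scale1r.
have C1 i M : (M \in group_ring F G)%MS ->
    M *m component_idem i = component_idem i *m M.
  case: i => i; apply: orbit_idem_center => //; first exact: linear_idem_central.
  exact: quaternion_idem_central.
have memE i : (component_idem i \in group_ring F G)%MS.
  by case: i => i; apply: mem_orbit_idem; eassumption || exact: subxx.
(* s acts as 1 on the left factor and as -1 on the right one, so the product equals its own
   opposite. *)
have C12 i j : component_idem (inl i) *m component_idem (inr j) = 0.
  have: component_idem (inl i) *m component_idem (inr j) =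
        - (component_idem (inl i) *m component_idem (inr j)).
    by rewrite -mulmxN -A2 mulmxA -(C1 _ _ (envelop_mx_id aF Gs)) A1.
  move/eqP; rewrite -subr_eq0 opprK -mulr2n -scaler_nat scaler_eq0 (negPf nz2).
  by move/eqP.
apply: Wedderburn_idempotents => //.
- by apply/mulsmx_subP/envelop_mxM.
- by case=> i; apply: orbit_idem_idem; eassumption || exact: subxx.
- move=> [i|i] [j|j] ij.
  + by apply: (orbit_idem_orth chi1P (subxx _) rep1P).
  + exact: C12.
  + by rewrite -C1 ?memE // C12.
  by apply: (orbit_idem_orth chi2P sZG' rep2P).
(* Completeness is checked over [E], where the orbit idempotents add up to the idempotents of all
   characters. *)
- apply: (@map_mx_inj _ _ (in_alg E)); rewrite big_sumType /= raddfD /=.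
  rewrite (sum_orbit_idem chi1P) // (sum_orbit_idem chi2P) //.
  by rewrite sum_idem map_mx1.
case=> i; first exact: field_algebra_simple (linear_component chi1P rep1P i).
by case: (quaternion_component chi2P chi2s rep2P i).
Qed.

End Decomposition.

End GroupRingDecomposition.

(** * Arithmetic of finite and cyclotomic fields *)

Section FieldArithmetic.

Local Open Scope ring_scope.

(* Pigeonhole: [a c^2] and [1 - b d^2] both take more than half of all the values. *)
Lemma finField_sum_two_squares (k : finFieldType) (a b : k) :
  a != 0 -> b != 0 -> exists c d, a * c ^+ 2 + b * d ^+ 2 = 1.
Proof.
move=> nza nzb.
have half (g : k -> k) : injective g -> (#|k| < 2 * #|[set g (c ^+ 2) | c : k]|)%N.
  move=> injg; pose Q := [set c ^+ 2 | c : k].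
  have -> : [set g (c ^+ 2) | c : k] = g @: Q.
    apply/setP=> v; apply/imsetP/imsetP=> [[c _ ->]|[w /imsetP[c _ ->] ->]].
      by exists (c ^+ 2) => //; apply: imset_f.
    by exists c.
  rewrite (card_imset _ injg); pose rt (v : k) : k := odflt 0 [pick c : k | c ^+ 2 == v].
  have rtK c : rt (c ^+ 2) ^+ 2 = c ^+ 2.
    by rewrite /rt; case: pickP => [d /eqP //|/(_ c)]; rewrite eqxx.
  (* [c] is determined by its square and one bit, telling whether it is the chosen root. As 0 has
     only one root, the pair (0, false) is missed, which makes the bound strict. *)
  pose h (c : k) := (c ^+ 2, c == rt (c ^+ 2)).
  have injh : injective h.
    move=> c d [e2 e1]; case: (eqVneq c (rt (c ^+ 2))) e1 => [-> | nec].
      by rewrite e2 => /esym/eqP.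
    move=> /esym/negbT ned; have/eqP := rtK c; rewrite eqf_sqr eq_sym (negPf nec) /=.
    have/eqP := rtK d; rewrite eqf_sqr eq_sym (negPf ned) /= -e2 => /eqP-> /eqP/oppr_inj.
    by [].
  have: #|h @: [set: k]| = #|k| by rewrite card_imset // cardsT.
  move <-; apply: (@leq_ltn_trans #|setX Q [set: bool] :\ (0, false)|).
    apply/subset_leq_card/subsetP=> _ /imsetP[c _ ->].
    have Qc : c ^+ 2 \in Q by apply: imset_f.
    rewrite in_setD1 in_setX Qc in_setT !andbT /h; apply/eqP => -[/eqP].
    rewrite sqrf_eq0 => /eqP->; have/eqP := rtK 0.
    by rewrite expr0n /= sqrf_eq0 eq_sym => ->.
  have in0 : (0, false) \in setX Q [set: bool].
    by rewrite !inE andbT; apply/imsetP; exists 0; rewrite ?expr0n.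
  have := cardsD1 (0, false) (setX Q [set: bool]).
  by rewrite in0 cardsX cardsT card_bool mulnC add1n => ->.
have hA := half ( *%R a) (mulfI nza).
have hB : (#|k| < 2 * #|[set (1 - b * d ^+ 2)%R | d : k]|)%N.
  by apply: (half (fun v => 1 - b * v)) => u v /(addrI 1)/oppr_inj/(mulfI nzb).
set A := [set _ | _ in _] in hA; set B := [set _ | _ in _] in hB.
have : A :&: B != set0.
  apply: contraTneq isT => AB0; have := cardsUI A B; rewrite AB0 cards0 addn0.
  have M : (#|A :|: B| <= #|k|)%N := max_card _.
  by move: hA hB M; move: #|A| #|B| #|A :|: B| #|k| => ? ? ? ?; lia.
case/set0Pn=> v; rewrite inE => /andP[/imsetP[c _ ->] /imsetP[d _ cd]].
by exists c, d; rewrite cd subrK.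
Qed.

Lemma splitting_field_rat_galois (L : splittingFieldType rat) : galois 1 {:L}.
Proof.
apply/and3P; split; [exact: sub1v | | exact: normalFieldf].
apply/separableP=> u _; apply: contraT => /separablePn_pchar[p].
by rewrite pchar_lalg Num.Theory.pchar_num.
Qed.

(** Rests on the irreducibility of cyclotomic polynomials, known for algebraic numbers. The minimal
    polynomial [p] of [zeta] has a root [z] there; the minimal polynomial [pf] of [z] is cyclotomic,
    vanishes at [zeta] and [zeta ^+ r], and divides [p]. So [zeta ^+ r] is a conjugate of [zeta]. *)
Lemma rat_cyclotomic_gal (L : splittingFieldType rat) (e r : nat) (zeta : L) :
    e.-primitive_root zeta -> coprime r e ->
  exists2 u : gal_of {:L}, u \in 'Gal({:L} / 1)%g & u zeta = zeta ^+ r.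
Proof.
move=> prim cor; have e_gt0 := prim_order_gt0 prim.
apply: normalField_root_minPoly; rewrite ?sub1v ?normalFieldf ?memvf //.
have /polyOver1P[p Dp] := minPolyOver 1 zeta.
pose toL := map_poly (in_alg L) : {poly rat} -> {poly L}.
have dvd_p q : root (toL q) zeta -> p %| q.
  move=> qz; rewrite -(dvdp_map (in_alg L)) -Dp; apply: minPoly_dvdp => //.
  by apply/polyOver1P; exists q.
have nz_p : p != 0.
  by apply: contraTneq (monic_minPoly 1 zeta) => p0; 
    rewrite Dp p0 map_poly0 monicE lead_coef0 eq_sym oner_eq0.
have p_e : p %| 'X^e - 1.
  apply: dvd_p; rewrite /toL rmorphB rmorph1 /= map_polyXn rootE !hornerE.
  by rewrite (prim_expr_order prim) subrr.
have [z pz0] : exists z : algC, root (map_poly ratr p) z.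
  apply/closed_rootP; rewrite size_map_poly.
  by rewrite -(size_map_poly (in_alg L)) -Dp size_minPoly.
have ze1 : z ^+ e = 1.
  apply/eqP; rewrite -subr_eq0.
  have: root (map_poly (ratr : rat -> algC) ('X^e - 1)) z.
    by apply: root_dvdp pz0; rewrite dvdp_map.
  by rewrite rmorphB rmorph1 /= map_polyXn rootE !hornerE.
have [pf [Dpf mon_pf] dv_pf] := minCpolyP z.
have pf_p : pf %| p by rewrite -dv_pf.
have pf_zeta : root (toL pf) zeta.
  have [g Dg] := dvdpP _ _ pf_p.
  have: root (toL p) zeta by rewrite /toL -Dp root_minPoly.
  rewrite Dg /toL rmorphM rootM => /orP[/dvd_p gz|//].
  have nz_g : g != 0 by apply: contraNneq nz_p => g0; rewrite Dg g0 mul0r.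
  (* If [zeta] were a root of the cofactor [g], then [p] would divide [g], against the degrees since
     [pf] is not constant. *)
  have := dvdp_leq nz_g gz; rewrite Dg size_mul ?(monic_neq0 mon_pf) //.
  have : (1 < size pf)%N.
    have <-: size (minCpoly z) = size pf by rewrite Dpf size_map_poly.
    exact: size_minCpoly.
  have: (0 < size g)%N by rewrite size_poly_gt0.
  by move: (size pf) (size g) => ? ? *; exfalso; lia.
have prim_z : e.-primitive_root z.
  have [d prim_d d_e] := prim_order_exists e_gt0 ze1.
  suff /eqP <-: d == e by [].
  rewrite eqn_dvd d_e (prim_order_dvd prim) /=.
  have : pf %| 'X^d - 1.
    by rewrite -dv_pf rmorphB rmorph1 /= map_polyXn rootE !hornerE (prim_expr_order prim_d) subrr.
  rewrite -(dvdp_map (in_alg L)) => /root_dvdp div; have := div _ pf_zeta.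
  by rewrite rmorphB rmorph1 /= map_polyXn rootE !hornerE subr_eq0.
(* For [r] prime to [e] the power [z ^+ r] is again a primitive root of order [e], so [z] is a root
   of pf(X^r). Evaluating the divisibility at [zeta] brings the result back to [L]. *)
have : pf %| pf \Po 'X^r.
  rewrite -dv_pf map_comp_poly /= map_polyXn rootE horner_comp !hornerE.
  rewrite -Dpf (minCpoly_cyclotomic prim_z) -rootE root_cyclotomic //.
  by rewrite prim_root_exp_coprime.
rewrite -(dvdp_map (in_alg L)) => /root_dvdp div; have := div _ pf_zeta.
rewrite map_comp_poly /= map_polyXn rootE horner_comp !hornerE -rootE => pfr.
by rewrite Dp; apply: root_dvdp pfr; rewrite dvdp_map.
Qed.

Lemma finField_primitive_extension (k : finFieldType) (n : nat) :
    (0 < n)%N -> (n%:R : k) != 0 ->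
  exists (L : splittingFieldType k) (zeta : L), n.-primitive_root zeta.
Proof.
move=> n_gt0 nzn; pose p := 'X^n - 1 : {poly k}.
have nzp : p != 0 by apply/monic_neq0/monic_Xn_sub_1.
have [L [rs Drs _]] := FinSplittingFieldFor nzp; exists L.
have Dp : map_poly (in_alg L) p = 'X^n - 1.
  by rewrite rmorphB rmorph1 /= map_polyXn.
rewrite Dp in Drs.
have sep : separable_poly ('X^n - 1 : {poly L}).
  by rewrite separable_Xn_sub_1 // -(rmorph_nat (in_alg L)) fmorph_eq0.
have /hasP[z _ primz] : has n.-primitive_root rs.
  apply: has_prim_root => //.
  - by apply/allP=> z rz; rewrite /root_of_unity (eqp_root Drs) root_prod_XsubC.
  - by rewrite -separable_prod_XsubC -(eqp_separable Drs).
  by rewrite -ltnS -(size_prod_XsubC rs id) -(eqp_size Drs) size_XnsubC.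
by exists z.
Qed.

Lemma finField_gal_frobenius (k : finFieldType) (L : splittingFieldType k) :
  [/\ galois 1 {:L},
      forall u : gal_of {:L}, u \in 'Gal({:L} / 1)%g ->
        exists i, forall v, u v = v ^+ (#|k| ^ i)
    & forall i, exists2 u : gal_of {:L}, u \in 'Gal({:L} / 1)%g &
        forall v, u v = v ^+ (#|k| ^ i)].
Proof.
have [alpha gen_alpha alphaE] := finField_galois_generator (sub1v {:L}%AS).
have alphaX i v : (alpha ^+ i)%g v = v ^+ (#|k| ^ i).
  elim: i v => [|i IHi] v; first by rewrite gal_id.
  by rewrite expgSr galM ?memvf // IHi alphaE ?memvf // dimv1 expn1 -exprM expnSr.
split; first exact: finField_galois (sub1v {:L}%AS).
  move=> u; rewrite (eqP gen_alpha) => /cycleP[i ->].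
  by exists i.
by move=> i; exists (alpha ^+ i)%g => //; rewrite (eqP gen_alpha) mem_cycle.
Qed.

Lemma finField_fieldExt_two_squares (k : finFieldType) (L : fieldExtType k) (a b : L) :
  a != 0 -> b != 0 -> exists c d : L, a * c ^+ 2 + b * d ^+ 2 = 1.
Proof. exact: (@finField_sum_two_squares (finvect_type L)). Qed.

End FieldArithmetic.

(** * Groups of type D5 *)

Section Presentations.

Import Presentation.

Variables (gT : finGroupType) (e : seq gT).

Lemma and_relE (vT : finType) (v1 v2 : vT) r : and_rel v1 v2 r = (v1 == v2) && r :> bool.
Proof. by case: r => //=; rewrite andbT. Qed.

Lemma rel_Eq2 u v r : rel e (Eq2 u v) r = (eval e u == eval e v) && r :> bool.
Proof. exact: and_relE. Qed.

Lemma rel_And f1 f2 r : rel e (And f1 f2) r = rel e f1 (rel e f2 r).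
Proof. by []. Qed.

(** Reduces the predicate behind [Grp] to a check of the relations on five explicit generators. *)
Lemma homGrp5 (H : {group gT}) (a b c d g : gT)
    (f : term -> term -> term -> term -> term -> formula) :
    (<[a]> <*> <[b]> <*> <[c]> <*> <[d]> <*> <[g]> = H)%g ->
    rel [:: a; b; c; d; g] (f (Cst 0) (Cst 1) (Cst 2) (Cst 3) (Cst 4)) NoRel ->
  hom H (fun v => Cast (Generator (fun w => Cast (Generator (fun x => Cast (Generator
    (fun y => Cast (Generator (fun z => Cast (Formula (f v w x y z))))))))))).
Proof.
move=> gen relH; apply/existsP; exists (a, b, c, d, g).
by rewrite and_relE gen eqxx.
Qed.

End Presentations.

Lemma homg_Grp_D5 (gT : finGroupType) (H : {group gT}) (t x y : gT) (m1 n1 m2 m3 : nat) :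
    (<[t]> <*> <[x]> <*> <[y]> = H -> t ^+ n1 = 1 ->
     x ^+ (2 ^ m2.+1) = 1 -> y ^+ (2 ^ m3.+1) = 1 ->
     (forall u, commute t u) -> commute (x ^+ 2) y -> commute (y ^+ 2) x ->
     [~ x, y] = t ^+ m1 ->
   H \homg Grp (t1 : t2 : t3 : x : y :
        t1 ^+ n1, t2 ^+ (2 ^ m2), t3 ^+ (2 ^ m3),
        x ^+ 2 = t2, y ^+ 2 = t3,
        [~ t1, t2], [~ t1, t3], [~ t1, x], [~ t1, y],
        [~ t2, t3], [~ t2, x], [~ t2, y], [~ t3, x], [~ t3, y],
        [~ x, y] = t1 ^+ m1))%g.
Proof.
move=> gen exT exX exY ct cxxy cyyx xy.
have comm1 (u v : gT) : commute u v -> [~ u, v]%g == 1%g by move=> cuv; apply/commgP.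
have cXX : commute (x ^+ 2)%g x by apply/commute_sym/commuteX.
have cYY : commute (y ^+ 2)%g y by apply/commute_sym/commuteX.
apply: (@homGrp5 _ H t (x ^+ 2)%g (y ^+ 2)%g x y).
  rewrite -gen -!joingA [(<[y ^+ 2]> <*> _)%g]joingC -joingA.
  have -> : (<[y]> <*> <[y ^+ 2]> = <[y]>)%g by apply/joing_idPl/cycleX.
  rewrite [(<[x ^+ 2]> <*> _)%g]joingA.
  by have -> : (<[x ^+ 2]> <*> <[x]> = <[x]>)%g by apply/joing_idPr/cycleX.
rewrite !rel_And !rel_Eq2 /= -!expgM -!expnS exT exX exY xy !eqxx.
by rewrite !comm1 ?andbT //; exact/commuteX.
Qed.

Section Model.

Local Open Scope ring_scope.

Variables m1 m2 m3 : nat.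

(* The triple (a, i, j) stands for t1^a x^i y^j in the group of type D5 with
   parameters m1 + 1, m2, m3. *)
Definition D5_model : predArgType := ('Z_(2 ^ m1.+1) * 'Z_(2 ^ m2.+1) * 'Z_(2 ^ m3.+1))%type.

HB.instance Definition _ := Finite.on D5_model.

(** The cocycle of the model: moving y^j past x^i costs s^(ij), which depends on parities only, and
    s is t1^(2^m1) because the parameter here is m1 + 1. *)
Definition D5_twist (a b : bool) : 'Z_(2 ^ m1.+1) := if a && b then (2 ^ m1)%:R else 0.

Definition D5_mul (u v : D5_model) : D5_model :=
  (u.1.1 + v.1.1 + D5_twist (odd u.2) (odd v.1.2), u.1.2 + v.1.2, u.2 + v.2).

Definition D5_one : D5_model := (0, 0, 0).

Definition D5_inv (u : D5_model) : D5_model :=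
  (D5_twist (odd u.2) (odd u.1.2) - u.1.1, - u.1.2, - u.2).

Lemma Zp_pow2_cast k : (Zp_trunc (2 ^ k.+1)).+2 = (2 ^ k.+1)%N.
Proof. by rewrite Zp_cast // -{1}(expn0 2) ltn_exp2l. Qed.

Lemma odd_mod_pow2 k n : odd (n %% (Zp_trunc (2 ^ k.+1)).+2) = odd n.
Proof. by rewrite Zp_pow2_cast odd_mod // expnS oddM. Qed.

Lemma odd_ZpD k (i j : 'Z_(2 ^ k.+1)) : odd (i + j)%R = odd i (+) odd j.
Proof. by rewrite [_ (i + j)]/= odd_mod_pow2 oddD. Qed.

Lemma odd_Zp0 k : odd (0%R : 'Z_(2 ^ k.+1)) = false.
Proof. by []. Qed.

Lemma odd_ZpN k (i : 'Z_(2 ^ k.+1)) : odd (- i)%R = odd i.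
Proof.
by have := odd_ZpD (- i) i; rewrite addNr odd_Zp0; do 2!case: (odd _).
Qed.

Lemma D5_twist2 b c : D5_twist b c + D5_twist b c = 0.
Proof.
rewrite /D5_twist; case: ifP => _; rewrite ?addr0 // -natrD addnn -mul2n -expnS.
by apply: pchar_Zp; rewrite -{1}(expn0 2) ltn_exp2l.
Qed.

Lemma D5_twistDl b c d : D5_twist (b (+) c) d = D5_twist b d + D5_twist c d.
Proof.
by case: b c d (D5_twist2 b d) => [] [] [] // E; rewrite ?addr0 ?add0r.
Qed.

Lemma D5_twistDr b c d : D5_twist d (b (+) c) = D5_twist d b + D5_twist d c.
Proof.
by case: b c d (D5_twist2 d b) => [] [] [] // E; rewrite ?addr0 ?add0r.
Qed.

Lemma D5_mulA : associative D5_mul.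
Proof.
move=> [[a i] j] [[a' i'] j'] [[a'' i''] j'']; rewrite /D5_mul /= !odd_ZpD.
by rewrite D5_twistDl D5_twistDr; congr (_, _, _); ring.
Qed.

Lemma D5_mul1 : left_id D5_one D5_mul.
Proof. by case=> [[a i] j]; rewrite /D5_mul /D5_twist /= !add0r addr0. Qed.

Lemma D5_mulV : left_inverse D5_one D5_inv D5_mul.
Proof.
case=> [[a i] j]; rewrite /D5_mul /D5_one /= odd_ZpN !addNr.
by rewrite subrK D5_twist2.
Qed.

HB.instance Definition _ := Finite_isGroup.Build D5_model D5_mulA D5_mul1 D5_mulV.

Local Notation t1 := ((1, 0, 0) : D5_model).
Local Notation x := ((0, 1, 0) : D5_model).
Local Notation y := ((0, 0, 1) : D5_model).

Lemma D5_expt k : (t1 ^+ k)%g = (k%:R, 0, 0).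
Proof.
elim: k => // k IHk; rewrite expgS IHk.
by congr (_, _, _); rewrite /= ?addr0 // mulrS.
Qed.

Lemma D5_expx k : (x ^+ k)%g = (0, k%:R, 0).
Proof.
elim: k => // k IHk; rewrite expgS IHk.
by congr (_, _, _); rewrite /= ?addr0 // mulrS.
Qed.

Lemma D5_expy k : (y ^+ k)%g = (0, 0, k%:R).
Proof.
elim: k => // k IHk; rewrite expgS IHk.
by congr (_, _, _); rewrite /= ?addr0 // /D5_twist /= ?andbF ?addr0 // mulrS.
Qed.

(** The presented group maps onto the model, hence is at least as large; this is the only lower
    bound on its order. *)
Lemma D5_homg :
  ([set: D5_model] \homg Grp (t1 : t2 : t3 : x : y :
        t1 ^+ (2 ^ m1.+1), t2 ^+ (2 ^ m2), t3 ^+ (2 ^ m3),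
        x ^+ 2 = t2, y ^+ 2 = t3,
        [~ t1, t2], [~ t1, t3], [~ t1, x], [~ t1, y],
        [~ t2, t3], [~ t2, x], [~ t2, y], [~ t3, x], [~ t3, y],
        [~ x, y] = t1 ^+ (2 ^ m1)))%g.
Proof.
have p0 k : (2 ^ k.+1)%:R = 0 :> 'Z_(2 ^ k.+1).
  by apply: pchar_Zp; rewrite -{1}(expn0 2) ltn_exp2l.
have ct u : commute t1 u.
  case: u => [[a i] j]; rewrite /commute; congr (_, _, _);
  by rewrite /= ?add0r ?addr0 // /D5_twist /= ?andbF ?addr0 // addrC.
have odd2 k : odd (2%:R : 'Z_(2 ^ k.+1)) = false by rewrite mulr2n odd_ZpD addbb.
have cyx : commute (x ^+ 2)%g y.
  rewrite D5_expx /commute -[LHS]/(D5_mul _ _) -[RHS]/(D5_mul _ _) /D5_mul odd2.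
  by congr (_, _, _); rewrite /D5_twist ?andbF /= ?addr0 ?add0r.
have cxy : commute (y ^+ 2)%g x.
  rewrite D5_expy /commute -[LHS]/(D5_mul _ _) -[RHS]/(D5_mul _ _) /D5_mul odd2.
  by congr (_, _, _); rewrite /D5_twist /= ?addr0 ?add0r.
have exT : (t1 ^+ (2 ^ m1.+1) = 1)%g by rewrite D5_expt p0.
have exX : (x ^+ (2 ^ m2.+1) = 1)%g by rewrite D5_expx p0.
have exY : (y ^+ (2 ^ m3.+1) = 1)%g by rewrite D5_expy p0.
have xy : [~ x, y]%g = (t1 ^+ (2 ^ m1))%g.
  apply: (mulgI (y * x)%g); rewrite -commgC D5_expt -[LHS]/(D5_mul _ _).
  rewrite -[RHS]/(D5_mul (D5_mul _ _) _) /D5_mul /D5_twist /= ?add0r ?addr0.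
  congr (_, _, _); rewrite // -natrD addnn -mul2n -expnS p0 //.
have gen u : exists a i j, u = (t1 ^+ a * x ^+ i * y ^+ j)%g.
  case: u => [[a i] j]; exists a, i, j; rewrite D5_expt D5_expx D5_expy !natr_Zp.
  by congr (_, _, _); rewrite /= ?add0r ?addr0 // /D5_twist /= ?andbF ?addr0.
apply: (homg_Grp_D5 (H := [set: D5_model]) _ exT exX exY ct cyx cxy xy).
apply/eqP; rewrite eqEsubset subsetT.
apply/subsetP=> u _; have [a [i [j ->]]] := gen u.
apply: groupM; first apply: groupM; apply: groupX; rewrite -cycle_subG.
- exact: subset_trans (joing_subl _ _) (joing_subl _ _).
- exact: subset_trans (joing_subr _ _) (joing_subl _ _).
exact: joing_subr.
Qed.

End Model.

Section GroupStructure.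

Local Open Scope group_scope.

(** The chain m n <= |BC| <= |B| |C| <= m n collapses to equalities, so the intersection is
    trivial. *)
Lemma dprod_of_card (gT : finGroupType) (B C : {group gT}) (m n : nat) :
    C \subset 'C(B) -> #|B| <= m -> #|C| <= n -> m * n <= #|B * C| ->
    0 < m -> 0 < n ->
  [/\ B \x C = B * C, #|B| = m & #|C| = n].
Proof.
move=> cBC leB leC lemn m_gt0 n_gt0.
have leBC : #|B * C| <= #|B| * #|C| by rewrite mul_cardG leq_pmulr ?cardG_gt0.
have oB : #|B| = m.
  apply/eqP; rewrite eqn_leq leB -(leq_pmul2r n_gt0) (leq_trans lemn) //.
  by rewrite (leq_trans leBC) // leq_mul2l leC orbT.
have oC : #|C| = n.
  apply/eqP; rewrite eqn_leq leC -(leq_pmul2l m_gt0) (leq_trans lemn) //.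
  by rewrite (leq_trans leBC) // leq_mul2r leB orbT.
split=> //; apply: dprodE => //; apply: cardMg_TI.
by rewrite oB oC.
Qed.

(** The lower bound is handed inwards: splitting off [d] fixes the order of the product of the first
    three cyclic groups, and so on. It serves both for Z(G) and for G/G'. *)
Lemma dprod4_of_card (gT : finGroupType) (a b c d : gT) (n1 n2 n3 n4 : nat)
    (A : {group gT}) :
    abelian A -> [/\ a \in A, b \in A, c \in A & d \in A] ->
    [/\ a ^+ n1 = 1, b ^+ n2 = 1, c ^+ n3 = 1 & d ^+ n4 = 1] ->
    [/\ 0 < n1, 0 < n2, 0 < n3 & 0 < n4] ->
    A \subset <[a]> * <[b]> * <[c]> * <[d]> -> n1 * n2 * n3 * n4 <= #|A| ->
  <[a]> \x <[b]> \x <[c]> \x <[d]> = A /\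
  [/\ #[a] = n1, #[b] = n2, #[c] = n3 & #[d] = n4].
Proof.
move=> abA [Aa Ab Ac Ad] [ea eb ec ed] [n1p n2p n3p n4p] sub leA.
have ord (u : gT) n : u ^+ n = 1 -> 0 < n -> #|<[u]>| <= n.
  by move=> un np; rewrite -orderE dvdn_leq // order_dvdn un.
have cent (B C : {group gT}) : B \subset A -> C \subset A -> C \subset 'C(B).
  by move=> BA CA; apply: (centsS BA); apply: subset_trans CA abA.
have sA (u : gT) : u \in A -> <[u]> \subset A by rewrite cycle_subG.
have AB : <[a]> * <[b]> = <[a]> <*> <[b]> by rewrite cent_joinEr ?cent ?sA.
have sAB : <[a]> <*> <[b]> \subset A by rewrite join_subG !sA.
have ABC : <[a]> <*> <[b]> * <[c]> = <[a]> <*> <[b]> <*> <[c]>.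
  by rewrite (cent_joinEr (cent _ _ sAB (sA _ Ac))).
have sABC : <[a]> <*> <[b]> <*> <[c]> \subset A by rewrite join_subG sAB sA.
rewrite AB ABC in sub.
have cardM (B C : {group gT}) : #|B * C| <= #|B| * #|C|.
  by rewrite mul_cardG leq_pmulr ?cardG_gt0.
have l1 : #|<[a]> <*> <[b]>| <= n1 * n2.
  by rewrite -AB (leq_trans (cardM _ _)) // leq_mul ?ord.
have l2 : #|<[a]> <*> <[b]> <*> <[c]>| <= n1 * n2 * n3.
  by rewrite -ABC (leq_trans (cardM _ _)) // leq_mul ?ord.
have l3 := leq_trans leA (subset_leq_card sub).
have [D3 o3 od] := dprod_of_card (cent _ _ sABC (sA _ Ad)) l2 (ord d _ ed n4p) l3
  (ltac:(by rewrite !muln_gt0 n1p n2p)) n4p.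
have l2' : n1 * n2 * n3 <= #|<[a]> <*> <[b]> * <[c]>| by rewrite ABC o3.
have [D2 o2 oc] := dprod_of_card (cent _ _ sAB (sA _ Ac)) l1 (ord c _ ec n3p) l2'
  (ltac:(by rewrite !muln_gt0 n1p n2p)) n3p.
have l1' : n1 * n2 <= #|<[a]> * <[b]>| by rewrite AB o2.
have [D1 oa ob] := dprod_of_card (cent _ _ (sA _ Aa) (sA _ Ab)) (ord a _ ea n1p)
  (ord b _ eb n2p) l1' n1p n2p.
split; last by split.
rewrite D1 AB D2 ABC D3; apply/eqP; rewrite eqEsubset sub andbT.
by rewrite mul_subG ?sA.
Qed.

(* Words in generators can be put in the form z x^i y^j with i, j < 2. *)
Lemma central_ext_cosets (gT : finGroupType) (K : {group gT}) (x y s : gT)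
    (A : {set gT}) :
    (forall k, k \in K -> commute k x /\ commute k y) ->
    s \in K -> x * x \in K -> y * y \in K -> y * x = s * (x * y) ->
    A \subset K :|: [set x; y] ->
  forall g, g \in <<A>> -> exists2 z, z \in K &
    [\/ g = z, g = z * x, g = z * y | g = z * (x * y)].
Proof.
move=> cK Ks Kxx Kyy yx sA g /gen_prodgP[n [c Ac ->]].
have cx k : k \in K -> x * k = k * x by case/cK.
have cy k : k \in K -> y * k = k * y by case/cK.
elim: n c Ac => [|n IHn] c Ac.
  by rewrite big_ord0; exists 1; rewrite ?group1 //; apply: Or41.
rewrite big_ord_recr /=; have [i|z Kz] := IHn (fun i => c (widen_ord (leqnSn n) i)).
  exact: Ac.
set w := \prod_(i < n) _; move=> wz.
have : c ord_max \in K :|: [set x; y] by apply: (subsetP sA); apply: Ac.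
case/setUP=> [Kc | /set2P[->|->]].
- exists (z * c ord_max); first by rewrite groupM.
  case: wz => ->; [apply: Or41 | apply: Or42 | apply: Or43 | apply: Or44] => //.
  + by rewrite -!mulgA cx.
  + by rewrite -!mulgA cy.
  by rewrite -!mulgA cy // !mulgA -(mulgA z x) cx // !mulgA.
- case: wz => ->.
  + by exists z => //; apply: Or42.
  + exists (z * (x * x)); first by rewrite groupM.
    by apply: Or41; rewrite mulgA.
  + exists (z * s); first by rewrite groupM.
    by apply: Or44; rewrite -!mulgA yx.
  exists (z * (s * (x * x))); first by rewrite groupM // groupM.
  by apply: Or43; rewrite -!mulgA yx (mulgA x s) (cx s) // !mulgA.
case: wz => ->.
- by exists z => //; apply: Or43.
- by exists z => //; apply: Or44; rewrite mulgA.
- exists (z * (y * y)); first by rewrite groupM.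
  by apply: Or41; rewrite mulgA.
exists (z * (y * y)); first by rewrite groupM.
by apply: Or42; rewrite -!mulgA [y * (y * x)]mulgA -(cx (y * y)).
Qed.

End GroupStructure.

Section TypeD5.

Local Open Scope group_scope.

(** What the rest of the argument knows about the group; the presentation is not consulted again. *)
Record D5_structure (gT : finGroupType) (m1 m2 m3 m4 : nat) (G : {group gT})
    (t1 t2 t3 t4 x y s : gT) : Prop := D5Structure {
  D5_center : <[t1]> \x <[t2]> \x <[t3]> \x <[t4]> = 'Z(G);
  D5_orders : [/\ #[t1] = 2 ^ m1, #[t2] = 2 ^ m2, #[t3] = 2 ^ m3 & #[t4] = 2 ^ m4]%N;
  D5_mem : x \in G /\ y \in G;
  D5_squares : x * x \in 'Z(G) /\ y * y \in 'Z(G);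
  D5_sE : s = t1 ^+ (2 ^ m1.-1);
  D5_s : [/\ s \in 'Z(G), s * s = 1 & s != 1];
  D5_yx : y * x = s * (x * y);
  D5_cosets : forall g, g \in G -> exists2 z, z \in 'Z(G) &
    [\/ g = z, g = z * x, g = z * y | g = z * (x * y)];
  D5_card : #|G| = (2 ^ (m1 + m2 + m3 + m4).+2)%N;
  D5_der : G^`(1) = <[s]>;
  D5_abel :
    <[coset G^`(1) t1]> \x <[coset G^`(1) x]> \x <[coset G^`(1) y]> \x <[coset G^`(1) t4]>
      = G / G^`(1);
  D5_abel_orders :
    [/\ #[coset G^`(1) t1] = 2 ^ m1.-1, #[coset G^`(1) x] = 2 ^ m2.+1,
        #[coset G^`(1) y] = 2 ^ m3.+1 & #[coset G^`(1) t4] = 2 ^ m4]%N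
}.

(** Let K be generated by the four t's. The model gives |G| >= 2^(m1+m2+m3+m4+2), the normal form
    gives |G| <= 4|K|, and |K| is at most the product of the 2^mi. So all these are equalities, and
    K is the direct product of the four cyclic groups. *)
Lemma type_D5_structure (gT : finGroupType) (m1 m2 m3 m4 : nat) (G0 G : {group gT})
    (t1 t2 t3 t4 x y s : gT) :
    (0 < m1)%N -> type_D5 m1 m2 m3 G0 t1 t2 t3 x y ->
    s = t1 ^+ (2 ^ m1.-1) -> #[t4] = (2 ^ m4)%N -> G0 \x <[t4]> = G ->
  D5_structure m1 m2 m3 m4 G t1 t2 t3 t4 x y s.
Proof.
move=> m1_gt0.
have ea : (m1.-1 + m2.+1 + m3.+1 + m4 = (m1 + m2 + m3 + m4).+1)%N by lia.
move=> [defG0 [e1 e2 e3 ex ey] [Z1 Z2 Z3] xys iso] defs o4 defG.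
have oG0 : (2 ^ (m1 + m2.+1 + m3.+1) <= #|G0|)%N.
  move: (D5_homg m1.-1 m2 m3) iso; rewrite (prednK m1_gt0) => hom iso.
  have /leq_homg : [set: D5_model m1.-1 m2 m3] \homg G0.
    by rewrite (iso _ [set: _]%G).
  apply: leq_trans; rewrite cardsT !card_prod !card_ord !Zp_pow2_cast (prednK m1_gt0).
  by rewrite !expnD.
have [_ GE cG04 ti4] := dprodP defG.
have oG : (2 ^ (m1 + m2 + m3 + m4).+2 <= #|G|)%N.
  rewrite -(dprod_card defG) -orderE o4 (leq_trans _ (leq_mul oG0 (leqnn _))) //.
  by rewrite -expnD leq_exp2l //; lia.
have sG0 : G0 \subset G by rewrite -GE mulG_subl.
have G4 : t4 \in G by rewrite -cycle_subG -GE mulG_subr.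
have G0x : x \in G0 by rewrite defG0 mem_gen // !inE eqxx ?orbT.
have G0y : y \in G0 by rewrite defG0 mem_gen // !inE eqxx ?orbT.
have Gx := subsetP sG0 x G0x; have Gy := subsetP sG0 y G0y.
have ZG0 t : t \in 'Z(G0) -> t \in 'Z(G).
  case/centerP=> G0t cG0t; apply/centerP; split=> [|g]; first exact: (subsetP sG0).
  rewrite -GE => /mulsgP[h k G0h k4 ->].
  apply: commuteM; first exact: cG0t.
  by apply: commute_sym; apply: (centP (subsetP cG04 k k4)).
have Z4 : t4 \in 'Z(G).
  apply/centerP; split=> // g; rewrite -GE => /mulsgP[h k G0h /cycleP[i ->] ->].
  apply: commuteM; last exact/commuteX.
  by apply: (centP (subsetP cG04 _ (cycle_id t4))).
move: {Z1 Z2 Z3} (ZG0 _ Z1) (ZG0 _ Z2) (ZG0 _ Z3) => Z1 Z2 Z3.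
pose K := <<[set t1; t2; t3; t4]>>.
have sKZ : K \subset 'Z(G).
  by rewrite gen_subG; apply/subsetP=> t; rewrite !in_setU !in_set1 -!orbA => /or4P[] /eqP->.
have [K1 K2 K3 K4] : [/\ t1 \in K, t2 \in K, t3 \in K & t4 \in K].
  by split; rewrite mem_gen // !inE eqxx ?orbT.
have sKG : K \subset G := subset_trans sKZ (center_sub G).
have abK : abelian K := abelianS sKZ (center_abelian G).
have Ks : s \in K by rewrite defs groupX.
have cK k : k \in K -> commute k x /\ commute k y.
  by move=> Kk; have /centerP[_ cGk] := subsetP sKZ k Kk; split; apply: cGk.
have ss : s * s = 1.
  by rewrite defs -expgD addnn -mul2n -expnS (prednK m1_gt0).
have yx : y * x = s * (x * y).
  have [c1 c2] := cK s Ks; have cs : s * (y * x) = y * x * s := commuteM c2 c1.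
  by rewrite (commgC x y) xys -defs -cs mulgA ss mul1g.
have xx : x * x = t2 by rewrite -ex expgS expg1.
have yy : y * y = t3 by rewrite -ey expgS expg1.
have cosK : forall g, g \in G -> exists2 z, z \in K &
    [\/ g = z, g = z * x, g = z * y | g = z * (x * y)].
  move=> g Gg; apply: (central_ext_cosets (A := [set t1; t2; t3; t4; x; y]) cK Ks) => //.
  - by rewrite xx.
  - by rewrite yy.
  - apply/subsetP=> t; rewrite !in_setU !in_set1 -!orbA.
    by case/or4P=> [/eqP->|/eqP->|/eqP->|/or3P[] /eqP->]; rewrite ?K1 ?K2 ?K3 ?K4 ?eqxx ?orbT.
  apply: subsetP Gg; rewrite -GE mul_subG // ?cycle_subG; last first.
    by rewrite mem_gen // !inE eqxx ?orbT.
  rewrite defG0 genS //; apply/subsetP=> t; rewrite !inE -!orbA.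
  by case/or4P=> [/eqP->|/eqP->|/eqP->|/orP[] /eqP->]; rewrite eqxx ?orbT.
have leG : (#|G| <= 4 * #|K|)%N.
  have /subset_leq_card : G \subset K :|: (K :* x) :|: (K :* y) :|: (K :* (x * y)).
    apply/subsetP=> g /cosK[z Kz gz]; rewrite !inE !mem_rcoset.
    by case: gz => ->; rewrite ?mulgK ?Kz ?orbT.
  move/leq_trans; apply; rewrite !mulSn mul0n addn0 !addnA.
  rewrite (leq_trans (leq_card_setU _ _)) // card_rcoset leq_add2r.
  rewrite (leq_trans (leq_card_setU _ _)) // card_rcoset leq_add2r.
  by rewrite (leq_trans (leq_card_setU _ _)) // card_rcoset.
have leK : (2 ^ m1 * 2 ^ m2 * 2 ^ m3 * 2 ^ m4 <= #|K|)%N.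
  rewrite -(leq_pmul2l (isT : 0 < 4)%N); apply: leq_trans leG; apply: leq_trans oG.
  by rewrite -!expnD -[4]/(2 ^ 2)%N -expnD leq_exp2l //; lia.
have sKM : K \subset <[t1]> * <[t2]> * <[t3]> * <[t4]>.
  have c (B C : {set gT}) : B \subset K -> C \subset K -> C \subset 'C(B).
    by move=> sB sC; apply: (sub_abelian_cent2 abK).
  have s2 : <[t1]> <*> <[t2]> \subset K by rewrite join_subG !cycle_subG K1.
  have s3 : <[t1]> <*> <[t2]> <*> <[t3]> \subset K by rewrite join_subG s2 cycle_subG.
  rewrite -[<[t1]> * <[t2]>]cent_joinEr ?c ?cycle_subG //.
  rewrite -[_ * <[t3]>]cent_joinEr ?c ?cycle_subG // -[_ * <[t4]>]cent_joinEr ?c ?cycle_subG //.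
  rewrite gen_subG; apply/subsetP=> t; rewrite !in_setU !in_set1 -!orbA -cycle_subG.
  case/or4P=> /eqP->.
  - by do 2!rewrite (subset_trans _ (joing_subl _ _)) //; rewrite joing_subl.
  - by do 2!rewrite (subset_trans _ (joing_subl _ _)) //; rewrite joing_subr.
  - by rewrite (subset_trans _ (joing_subl _ _)) //; rewrite joing_subr.
  by rewrite joing_subr.
have pos n : (0 < 2 ^ n)%N by rewrite expn_gt0.
have [defK [o1 o2 o3 _]] : <[t1]> \x <[t2]> \x <[t3]> \x <[t4]> = K /\
    [/\ #[t1] = 2 ^ m1, #[t2] = 2 ^ m2, #[t3] = 2 ^ m3 & #[t4] = 2 ^ m4]%N.
  by apply: (@dprod4_of_card _ _ _ _ _ _ _ _ _ <<_>>%G) => //; split; rewrite // -o4 expg_order.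
have s_neq1 : s != 1.
  by rewrite defs -order_dvdn o1 dvdn_Pexp2l // -ltnNge prednK.
have oK : #|K| = (2 ^ m1 * 2 ^ m2 * 2 ^ m3 * 2 ^ m4)%N.
  have [[B _ defB _] _ _ _] := dprodP defK; rewrite defB in defK.
  have [[C _ defC _] _ _ _] := dprodP defB; rewrite defC in defB.
  rewrite -(dprod_card defK) -(dprod_card defB) -(dprod_card defC).
  by rewrite -!orderE o1 o2 o3 o4.
have eG : #|G| = (2 ^ (m1 + m2 + m3 + m4).+2)%N.
  apply/eqP; rewrite eqn_leq oG andbT (leq_trans leG) // oK.
  by rewrite -!expnD -[4]/(2 ^ 2)%N -expnD leq_exp2l //; lia.
(* An element of [K] times x, y or xy cannot be central, since x and y do not commute. *)
have KZ : K = 'Z(G).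
  apply/eqP; rewrite eqEsubset sKZ; apply/subsetP=> g Zg.
  have /centerP[Gg cg] := Zg; have [z Kz gz] := cosK g Gg.
  have ZKz := subsetP sKZ z Kz.
  have noc w : w \in 'Z(G) -> commute w x /\ commute w y.
    by case/centerP=> _ cw; split; apply: cw.
  have noxy : commute y x -> False.
    by rewrite /commute yx => /eqP; rewrite eq_mulgV1 mulgK (negPf s_neq1).
  case: gz => Dg; first by rewrite Dg.
  - have : x \in 'Z(G) by rewrite -(mulKg z x) -Dg groupM ?groupV.
    by case/noc=> _ /commute_sym.
  - have : y \in 'Z(G) by rewrite -(mulKg z y) -Dg groupM ?groupV.
    by case/noc=> /noxy.
  have : x * y \in 'Z(G) by rewrite -(mulKg z (x * y)) -Dg groupM ?groupV.
  case/noc=> _ c; case: noxy; apply: (mulIg y).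
  by rewrite -[LHS]mulgA; apply: esym c.
have Gs := subsetP sKG s Ks.
have defG' : G^`(1) = <[s]>.
  apply/eqP; rewrite eqEsubset cycle_subG defs -xys mem_commg // andbT.
  have nsG : G \subset 'N(<[s]>).
    rewrite cents_norm // centsC cycle_subG; apply/centP=> g Gg.
    by have /centerP[_] := subsetP sKZ s Ks; apply.
  rewrite xys -defs; apply: der1_min => //.
  have quo g : g \in G -> exists2 z, z \in K & exists i j, g = z * (x ^+ i * y ^+ j).
    case/cosK=> z Kz gz; exists z => //; case: gz => ->.
    - by exists 0, 0; rewrite !mulg1.
    - by exists 1%N, 0; rewrite mulg1.
    - by exists 0, 1%N; rewrite mul1g.
    by exists 1%N, 1%N.
  have nx := subsetP nsG _ Gx; have ny := subsetP nsG _ Gy.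
  have cxy : commute (coset <[s]> x) (coset <[s]> y).
    rewrite /commute -!morphM // yx [RHS]morphM ?groupM ?(subsetP nsG _ Gs) //.
    by rewrite /= (coset_id (cycle_id s)) mul1g.
  have sub : G / <[s]> \subset (K / <[s]>) <*> <[coset <[s]> x]> <*> <[coset <[s]> y]>.
    apply/subsetP=> _ /morphimP[g Ng /quo[z Kz [i [j ->]]] ->].
    have Nz := subsetP nsG z (subsetP sKG z Kz).
    rewrite /=; have -> : coset <[s]> (z * (x ^+ i * y ^+ j)) =
        coset <[s]> z * coset <[s]> x ^+ i * coset <[s]> y ^+ j.
      by rewrite !morphM ?groupM ?groupX // !morphX // mulgA.
    apply: groupM; last by rewrite (subsetP (joing_subr _ _)) ?mem_cycle.
    apply: (subsetP (joing_subl _ _)); apply: groupM.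
      by rewrite (subsetP (joing_subl _ _)) // mem_morphim.
    by rewrite (subsetP (joing_subr _ _)) ?mem_cycle.
  apply: abelianS sub _.
  have cKq u : u \in G -> coset <[s]> u \in 'C(K / <[s]>).
    move=> Gu; apply/centP=> _ /morphimP[k Nk Kk ->]; apply/commute_sym.
    have Nu := subsetP nsG u Gu; rewrite /commute -!morphM //.
    by have /centerP[_ ->] := subsetP sKZ k Kk.
  have cyc (u : coset_of <[s]>) : abelian <[u]> := cycle_abelian u.
  rewrite -/(K / <[s]>) abelianY abelianY !cyc quotient_abelian //= !cycle_subG cKq //=.
  rewrite centY inE cKq //=.
  by apply/centP=> _ /cycleP[i ->]; apply/commuteX/commute_sym.
have os : #[s] = 2 by apply: nt_prime_order; rewrite // expgS expg1.
have oQ : #|G / G^`(1)| = (2 ^ (m1 + m2 + m3 + m4).+1)%N.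
  apply/eqP; rewrite -(eqn_pmul2r (isT : 0 < 2)%N) -{1}os orderE -defG'.
  by rewrite card_quotient ?gFnorm // mulnC Lagrange ?gFsub // eG expnSr.
have nG' : G \subset 'N(G^`(1)) by rewrite gFnorm.
have G't : coset G^`(1) s = 1 by rewrite coset_id // defG' cycle_id.
have N1 := subsetP nG' _ (subsetP sKG _ K1); have N4 := subsetP nG' _ G4.
have Nx := subsetP nG' _ Gx; have Ny := subsetP nG' _ Gy.
have [defQ oQs] : <[coset G^`(1) t1]> \x <[coset G^`(1) x]> \x <[coset G^`(1) y]>
      \x <[coset G^`(1) t4]> = G / G^`(1) /\
    [/\ #[coset G^`(1) t1] = 2 ^ m1.-1, #[coset G^`(1) x] = 2 ^ m2.+1,
        #[coset G^`(1) y] = 2 ^ m3.+1 & #[coset G^`(1) t4] = 2 ^ m4]%N.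
  apply: dprod4_of_card => //.
  - exact: sub_der1_abelian.
  - by split; apply: mem_quotient => //; apply: (subsetP sKG).
  - split; rewrite -morphX //.
    + by rewrite -defs.
    + by rewrite expnS expgM ex e2 morph1.
    + by rewrite expnS expgM ey e3 morph1.
    by rewrite -o4 expg_order morph1.
  (* In the abelian quotient t2 and t3 become the squares of x and y, so a central factor has even
     exponents there, and a further x or y raises one exponent by 1. *)
  - apply/subsetP=> _ /morphimP[g Ng Gg ->]; have [z Kz gz] := cosK g Gg.
    have := subsetP sKM z Kz.
    case/mulsgP=> _ _ /mulsgP[_ _ /mulsgP[_ _ /cycleP[a ->] /cycleP[b ->] ->] /cycleP[c ->] ->]
      /cycleP[d ->] Dz.
    have qz : coset G^`(1) z = coset G^`(1) t1 ^+ a * coset G^`(1) x ^+ (2 * b) *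
        coset G^`(1) y ^+ (2 * c) * coset G^`(1) t4 ^+ d.
      rewrite Dz !morphM ?groupM ?groupX ?(subsetP nG' _ (subsetP sKG _ _)) //.
      by rewrite -!morphX // !expgM ex ey.
    have cQ u v : u \in G -> v \in G -> commute (coset G^`(1) u) (coset G^`(1) v).
      move=> Gu Gv; apply: (centsP (sub_der1_abelian (subxx _))); exact: mem_quotient.
    have fin i j k l : coset G^`(1) t1 ^+ i * coset G^`(1) x ^+ j *
        coset G^`(1) y ^+ k * coset G^`(1) t4 ^+ l \in
        <[coset G^`(1) t1]> * <[coset G^`(1) x]> * <[coset G^`(1) y]> * <[coset G^`(1) t4]>.
      by rewrite !mem_mulg ?mem_cycle.
    have Nz := subsetP nG' z (subsetP sKG z Kz).
    have mulx i j k l : coset G^`(1) t1 ^+ i * coset G^`(1) x ^+ j *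
        coset G^`(1) y ^+ k * coset G^`(1) t4 ^+ l * coset G^`(1) x =
        coset G^`(1) t1 ^+ i * coset G^`(1) x ^+ j.+1 *
        coset G^`(1) y ^+ k * coset G^`(1) t4 ^+ l.
      rewrite expgSr -!mulgA; congr (_ * (_ * _)); rewrite mulgA; apply: esym.
      by apply: commuteM; apply: commuteX; apply: cQ.
    have muly i j k l : coset G^`(1) t1 ^+ i * coset G^`(1) x ^+ j *
        coset G^`(1) y ^+ k * coset G^`(1) t4 ^+ l * coset G^`(1) y =
        coset G^`(1) t1 ^+ i * coset G^`(1) x ^+ j *
        coset G^`(1) y ^+ k.+1 * coset G^`(1) t4 ^+ l.
      rewrite expgSr -!mulgA; congr (_ * (_ * (_ * _))); apply: esym.
      by apply: commuteX; apply: cQ.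
    have qzM w : w \in G -> coset G^`(1) (z * w) = coset G^`(1) z * coset G^`(1) w.
      by move=> Gw; rewrite morphM // (subsetP nG').
    case: gz => -> /=.
    + by rewrite qz fin.
    + by rewrite qzM // qz mulx fin.
    + by rewrite qzM // qz muly fin.
    by rewrite qzM ?groupM // morphM // qz mulgA mulx muly fin.
  by rewrite oQ -!expnD ea.
split=> //; rewrite -?KZ //.
- by rewrite xx yy.
Qed.

End TypeD5.

(** * Self-pairings of finite abelian groups *)

Section Pairings.

Local Open Scope group_scope.

Lemma dprod_proj (gT : finGroupType) (A B C : {group gT}) :
    B \x C = A ->
  exists p1 p2 : gT -> gT,
  [/\ forall u, u \in A -> [/\ p1 u \in B, p2 u \in C & u = p1 u * p2 u],
      {in A &, {morph p1 : u v / u * v}}, {in A &, {morph p2 : u v / u * v}},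
      forall u, u \in B -> p1 u = u /\ p2 u = 1
    & forall v, v \in C -> p1 v = 1 /\ p2 v = v].
Proof.
case/dprodP=> _ defA cBC tiBC.
have compl : C \in [complements to B in A] by apply/complP.
have nBA : B <| A by rewrite -defA -cent_joinEr // normalYl cents_norm.
exists (divgr B C), (remgr B C); split.
- by move=> u Au; rewrite mem_divgr ?mem_remgr ?defA // -divgr_eq.
- exact: divgrM compl cBC.
- exact: remgrM compl nBA.
- by move=> u Bu; rewrite divgr_id // remgr1.
move=> v Cv; have r := remgr_id tiBC Cv; split=> //.
by rewrite -[RHS](mulgV v) -{3}r.
Qed.

Variables (E : fieldType) (e : nat) (zeta : E).
Hypothesis prim_zeta : e.-primitive_root%R zeta.

Definition self_pairing (gT : finGroupType) (A : {set gT}) (chi : gT -> gT -> E) : Prop :=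
  [/\ {in A & &, forall a b c, chi (a * b) c = (chi a c * chi b c)%R},
      {in A &, forall a b, chi a b = chi b a},
      {in A &, forall a b, (chi a b ^+ e = 1)%R}
    & {in A, forall a, {in A, forall b, chi a b = 1%R} -> a = 1}].

(** The pairing sends (t^i, t^j) to zeta^(d i j) with d = e / #[t]; [lg] is a discrete logarithm to
    base t. *)
Lemma pairing_cycle (gT : finGroupType) (t : gT) :
  #[t] %| e -> exists chi, self_pairing <[t]> chi.
Proof.
case/dvdnP=> d De; have e_gt0 := prim_order_gt0 prim_zeta.
have d_gt0 : 0 < d by move: e_gt0; rewrite De muln_gt0 => /andP[].
pose lg u := odflt 0 (omap val [pick i : 'I_#[t] | t ^+ i == u]).
have lgK u : u \in <[t]> -> t ^+ lg u = u.
  case/cyclePmin=> i lti ->; rewrite /lg; case: pickP => [j /eqP //|/(_ (Ordinal lti))].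
  by rewrite eqxx.
have zz i j : i = j %[mod #[t]] -> (zeta ^+ (d * i) = zeta ^+ (d * j))%R.
  move=> eij; apply/eqP; rewrite (eq_prim_root_expr prim_zeta) De.
  by rewrite -!muln_modr eij.
have lgM u v : u \in <[t]> -> v \in <[t]> -> lg (u * v) = lg u + lg v %[mod #[t]].
  move=> tu tv; apply/eqP; rewrite -eq_expg_mod_order expgD !lgK //.
  by rewrite groupM.
exists (fun u v => (zeta ^+ (d * (lg u * lg v)))%R); split.
- move=> a b c ta tb tc; rewrite -exprD -mulnDr -mulnDl; apply: zz.
  by rewrite -modnMml lgM // modnMml.
- by move=> a b _ _; rewrite (mulnC (lg a)).
- by move=> a b _ _; rewrite exprAC (prim_expr_order prim_zeta) expr1n.
move=> a ta /(_ t (cycle_id t)) h.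
have lt1 : lg t = 1 %[mod #[t]].
  by apply/eqP; rewrite -eq_expg_mod_order lgK ?cycle_id // expg1.
have : (zeta ^+ (d * lg a) = 1)%R.
  by rewrite -h; apply: zz; rewrite -modnMmr lt1 modnMmr muln1.
move/eqP; rewrite -(prim_order_dvd prim_zeta) De dvdn_pmul2l //.
by rewrite order_dvdn lgK // => /eqP.
Qed.

Lemma pairing_dprod (gT : finGroupType) (A B C : {group gT}) chiB chiC :
    B \x C = A -> self_pairing B chiB -> self_pairing C chiC ->
  exists chi, self_pairing A chi /\
    {in B & C, forall b c, chi b c = 1%R}.
Proof.
move=> defA [mB sB eB nB] [mC sC eC nC].
have [p1 [p2 [p12 p1M p2M pB pC]]] := dprod_proj defA.
have sBA : B \subset A by rewrite -(dprodW defA) mulG_subl.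
have sCA : C \subset A by rewrite -(dprodW defA) mulG_subr.
have m1B (chi : gT -> gT -> E) (D : {group gT}) : self_pairing D chi ->
    forall u, u \in D -> (chi 1%g u = 1)%R.
  case=> mD _ eD _ u Du; have E1 := mD 1 1 u (group1 D) (group1 D) Du.
  have e_gt0 := prim_order_gt0 prim_zeta.
  have nz : (chi 1%g u != 0)%R.
    apply: contraTneq (oner_neq0 E) => c0; have := eD 1 u (group1 D) Du.
    by rewrite c0 expr0n gtn_eqF // => <-; rewrite eqxx.
  by apply: (mulfI nz); rewrite -E1 !mulg1 mulr1.
exists (fun u v => (chiB (p1 u) (p1 v) * chiC (p2 u) (p2 v))%R); split; first split.
- move=> a b c Aa Ab Ac; rewrite p1M // p2M //.
  have [? ? _] := p12 a Aa; have [? ? _] := p12 b Ab; have [? ? _] := p12 c Ac.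
  by rewrite mB // mC // mulrACA.
- move=> a b Aa Ab; have [? ? _] := p12 a Aa; have [? ? _] := p12 b Ab.
  by rewrite sB // sC.
- move=> a b Aa Ab; have [? ? _] := p12 a Aa; have [? ? _] := p12 b Ab.
  by rewrite exprMn eB // eC // mulr1.
- move=> a Aa h; have [Ba Ca ->] := p12 a Aa.
  have -> : p1 a = 1.
    apply: nB => // b Bb; have := h b (subsetP sBA b Bb).
    have [-> ->] := pB b Bb; rewrite sC // (m1B chiC C) ?mulr1 //.
  rewrite mul1g; apply: nC => // c Cc; have := h c (subsetP sCA c Cc).
  by have [-> ->] := pC c Cc; rewrite sB // (m1B chiB B) ?mul1r.
move=> b c Bb Cc; have [-> ->] := pB b Bb; have [-> ->] := pC c Cc.
by rewrite sB // (m1B chiB B) // (m1B chiC C) // mulr1.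
Qed.

(** The orthogonality of [a] and [B] is kept because s is a power of t1: with a = t1, the value of a
    character at s then depends on its t1-component only. *)
Lemma pairing_dprod4 (gT : finGroupType) (A : {group gT}) (a b c d : gT) :
    <[a]> \x <[b]> \x <[c]> \x <[d]> = A ->
    [/\ #[a] %| e, #[b] %| e, #[c] %| e & #[d] %| e] ->
  exists (B : {group gT}) chi, [/\ <[a]> \x B = A, self_pairing A chi &
    forall u, u \in B -> chi a u = 1%R].
Proof.
rewrite -!dprodA => defA [ea eb ec ed].
have [[_ B _ defB] _ _ _] := dprodP defA; rewrite defB in defA.
have [[_ C _ defC] _ _ _] := dprodP defB; rewrite defC in defB.
have [chia Pa] := pairing_cycle ea; have [chib Pb] := pairing_cycle eb.
have [chic Pc] := pairing_cycle ec; have [chid Pd] := pairing_cycle ed.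
have [chiC [PC _]] := pairing_dprod defC Pc Pd.
have [chiB [PB _]] := pairing_dprod defB Pb PC.
have [chi [P o]] := pairing_dprod defA Pa PB.
by exists B, chi; split=> // u Bu; apply: o; rewrite ?cycle_id.
Qed.

End Pairings.

Section PairingTheory.

Local Open Scope ring_scope.

Variables (E : fieldType) (e : nat) (zeta : E).
Hypothesis prim_zeta : e.-primitive_root zeta.
Variables (gT : finGroupType) (A : {group gT}) (chi : gT -> gT -> E).
Hypothesis abA : abelian A.
Hypothesis chiP : self_pairing e A chi.

Lemma pairing_neq0 a b : a \in A -> b \in A -> chi a b != 0.
Proof.
case: chiP => _ _ ex _ Aa Ab; apply: contraTneq (oner_neq0 E) => c0.
have := ex a b Aa Ab; have e_gt0 := prim_order_gt0 prim_zeta.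
by rewrite c0 expr0n gtn_eqF // => <-; rewrite eqxx.
Qed.

Lemma pairing1l a : a \in A -> chi 1%g a = 1.
Proof.
case: chiP => m _ _ _ Aa; have A1 := group1 A.
by apply: (mulfI (pairing_neq0 A1 Aa)); rewrite -m // mulg1 mulr1.
Qed.

Lemma pairing1r a : a \in A -> chi a 1%g = 1.
Proof. by case: chiP => _ sym _ _ Aa; rewrite sym ?group1 // pairing1l. Qed.

Lemma pairingMr a b c : a \in A -> b \in A -> c \in A ->
  chi a (b * c)%g = chi a b * chi a c.
Proof.
by case: chiP => m sym _ _ Aa Ab Ac; rewrite sym ?groupM // m // !(sym a).
Qed.

Lemma pairingXl a b n : a \in A -> b \in A -> chi (a ^+ n)%g b = chi a b ^+ n.
Proof.
case: chiP => m _ _ _ Aa Ab; elim: n => [|n IHn]; first by rewrite pairing1l.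
by rewrite expgS m ?groupX // IHn exprS.
Qed.

Lemma pairing_inj a b : a \in A -> b \in A -> {in A, chi a =1 chi b} -> a = b.
Proof.
case: chiP => m _ _ n Aa Ab eab; apply/eqP; rewrite eq_mulgV1; apply/eqP/n.
  by rewrite groupM ?groupV.
move=> c Ac; rewrite m ?groupV // eab // -m ?groupV //.
by rewrite mulgV pairing1l.
Qed.

Lemma sum_pairing a : a \in A ->
  \sum_(b in A) chi b a = if a == 1%g then #|A|%:R else 0.
Proof.
move=> Aa; case: eqP => [-> | /eqP ne].
  by rewrite -sum1_card natr_sum; apply: eq_bigr => b Ab; rewrite pairing1r.
have [c Ac nec] : exists2 c, c \in A & chi c a != 1.
  apply/exists_inP; apply: contraR ne; rewrite negb_exists_in => /forall_inP h.
  case: chiP => _ sym _ n; apply/eqP/n => // b Ab; apply/eqP.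
  by have := h b Ab; rewrite negbK sym.
apply/eqP; have := mulIr_eq0 (\sum_(b in A) chi b a) (mulIf (_ : chi c a - 1 != 0)).
rewrite subr_eq0 nec => <- //; rewrite mulrBr mulr1 subr_eq0; apply/eqP.
rewrite [RHS](reindex_inj (mulgI c)) /= mulr_suml.
apply: eq_big => [b | b Ab]; first by rewrite groupMl.
by case: chiP => m _ _ _; rewrite m // mulrC.
Qed.

End PairingTheory.

(** * Cyclic subgroups and orbits of power maps *)

Section Images.

(** Orbits and cyclic subgroups are all counted as sizes of images, so comparing two counts means
    comparing two equivalence relations on [S]. *)
Lemma leq_card_imset (aT bT cT : finType) (S : {set aT}) (f : aT -> bT) (g : aT -> cT) :
  {in S &, forall a b, f a = f b -> g a = g b} -> #|g @: S| <= #|f @: S|.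
Proof.
move=> fg; pose h v := omap g [pick a in S | f a == v].
have hf a : a \in S -> h (f a) = Some (g a).
  move=> Sa; rewrite /h; case: pickP => [b /andP[Sb /eqP e]|/(_ a)].
    by rewrite /= (fg b a).
  by rewrite Sa eqxx.
rewrite -(card_imset _ Some_inj); apply: leq_trans (leq_imset_card h _).
apply/subset_leq_card/subsetP=> _ /imsetP[_ /imsetP[a Sa ->] ->].
by rewrite -hf // imset_f // imset_f.
Qed.

Lemma eq_card_imset (aT bT cT : finType) (S : {set aT}) (f : aT -> bT) (g : aT -> cT) :
  {in S &, forall a b, f a = f b <-> g a = g b} -> #|f @: S| = #|g @: S|.
Proof.
move=> fg; apply/eqP; rewrite eqn_leq.
by rewrite !leq_card_imset // => a b Sa Sb; case: (fg a b Sa Sb).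
Qed.

Lemma card_imsetID (aT bT : finType) (S B : {set aT}) (f : aT -> bT) :
    {in S &, forall a b, f a = f b -> (a \in B) = (b \in B)} ->
  #|f @: S| = #|f @: (S :&: B)| + #|f @: (S :\: B)|.
Proof.
move=> fB; rewrite -{1}(setID S B) imsetU cardsU [X in _ - X](_ : _ = 0) ?subn0 //.
apply: eq_card0 => v; apply/negbTE/negP; rewrite in_setI => /andP[/imsetP[a + ->] /imsetP[b]].
by rewrite !inE => /andP[Sa Ba] /andP[nBb Sb] eab; case/negP: nBb; rewrite -(fB a b).
Qed.

End Images.

(** * Odd residues modulo powers of 2 *)

Section OddPowers.

Lemma odd_power_mod8 q i : odd q -> q ^ i = 1 %[mod 8] \/ q ^ i = q %[mod 8].
Proof.
move=> odd_q.
have q2 : q * q = 1 %[mod 8].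
  rewrite -modnMm; have : q %% 8 < 8 by rewrite ltn_mod.
  have : odd (q %% 8) by rewrite odd_mod.
  by case: (q %% 8) => [|[|[|[|[|[|[|[|]]]]]]]].
elim: i => [|i [] IHi]; first by left.
  by right; rewrite expnS -modnMmr IHi modnMmr muln1.
by left; rewrite expnS -modnMmr IHi modnMmr.
Qed.

(** Gives the exact power of 2 dividing q^(2^(j+1)) - 1. For q = 8c + 3, q^2 = 1 + 8(2(4c^2 + 3c) +
    1), and each squaring adds one factor 2. *)
Lemma pow2_expn q j : q = 3 %[mod 8] ->
  exists k, q ^ (2 ^ j.+1) = 1 + 2 ^ j.+3 * k.*2.+1.
Proof.
move=> q3; elim: j => [|j [k IHj]].
  have q3' : q %% 8 = 3 by rewrite q3.
  have := divn_eq q 8; rewrite q3' => ->; set c := q %/ 8.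
  exists (4 * c * c + 3 * c); rewrite -[2 ^ 1]/2 -[2 ^ 3]/8 -[_ ^ 2]/(_ * _).
  by rewrite -mul2n; nia.
exists (k + 2 ^ j.+1 * (k.*2.+1 * k.*2.+1)).
rewrite [2 ^ j.+2]expnS mulnC expnM IHj -[_ ^ 2]/(_ * _).
have -> : 2 ^ j.+4 = 8 * 2 ^ j.+1 by rewrite !expnS !mulnA.
have -> : 2 ^ j.+3 = 4 * 2 ^ j.+1 by rewrite !expnS !mulnA.
by rewrite -!mul2n; move: (2 ^ j.+1) => P; nia.
Qed.

Lemma modn_double a b m : a = b %[mod m] ->
  a = b %[mod m.*2] \/ a = b + m %[mod m.*2].
Proof.
have aux u v c : u = v + m * c -> u = v %[mod m.*2] \/ u = v + m %[mod m.*2].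
  move=> ->; rewrite -(odd_double_half c); case: (odd c) => /=; [right | left].
    have -> : v + m * (1 + c./2.*2) = c./2 * m.*2 + (v + m) by rewrite -!mul2n; nia.
    by rewrite modnMDl.
  have -> : v + m * (0 + c./2.*2) = c./2 * m.*2 + v by rewrite -!mul2n; nia.
  by rewrite modnMDl.
move=> E; case: (leqP b a) => [ba | /ltnW ab].
  have /dvdnP[c Dc] : m %| a - b by rewrite -eqn_mod_dvd // E.
  by apply: (aux a b c); rewrite mulnC -Dc subnKC.
have /dvdnP[c Dc] : m %| b - a by rewrite -eqn_mod_dvd // E.
have [|E1|E1] := aux b a c; first by rewrite mulnC -Dc subnKC.
  by left.
by right; rewrite -modnDml E1 modnDml -addnA addnn modnDr.
Qed.

(** -1 and q generate the odd residues modulo 2^k; divisibility of r + q^i stands for r = -q^i. By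
    induction on the exponent, starting at 8, one further bit is corrected at each step. *)
Lemma odd_pm_power q k r : q = 3 %[mod 8] -> odd r ->
  exists i, r = q ^ i %[mod 2 ^ k] \/ 2 ^ k %| r + q ^ i.
Proof.
move=> q3 odd_r.
have odd_q : odd q by rewrite -(odd_mod q (erefl : odd 8 = false)) q3.
suff: exists i, r = q ^ i %[mod 2 ^ k.+3] \/ 2 ^ k.+3 %| r + q ^ i.
  case=> i H; exists i; have d : 2 ^ k %| 2 ^ k.+3 by apply: dvdn_exp2l; rewrite -addn3 leq_addr.
  case: H => H; [left | right; exact: dvdn_trans H].
  by rewrite -(modn_dvdm r d) H modn_dvdm.
have two j : (2 ^ j).*2 = 2 ^ j.+1 by rewrite -mul2n -expnS.
(* By [pow2_expn], multiplying q^i by q^(2^(j+1)) flips exactly the bit 2^(j+3) modulo 2^(j+4). *)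
have shift j i : q ^ (i + 2 ^ j.+1) = q ^ i + 2 ^ j.+3 %[mod 2 ^ j.+4].
  have [c Dc] := pow2_expn j q3.
  have : odd (q ^ i * c.*2.+1) by rewrite oddM oddX odd_q orbT /= odd_double.
  rewrite expnD Dc mulnDr muln1 mulnCA => odd_c.
  rewrite -(odd_double_half (q ^ i * c.*2.+1)) odd_c mulnDr muln1 -mul2n mulnCA mulnA.
  by rewrite -expnS addnA mulnC addnC modnMDl.
elim: k => [|k [i [] H]].
- have : odd (r %% 8) by rewrite odd_mod.
  have : r %% 8 < 8 by rewrite ltn_mod.
  have q31 : q ^ 1 = 3 %[mod 8] by rewrite expn1.
  have s3 : (r + q ^ 1) %% 8 = (r %% 8 + 3) %% 8 by rewrite -modnDm q31 modnDm -modnDml.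
  have s1 : (r + q ^ 0) %% 8 = (r %% 8 + 1) %% 8 by rewrite -modnDml.
  rewrite -[2 ^ 3]/8; case: (r %% 8) s3 s1 => [|[|[|[|[|[|[|[|]]]]]]]] // s3 s1 _ _.
  + by exists 0; left.
  + by exists 1; left; rewrite q31.
  + by exists 1; right; rewrite /dvdn s3.
  by exists 0; right; rewrite /dvdn s1.
- have [H1 | H1] := modn_double H; rewrite two in H1; first by exists i; left.
  by exists (i + 2 ^ k.+1); left; rewrite H1 shift.
have [] := @modn_double (r + q ^ i) 0 (2 ^ k.+3); rewrite ?mod0n ?two.
- exact/eqP.
- by move/eqP; exists i; right.
rewrite add0n => H1; exists (i + 2 ^ k.+1); right.
rewrite /dvdn -modnDmr shift modnDmr addnA -modnDml H1 modnDml addnn two.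
by rewrite modnn.
Qed.

(** Modulo 4, q is -1, so one more factor q absorbs the sign. *)
Lemma eqn_mod_odd_power4 q r : q = 3 %[mod 8] -> odd r -> exists i, r = q ^ i %[mod 4].
Proof.
move=> q3 odd_r; have [i [E|]] := odd_pm_power 2 q3 odd_r; first by exists i.
have q4 : q = 3 %[mod 4] by rewrite -(modn_dvdm q (isT : 4 %| 8)) q3.
case/dvdnP=> c Dc; exists i.+1; rewrite expnS -modnMml q4 modnMml.
apply/eqP; rewrite -(eqn_modDr (q ^ i)) Dc -[2 ^ 2]/4 -mulSnr.
by rewrite modnMl modnMr.
Qed.

End OddPowers.

Section CountingOrbits.

Local Open Scope group_scope.

Variables (gT : finGroupType) (T : {set gT}) (q : nat).
Hypothesis T2 : forall b, b \in T -> 2.-elt b.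
Hypothesis TX : forall b r, b \in T -> odd r -> b ^+ r \in T.
Hypothesis odd_q : odd q.

Definition power_orbit (b : gT) : {set gT} := [set c | fconnect (fun u => u ^+ q) b c].

Lemma mem_power_orbit b c : reflect (exists i, c = b ^+ (q ^ i)) (c \in power_orbit b).
Proof.
have itE i : iter i (fun u => u ^+ q) b = b ^+ (q ^ i).
  by elim: i => // i IHi; rewrite iterS IHi -expgM -expnSr.
rewrite inE; apply: (iffP idP) => [/iter_findex <- | [i ->]].
  by exists (findex (fun u => u ^+ q) b c); rewrite itE.
by rewrite -itE fconnect_iter.
Qed.

Lemma odd_generator (b c : gT) : 2.-elt b -> <[b]> = <[c]> <-> exists2 r, odd r & c = b ^+ r.
Proof.
move=> b2; split=> [E | [r odd_r ->]].
  have /cycleP[r Dc] : c \in <[b]> by rewrite E cycle_id.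
  have : generator <[b]> (b ^+ r) by rewrite /generator -Dc E.
  rewrite generator_coprime; have [b1 _ | nb1] := eqVneq b 1.
    by exists 1%N; rewrite // expg1 Dc b1 expg1n.
  move=> co; exists r => //; rewrite -coprime2n; apply: coprime_dvdl co.
  by have [] := pgroup_pdiv (b2 : 2.-group <[b]>); rewrite ?cycle_eq1.
apply/eqP; rewrite -/(generator _ _) generator_coprime.
by apply: pnat_coprime b2 _; rewrite p'natE // dvdn2 odd_r.
Qed.

(** The orbits are defined by forward iteration only. By Euler's theorem the odd number q is
    invertible modulo the order of the 2-element b, so iteration can be undone. *)
Lemma power_orbit_eqP b c : b \in T ->
  power_orbit b = power_orbit c <-> exists i, c = b ^+ (q ^ i).
Proof.
move=> Tb; split=> [E | [i Dc]].
  by apply/mem_power_orbit; rewrite E; apply/mem_power_orbit; exists 0; rewrite expg1.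
have [j Db] : exists j, b = c ^+ (q ^ j).
  have t_gt0 : 0 < totient #[b] by rewrite totient_gt0 order_gt0.
  exists (i * (totient #[b]).-1)%N; rewrite Dc -expgM -expnD -mulnS prednK // mulnC expnM.
  have Eu : q ^ totient #[b] = 1 %[mod #[b]].
    apply: Euler_exp_totient; rewrite coprime_sym; apply: pnat_coprime (T2 Tb) _.
    by rewrite p'natE // dvdn2 odd_q.
  rewrite -[LHS]expg1; apply/eqP; rewrite eq_expg_mod_order eq_sym.
  by rewrite -modnXm Eu modnXm exp1n.
apply/setP=> x; apply/mem_power_orbit/mem_power_orbit=> [[k ->]|[k ->]].
  by exists (j + k)%N; rewrite Db -!expgM -!expnD.
by exists (i + k)%N; rewrite Dc -!expgM -!expnD.
Qed.

Lemma power_orbit_cycle b c : b \in T -> c \in T ->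
  power_orbit b = power_orbit c -> <[b]>%G = <[c]>%G.
Proof.
move=> Tb Tc /(power_orbit_eqP _ Tb)[i Dc]; apply: val_inj.
by apply/odd_generator; [exact: T2 | exists (q ^ i)%N; rewrite // oddX odd_q orbT].
Qed.

Let B4 := [set b : gT | b ^+ 4 == 1].

Lemma cycle_B4 b c : <[b]>%G = <[c]>%G -> (b \in B4) = (c \in B4).
Proof.
move/(congr1 val)=> /= E; rewrite !inE -!order_dvdn.
by rewrite !orderE E.
Qed.

Lemma order8 b : b \in T :\: B4 -> 8 %| #[b].
Proof.
rewrite !inE -order_dvdn => /andP[n4 Tb]; have /p_natP[k E] := T2 Tb.
rewrite E (dvdn_exp2l 2 (_ : 3 <= k)) // ltnNge; apply: contra n4 => k2.
by rewrite E (dvdn_exp2l 2 k2).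
Qed.

Let twist r (b : gT) (s : bool) := if s then b ^+ r else b.

(** A generator of <[b]> in [T] that depends only on the subgroup, so that orbits attached to it are
    indexed by cyclic subgroups. *)
Let rep (b : gT) : gT := odflt 1 [pick c in T :\: B4 | <[c]>%G == <[b]>%G].

Let repP b : b \in T :\: B4 -> rep b \in T :\: B4 /\ <[rep b]>%G = <[b]>%G.
Proof.
move=> Tb; rewrite /rep; case: pickP => [c /andP[Tc /eqP] //|/(_ b)].
by rewrite Tb eqxx.
Qed.

Let rep_eq b c : <[b]>%G = <[c]>%G -> rep b = rep c.
Proof. by move=> E; rewrite /rep E. Qed.

Let twistT r b s : odd r -> b \in T :\: B4 -> twist r b s \in T :\: B4.
Proof.
move=> odd_r Tb; case: s => //=; rewrite /twist.
have /setDP[Tb' nB] := Tb; apply/setDP; split; first exact: TX.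
suff <- : (b \in B4) = (b ^+ r \in B4) by [].
by apply: cycle_B4; apply: val_inj; apply/odd_generator; [exact: T2 | exists r].
Qed.

Let twist_cycle r b s : odd r -> b \in T :\: B4 -> <[twist r b s]>%G = <[b]>%G.
Proof.
move=> odd_r /setDP[Tb _]; case: s => //; apply/esym/val_inj.
by apply/odd_generator; [exact: T2 | exists r].
Qed.

(* An element of order at least 8 and its r-th power, where [r] is neither 1 nor
   [q] modulo 8, generate the same cyclic group but lie in distinct orbits. *)
Let F (u : gT * bool) := (<[u.1]>%G, u.2).
Let G r (u : gT * bool) := power_orbit (twist r (rep u.1) u.2).
Let U := setX (T :\: B4) [set: bool].

Let cardF : #|F @: U| = (2 * #|(fun b => <[b]>%G) @: (T :\: B4)|)%N.
Proof.
have -> : F @: U = setX ((fun b => <[b]>%G) @: (T :\: B4)) [set: bool].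
  apply/setP=> -[C s]; apply/imsetP/idP=> [[[b s'] + [-> ->]]|].
    by rewrite !in_setX /= !in_setT !andbT => Tb; apply: imset_f.
  rewrite in_setX /= in_setT andbT => /imsetP[b Tb ->].
  by exists (b, s) => //; rewrite in_setX /= Tb in_setT.
by rewrite cardsX cardsT card_bool mulnC.
Qed.

Let FG_leq r : odd r -> r != 1 %[mod 8] -> r != q %[mod 8] ->
  #|F @: U| <= #|G r @: U|.
Proof.
move=> odd_r r1 rq; apply: leq_card_imset => -[b s] [c s'].
rewrite !in_setX /= !in_setT !andbT /F /G /= => Tb Tc.
have [Tb' Eb] := repP Tb; have [Tc' Ec] := repP Tc.
have Tbs := twistT s odd_r Tb'; have Tcs := twistT s' odd_r Tc'.
move=> E; have Ecyc : <[b]>%G = <[c]>%G.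
  rewrite -Eb -Ec -(twist_cycle s odd_r Tb') -(twist_cycle s' odd_r Tc').
  by apply: power_orbit_cycle E; [case/setDP: Tbs | case/setDP: Tcs].
rewrite Ecyc; congr (_, _); move: E; rewrite (rep_eq Ecyc); move: (rep c) Tc' => {Tbs Tcs} d Td.
have o8 := order8 Td; have /setDP[Td' _] := Td.
have neq : power_orbit d <> power_orbit (d ^+ r).
  case/(power_orbit_eqP _ Td')=> i /eqP; rewrite eq_expg_mod_order => /eqP E8.
  have {}E8 : r = q ^ i %[mod 8] by rewrite -(modn_dvdm r o8) E8 modn_dvdm.
  by case: (odd_power_mod8 i odd_q) => Ei; [case/eqP: r1 | case/eqP: rq]; rewrite E8.
by case: s s' => [] [] //= E; case: neq.
Qed.

Let G_sub r : odd r -> G r @: U \subset power_orbit @: (T :\: B4).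
Proof.
move=> odd_r; apply/subsetP=> _ /imsetP[[b s] + ->]; rewrite in_setX /= in_setT andbT => Tb.
by apply: imset_f; apply: twistT => //; case: (repP Tb).
Qed.

Let split_cycles : #|(fun b => <[b]>%G) @: T| =
  #|(fun b => <[b]>%G) @: (T :&: B4)| + #|(fun b => <[b]>%G) @: (T :\: B4)|.
Proof. by apply: card_imsetID => b c _ _; apply: cycle_B4. Qed.

Let split_orbits : #|power_orbit @: T| =
  #|power_orbit @: (T :&: B4)| + #|power_orbit @: (T :\: B4)|.
Proof. by apply: card_imsetID => b c Tb Tc E; apply/cycle_B4/power_orbit_cycle. Qed.

(** Outside [B4] each cyclic subgroup yields two orbits at least, inside [B4] at least one. So only
    the subgroups of order dividing 4 are lost from twice the number of subgroups. *)
Lemma leq_power_orbits : (2 * #|(fun b => <[b]>%G) @: T| <=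
  #|power_orbit @: T| + #|(fun b => <[b]>%G) @: (T :&: B4)|)%N.
Proof.
have [r [odd_r r1 rq]] : exists r, [/\ odd r, r != 1 %[mod 8] & r != q %[mod 8]].
  (* Any odd [r] distinct from 1 and q modulo 8 does: 3, unless q is 3 itself. *)
  case: (eqVneq (q %% 8) 3) => [q3 | nq3]; [exists 5 | exists 3]; rewrite ?q3 //.
  by split=> //; rewrite eq_sym.
have h8 := leq_trans (FG_leq odd_r r1 rq) (subset_leq_card (G_sub odd_r)).
have h4 : #|(fun b => <[b]>%G) @: (T :&: B4)| <= #|power_orbit @: (T :&: B4)|.
  by apply: leq_card_imset => b c /setIP[Tb _] /setIP[Tc _]; apply: power_orbit_cycle.
move: h8; rewrite cardF split_cycles split_orbits; lia.
Qed.

Lemma card_power_orbits : q = 3 %[mod 8] ->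
  (2 * #|(fun b => <[b]>%G) @: T| =
  #|power_orbit @: T| + #|(fun b => <[b]>%G) @: (T :&: B4)|)%N.
Proof.
move=> q3; apply/eqP; rewrite eqn_leq leq_power_orbits /=.
have h4 : #|power_orbit @: (T :&: B4)| <= #|(fun b => <[b]>%G) @: (T :&: B4)|.
  apply: leq_card_imset => b c /setIP[Tb]; rewrite inE => b4 /setIP[Tc _] /(congr1 val) /=.
  case/(odd_generator _ (T2 Tb))=> r odd_r ->; apply/(power_orbit_eqP _ Tb).
  have [i Ei] := eqn_mod_odd_power4 q3 odd_r; exists i.
  apply/eqP; rewrite eq_expg_mod_order; apply/eqP.
  have d4 : #[b] %| 4 by rewrite order_dvdn.
  by rewrite -(modn_dvdm r d4) Ei modn_dvdm.
(* [r] acts as inversion; -1 and [q] generate the odd residues modulo [2 ^ n]. *)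
pose r := (#|gT| * 8).-1.
have rS : r.+1 = (#|gT| * 8)%N by rewrite prednK // muln_gt0 (cardD1 (1 : gT)).
(* The factor 8 in [r] makes it odd, whatever the parity of [#|gT|]. *)
have odd_r : odd r by rewrite -[odd r]negbK -[~~ odd r]/(odd r.+1) rS oddM andbF.
have expr (d : gT) : d ^+ r = d^-1.
  apply: (mulIg d); rewrite mulVg -expgSr rS expgM.
  have := order_dvdG (in_setT d : d \in [set: gT]%G).
  by rewrite cardsT order_dvdn => /eqP->; rewrite expg1n.
have hF : #|G r @: U| <= #|F @: U|.
  apply: leq_card_imset => -[b s] [c s'] _ _ /eqP.
  by rewrite /F xpair_eqE /= => /andP[/eqP E /eqP->]; rewrite /G /= (rep_eq E).
have h8 : #|power_orbit @: (T :\: B4)| <= #|G r @: U|.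
  apply/subset_leq_card/subsetP=> _ /imsetP[b Tb ->]; have [Td E] := repP Tb.
  have /setDP[Td' _] := Td; have /p_natP[n On] := T2 Td'.
  move/(congr1 val): E => /(odd_generator _ (T2 Td'))[k odd_k Eb].
  have [i [Ei | di]] := odd_pm_power n q3 odd_k.
    have -> : power_orbit b = G r (b, false).
      apply/esym/(power_orbit_eqP _ Td'); exists i; rewrite [LHS]Eb.
      by apply/eqP; rewrite eq_expg_mod_order On Ei.
    by apply: imset_f; rewrite in_setX in_setT andbT.
  have -> : power_orbit b = G r (b, true).
    apply/esym/power_orbit_eqP; first exact: TX.
    exists i; rewrite [LHS]Eb /twist expr expgVn; apply/eqP; rewrite eq_sym eq_invg_mul -expgD.
    by rewrite -order_dvdn On addnC.
  by apply: imset_f; rewrite in_setX in_setT andbT.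
move: h4 (leq_trans h8 hF); rewrite cardF split_cycles split_orbits.
by move: #|_| #|_| #|_| #|_| => ? ? ? ?; clear; lia.
Qed.

End CountingOrbits.

(** * Elements and cyclic subgroups of order dividing 4 *)

Section Torsion.

Local Open Scope group_scope.

Definition torsion (gT : finGroupType) (n : nat) (A : {set gT}) : {set gT} :=
  [set u in A | u ^+ n == 1].

Lemma card_torsion_dprod (gT : finGroupType) n (A B C : {group gT}) :
  B \x C = A -> #|torsion n A| = (#|torsion n B| * #|torsion n C|)%N.
Proof.
move=> defA; have [p1 [p2 [p12 p1M p2M pB pC]]] := dprod_proj defA.
have [_ defA' cBC _] := dprodP defA; rewrite -cardsX.
have sBA : B \subset A by rewrite -defA' mulG_subl.
have sCA : C \subset A by rewrite -defA' mulG_subr.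
have pBC b c : b \in B -> c \in C -> p1 (b * c) = b /\ p2 (b * c) = c.
  move=> Bb Cc; rewrite p1M ?p2M ?(subsetP sBA b) ?(subsetP sCA c) //.
  by have [-> ->] := pB b Bb; have [-> ->] := pC c Cc; rewrite mulg1 mul1g.
have inj : {in setX (torsion n B) (torsion n C) &, injective (fun u => u.1 * u.2)}.
  move=> [b c] [b' c']; rewrite !inE /= => /andP[/andP[Bb _] /andP[Cc _]].
  case/andP=> /andP[Bb' _] /andP[Cc' _] /= E.
  have [eb ec] := pBC b c Bb Cc; have [eb' ec'] := pBC b' c' Bb' Cc'.
  by congr (_, _); [rewrite -[RHS]eb' -E eb | rewrite -[RHS]ec' -E ec].
have expM b c : b \in B -> c \in C -> (b * c) ^+ n = b ^+ n * c ^+ n.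
  by move=> Bb Cc; apply/expgMn/esym/(centsP cBC).
rewrite -(card_in_imset inj); apply: eq_card => u; apply/idP/imsetP.
  rewrite inE => /andP[Au un]; have [Bu Cu Du] := p12 u Au.
  have eqn : p1 u ^+ n * p2 u ^+ n == 1 by rewrite -expM // -Du.
  have [e1 e2] := pBC _ _ (groupX n Bu) (groupX n Cu).
  exists (p1 u, p2 u) => //; rewrite !inE /= Bu Cu -e1 -{2}e2 (eqP eqn) /=.
  by have [-> ->] := pB 1 (group1 B); rewrite eqxx.
case=> -[b c]; rewrite !inE /= => /andP[/andP[Bb bn] /andP[Cc cn]] ->.
by rewrite groupM ?(subsetP sBA b) ?(subsetP sCA c) //= expM // (eqP bn) (eqP cn) mulg1.
Qed.

Lemma card_torsion_cycle (gT : finGroupType) n (a : gT) :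
  n %| #[a] -> #|torsion n <[a]>| = n.
Proof.
move=> na; have n_gt0 : 0 < n := dvdn_gt0 (order_gt0 a) na.
have -> : torsion n <[a]> = <[a ^+ (#[a] %/ n)]>.
  apply/setP=> u; rewrite inE; apply/andP/cycleP=> [[/cycleP[i ->]]|[k ->]].
    rewrite -expgM -order_dvdn -{1}(divnK na) dvdn_pmul2r // => /dvdnP[k ->].
    by exists k; rewrite -expgM mulnC.
  rewrite !groupX ?cycle_id //; split=> //.
  by rewrite -!expgM [(k * n)%N]mulnC mulnA divnK // expgM expg_order expg1n.
by rewrite -orderE orderXdiv ?dvdn_div // divnA // mulKn ?order_gt0.
Qed.

(** There are n^4 elements killed by n = 2 or 4. The 16 killed by 2 generate distinct subgroups, and
    the other 256 - 16 = 240 fall into pairs u, u^-1 generating the same one. *)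
Lemma card_cycles_torsion4 (gT : finGroupType) (A : {group gT}) (a b c d : gT) :
    <[a]> \x <[b]> \x <[c]> \x <[d]> = A ->
    [/\ 4 %| #[a], 4 %| #[b], 4 %| #[c] & 4 %| #[d]] ->
  #|(fun u : gT => <[u]>%G) @: (A :&: [set u | u ^+ 4 == 1])| = 136.
Proof.
move=> defA [oa ob oc od]; pose cyc (u : gT) := <[u]>%G.
have tor n : n %| 4 -> #|torsion n A| = (n ^ 4)%N.
  move=> n4; have [[B _ defB _] _ _ _] := dprodP defA; rewrite defB in defA.
  have [[C _ defC _] _ _ _] := dprodP defB; rewrite defC in defB.
  rewrite (card_torsion_dprod n defA) (card_torsion_dprod n defB) (card_torsion_dprod n defC).
  by rewrite !card_torsion_cycle ?(dvdn_trans n4) // !expnS expn0 muln1 !mulnA.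
have -> : A :&: [set u | u ^+ 4 == 1] = torsion 4 A by apply/setP=> u; rewrite !inE.
pose B2 := [set u : gT | u ^+ 2 == 1].
have eq_order (u v : gT) : cyc u = cyc v -> #[u] = #[v].
  by move/(congr1 val) => /= E; rewrite !orderE E.
rewrite (card_imsetID (B := B2)) => [|u v _ _ /eq_order E]; last by rewrite !inE -!order_dvdn E.
have T2 : torsion 4 A :&: B2 = torsion 2 A.
  apply/setP=> u; rewrite !inE -andbA; congr (_ && _); rewrite andbC; case: eqP => // u2.
  by rewrite (expgM u 2 2) u2 expg1n eqxx.
rewrite T2; have -> : #|cyc @: torsion 2 A| = 16.
  rewrite card_in_imset ?tor // => u v; rewrite !inE => /andP[_ u2] /andP[_ v2] E.
  have /cycleP[i Du] : u \in <[v]> by rewrite -[<[v]>](congr1 val E) cycle_id.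
  have o := eq_order _ _ E; rewrite Du; move: Du.
  rewrite -(odd_double_half i) expgD -muln2 mulnC expgM (eqP v2) expg1n mulg1.
  case: (odd i) => // u1; move: o; rewrite u1 order1 => /esym/eqP.
  by rewrite order_eq1 => /eqP->.
have oS : #|torsion 4 A :\: B2| = 240.
  have := cardsID B2 (torsion 4 A); rewrite T2 !tor //.
  by move/(congr1 (subn^~ (2 ^ 4)%N)); rewrite addKn.
have := oS; rewrite -sum1_card (partition_big_imset cyc) /=.
rewrite (eq_bigr (fun _ => 2)) => [|C /imsetP[u Tu ->]].
  by rewrite sum_nat_const => E; apply/eqP; rewrite -(eqn_pmul2r (isT : 0 < 2)) mulnDl E.
rewrite sum1dep_card; have c2 : #|[set u; u^-1]| = 2.
  rewrite cards2; case: eqP => // E; move: Tu; rewrite !inE => /andP[/negP[]].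
  by rewrite expgS expg1 {2}E mulgV.
rewrite -[RHS]c2; apply: eq_card => v; rewrite !inE.
move: Tu; rewrite !inE => /andP[nu2 /andP[Au u4]].
apply/idP/idP=> [/andP[/andP[_ /andP[Av v4]] /eqP E]|].
  have /cycleP[i Dv] : v \in <[u]> by rewrite -[<[u]>](congr1 val E) cycle_id.
  have odd_i : odd i.
    apply: contraR nu2 => even_i; rewrite -order_dvdn -(eq_order _ _ E) order_dvdn Dv.
    by rewrite -expgM -(odd_double_half i) (negPf even_i) add0n -mul2n mulnAC expgM (eqP u4) expg1n.
  rewrite Dv -(odd_double_half i) odd_i -(odd_double_half i./2) doubleD.
  have -> : (i./2./2.*2.*2 = 4 * i./2./2)%N by rewrite -!mul2n mulnA.
  rewrite addnA expgD [u ^+ (4 * _)]expgM (eqP u4) expg1n mulg1.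
  case: (odd i./2) => /=; last by rewrite expg1 eqxx.
  by apply/orP; right; rewrite eq_sym eq_invg_mul -expgS.
case/orP=> /eqP->; first by rewrite nu2 Au u4 eqxx.
by rewrite groupV Au !expgVn !invg_eq1 nu2 u4 /= /cyc; apply/eqP/val_inj; rewrite /= cycleV.
Qed.

End Torsion.

(** * Galois orbits of pairings *)

Section PairingCharacters.

Local Open Scope ring_scope.

Variables (F : fieldType) (E : splittingFieldType F) (e : nat) (zeta : E).
Hypothesis prim_zeta : e.-primitive_root zeta.
Variables (gT aT : finGroupType) (H : {group gT}) (A : {group aT}).
Variables (pi : gT -> aT) (chi : aT -> aT -> E).
Hypothesis abA : abelian A.
Hypothesis chiP : self_pairing e A chi.
Hypothesis piM : {in H &, {morph pi : g h / (g * h)%g}}.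
Hypothesis pi_im : pi @: H = A.

Let piA h : h \in H -> pi h \in A.
Proof. by move=> Hh; rewrite -pi_im imset_f. Qed.

Local Notation chiH := (fun b h => chi b (pi h)).

Lemma gal_prim_root (u : gal_of {:E}) : exists2 r, coprime r e & u zeta = zeta ^+ r.
Proof. by have [r co Du] := aut_prim_rootP u prim_zeta; exists r. Qed.

Lemma gal_pairing (u : gal_of {:E}) r a b : u zeta = zeta ^+ r ->
  a \in A -> b \in A -> u (chi a b) = chi (a ^+ r)%g b.
Proof.
move=> uz Aa Ab; have [_ _ ex _] := chiP.
rewrite (pairingXl prim_zeta chiP) //.
have [k ->] := prim_rootP prim_zeta (ex a b Aa Ab).
by rewrite rmorphXn /= uz exprAC.
Qed.

Lemma pairing_galois_characters (S : {set aT}) :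
    S \subset A -> (forall b r, b \in S -> coprime r e -> (b ^+ r)%g \in S) ->
  galois_characters H S chiH.
Proof.
move=> /subsetP sSA SX; have [m sym ex _] := chiP; split.
- move=> b /sSA Ab; rewrite -(pairing1r prim_zeta chiP Ab); congr (chi b _).
  by apply: (mulgI (pi 1%g)); rewrite -piM ?group1 // !mulg1.
- move=> b /sSA Ab g h Hg Hh; rewrite piM //.
  by rewrite (pairingMr chiP) ?piA.
- move=> b c /sSA Ab /sSA Ac E'; apply: (pairing_inj prim_zeta chiP) => // a.
  by rewrite -pi_im => /imsetP[h Hh ->]; apply: E'.
move=> u b Gu Sb; have [r co uz] := gal_prim_root u.
exists (b ^+ r)%g; first exact: SX.
by move=> h Hh; rewrite (gal_pairing uz) ?piA ?sSA.
Qed.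

Lemma gal_conj_pairingP b c : b \in A -> c \in A ->
  gal_conj H chiH b c <-> exists2 u : gal_of {:E}, u \in 'Gal({:E} / 1)%g &
    exists2 r, u zeta = zeta ^+ r & c = (b ^+ r)%g.
Proof.
move=> Ab Ac; split=> [/gal_conjP[u Gu uE] | [u Gu [r uz ->]]].
  exists u => //; have [r _ uz] := gal_prim_root u; exists r => //.
  apply: (pairing_inj prim_zeta chiP) => //; first exact: groupX.
  move=> a; rewrite -pi_im => /imsetP[h Hh ->].
  by rewrite -uE // (gal_pairing uz) ?piA.
apply/gal_conjP; exists u => // h Hh.
by rewrite (gal_pairing uz) ?piA.
Qed.

(** [I] is any type of the right size, so the ordinals of the final statement can index the
    components directly. *)
Lemma orbit_reps_of (S : {set aT}) (X I : finType) (f : aT -> X) :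
    (forall b c, b \in S -> c \in S -> gal_conj H chiH b c <-> f b = f c) ->
    #|I| = #|f @: S| ->
  exists rep : I -> aT, orbit_reps H S chiH rep.
Proof.
move=> fP oI; pose v (i : I) := enum_val (cast_ord oI (enum_rank i)).
have /fin_all_exists2[rep Srep frep] (i : I) : exists2 b, b \in S & f b = v i.
  by have /imsetP[b Sb ->] : v i \in f @: S := enum_valP _; exists b.
exists rep; split=> // [b Sb | i j b Sb].
  have Sfb : f b \in f @: S by apply: imset_f.
  exists (enum_val (cast_ord (esym oI) (enum_rank_in Sfb (f b)))).
  by apply/fP => //; rewrite frep /v enum_valK cast_ordKV enum_rankK_in.
move=> /(fP _ _ (Srep i) Sb) vi /(fP _ _ (Srep j) Sb) vj.
have : v i = v j by rewrite -!frep vi vj.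
by move/enum_val_inj/cast_ord_inj/enum_rank_inj.
Qed.

End PairingCharacters.

Section CenterPairing.

Local Open Scope group_scope.

(** f v lies in <[f u]> exactly when some v u^-k lies in the kernel, a condition that is the same
    for [g]. *)
Lemma same_kernel_cycle (gT aT bT : finGroupType) (A : {group gT})
    (f : gT -> aT) (g : gT -> bT) :
    {in A &, {morph f : u v / u * v}} -> {in A &, {morph g : u v / u * v}} ->
    {in A, forall u, f u = 1 <-> g u = 1} ->
  {in A &, forall u v, <[f u]>%G = <[f v]>%G <-> <[g u]>%G = <[g v]>%G}.
Proof.
move=> fM gM ker u v Au Av.
have half (aT' bT' : finGroupType) (f' : gT -> aT') (g' : gT -> bT') :
    {in A &, {morph f' : u v / u * v}} -> {in A &, {morph g' : u v / u * v}} ->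
    {in A, forall u, f' u = 1 -> g' u = 1} ->
    forall a b, a \in A -> b \in A -> f' b \in <[f' a]> -> g' b \in <[g' a]>.
  move=> fM' gM' ker' a b Aa Ab /cycleP[k fk].
  have f1 : f' 1 = 1 by apply: (mulgI (f' 1)); rewrite -fM' ?group1 // !mulg1.
  have g1 : g' 1 = 1 by apply: (mulgI (g' 1)); rewrite -gM' ?group1 // !mulg1.
  have fX i : f' (a ^+ i) = f' a ^+ i.
    by elim: i => [|i IHi]; rewrite ?f1 // !expgS fM' ?groupX // IHi.
  have gX i : g' (a ^+ i) = g' a ^+ i.
    by elim: i => [|i IHi]; rewrite ?g1 // !expgS gM' ?groupX // IHi.
  have fV c : c \in A -> f' c^-1 = (f' c)^-1.
    by move=> Ac; apply: (mulgI (f' c)); rewrite -fM' ?groupV // !mulgV.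
  have gV c : c \in A -> g' c^-1 = (g' c)^-1.
    by move=> Ac; apply: (mulgI (g' c)); rewrite -gM' ?groupV // !mulgV.
  have := ker' (b * (a ^+ k)^-1); rewrite fM' ?gM' ?groupV ?groupX // fV ?gV ?groupX //.
  rewrite fX gX fk mulgV groupM ?groupV ?groupX // => /(_ isT erefl)/eqP.
  by rewrite -eq_mulgV1 => /eqP->; apply: mem_cycle.
have eqc (cT : finGroupType) (c d : cT) : <[c]>%G = <[d]>%G <-> d \in <[c]> /\ c \in <[d]>.
  split=> [/(congr1 val)/= E|[dc cd]]; first by rewrite -{1}E {1}E !cycle_id.
  by apply/val_inj/eqP; rewrite /= eqEsubset !cycle_subG dc cd.
have ker1 : {in A, forall u, f u = 1 -> g u = 1} by move=> c /ker[].
have ker2 : {in A, forall u, g u = 1 -> f u = 1} by move=> c /ker[].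
rewrite !eqc; split=> -[h1 h2].
  by split; [exact: (half _ _ f g) h1 | exact: (half _ _ f g) h2].
by split; [exact: (half _ _ g f) h1 | exact: (half _ _ g f) h2].
Qed.

Variables (E : fieldType) (e : nat) (zeta : E).
Hypothesis prim_zeta : e.-primitive_root%R zeta.
Variables (gT : finGroupType) (m1 m2 m3 m4 : nat) (G : {group gT}).
Variables (t1 t2 t3 t4 x y s : gT).
Hypothesis m1_ge3 : 3 <= m1.
Hypothesis D5 : D5_structure m1 m2 m3 m4 G t1 t2 t3 t4 x y s.
Hypothesis expGe : exponent G %| e.

Local Notation Z := 'Z(G).
Local Notation cs := (coset G^`(1)).

(** An explicit form of the duality between Z(G)/<s> and the characters trivial on s. As s is a
    power of t1, which is orthogonal to the complement, chi(z, s) is the parity sign of the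
    t1-exponent of z. *)
Lemma center_pairing : exists (chi : gT -> gT -> E) (phi : gT -> gT),
  [/\ self_pairing e Z chi,
      {in Z &, {morph phi : u v / u * v}},
      {in Z, forall z, phi z = 1 <-> z \in <[s]>},
      {in Z, forall z, phi z \in Z} /\
      {in Z, forall b, (chi b s == 1%R) = (b \in phi @: Z)}
    & {in Z, forall b, (chi b s == 1%R) || (chi b s == -1)%R}].
Proof.
have [dZ ordZ _ _ defs [Zs ss s1] _ _ _ _ _ _] := D5.
have [o1 o2 o3 o4] := ordZ.
have oe u : u \in 'Z(G) -> #[u] %| e.
  by case/centerP=> Gu _; apply: dvdn_trans (dvdn_exponent Gu) expGe.
have [[B3 _ dB3 _] _ _ _] := dprodP dZ; have := dZ; rewrite dB3 => dZ3.
have [_ dZ3' _ _] := dprodP dZ3; rewrite -dB3 in dZ3.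
have [[B2 _ dB2 _] d3 _ _] := dprodP dB3; have := d3; rewrite dB2 => d3'.
have [_ d2 _ _] := dprodP dB2.
have sB3 : B3 \subset Z by rewrite -dZ3' mulG_subl.
have sB2 : B2 \subset Z by apply: subset_trans sB3; rewrite -d3' mulG_subl.
have Z1 : t1 \in Z by apply: (subsetP sB2); rewrite -d2 -[X in X \in _]mulg1 mem_mulg ?cycle_id.
have Z2 : t2 \in Z by apply: (subsetP sB2); rewrite -d2 -[X in X \in _]mul1g mem_mulg ?cycle_id.
have Z3 : t3 \in Z by apply: (subsetP sB3); rewrite -d3' -[X in X \in _]mul1g mem_mulg ?cycle_id.
have Z4 : t4 \in Z by rewrite -dZ3' -[X in X \in _]mul1g mem_mulg ?cycle_id.
have [B [chi [dB P orth]]] := pairing_dprod4 prim_zeta dZ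
  (And4 (oe _ Z1) (oe _ Z2) (oe _ Z3) (oe _ Z4)).
have [p1 [p2 [p12 p1M p2M pt pB]]] := dprod_proj dB.
have [m sym ex nondeg] := P.
have sBZ : B \subset Z by have [_ <- _ _] := dprodP dB; rewrite mulG_subr.
have abZ := center_abelian G.
have chiX := pairingXl prim_zeta P.
pose c1 := chi t1 s.
have c1E z : z \in Z -> exists2 i, p1 z = t1 ^+ i & chi z s = (c1 ^+ i)%R.
  move=> Zz; have [/cycleP[i Di] Bz Dz] := p12 z Zz; exists i => //.
  have Zp2 := subsetP sBZ _ Bz.
  rewrite {1}Dz m ?Di ?groupX // chiX // [chi (p2 z) s](_ : _ = 1%R) ?mulr1 //.
  by rewrite sym // defs chiX // orth // expr1n.
(* [c1] squares to 1 as s does, and [c1 = 1] would put s in the kernel of a nondegenerate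
   pairing. *)
have c1_2 : (c1 ^+ 2 = 1)%R.
  rewrite expr2 /c1 sym // -m // ss; exact: (pairing1l prim_zeta P).
have c1_neq1 : c1 != 1%R.
  apply: contra s1 => /eqP c11; apply/eqP/nondeg => // z Zz.
  by have [i _ ci] := c1E z Zz; rewrite sym // ci c11 expr1n.
have c1N : c1 = (-1)%R.
  by move/eqP: c1_2; rewrite sqrf_eq1 (negPf c1_neq1) => /eqP.
have chis z i : chi z s = (c1 ^+ i)%R -> (chi z s == 1%R) = ~~ odd i.
  move=> ->; rewrite -[i in LHS]odd_double_half exprD -mul2n exprM c1_2 expr1n mulr1.
  by case: (odd i); rewrite ?expr1 ?(negPf c1_neq1) ?eqxx.
(* Squaring the t1-component has kernel <s> and image the elements of even t1-exponent, that is,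
   those with chi(b, s) = 1. *)
exists chi, (fun z => p1 z ^+ 2 * p2 z).
have m1_gt0 : 0 < m1 by apply: leq_trans m1_ge3.
split=> //.
- move=> u v Zu Zv /=; rewrite p1M // p2M //.
  have [tu Bu _] := p12 u Zu; have [tv Bv _] := p12 v Zv.
  have st : <[t1]> \subset Z by rewrite cycle_subG.
  have cZ a b : a \in Z -> b \in Z -> commute a b by move=> Za Zb; apply: (centsP abZ).
  have Za := subsetP st _ tu; have Zb := subsetP st _ tv.
  have Zc := subsetP sBZ _ Bu; have Zd := subsetP sBZ _ Bv.
  rewrite expgMn; last exact: cZ.
  move: (p1 u ^+ 2) (p1 v ^+ 2) (groupX 2 Zb) => a b {}Zb.
  by rewrite -!mulgA; congr (_ * _); rewrite !mulgA (cZ b _ Zb Zc).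
- move=> z Zz /=; have [tz Bz Dz] := p12 z Zz; split=> [E1|].
    have z2 : p2 z = 1.
      have [_ _ _ ti] := dprodP dB; apply/set1gP; rewrite -ti inE Bz andbT.
      rewrite -[p2 z]invgK groupV (_ : (p2 z)^-1 = p1 z ^+ 2) ?groupX //.
      by apply: mulIg (p2 z) _ _ _; rewrite mulVg.
    rewrite Dz z2 mulg1; move: E1; rewrite z2 mulg1; case/cycleP: tz => i ->.
    rewrite -expgM => /eqP; rewrite -order_dvdn o1 -(prednK m1_gt0) expnSr dvdn_pmul2r //.
    by case/dvdnP=> k ->; rewrite defs mulnC expgM mem_cycle.
  case/cycleP=> k Dk; have tz' : z \in <[t1]> by rewrite Dk defs -expgM mem_cycle.
  have [-> ->] := pt z tz'; rewrite mulg1 Dk expgAC expgS expg1 ss expg1n //.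
- split=> [z Zz /= | b Zb /=].
    have [tz Bz _] := p12 z Zz; rewrite groupM ?groupX ?(subsetP sBZ _ Bz) //.
    by apply: subsetP tz; rewrite cycle_subG.
  have [i Di ci] := c1E b Zb; rewrite (chis _ _ ci).
  have [tb Bb Db] := p12 b Zb; apply/idP/imsetP=> [even_i | [z Zz Ez]].
    exists (t1 ^+ i./2 * p2 b).
      by rewrite groupM ?groupX // (subsetP sBZ).
    have Zp := subsetP sBZ _ Bb; have Zt := groupX i./2 Z1.
    rewrite p1M // p2M //; have [-> ->] := pt _ (mem_cycle t1 i./2); have [-> ->] := pB _ Bb.
    rewrite mulg1 mul1g -expgM muln2 {1}Db Di; congr (t1 ^+ _ * _).
    by rewrite -[LHS]odd_double_half (negPf even_i).
  have [j Dj cj] := c1E z Zz; have [tz Bz _] := p12 z Zz.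
  rewrite -(chis _ _ ci) Ez m ?groupX ?(subsetP sBZ _ Bz) //; last by rewrite Dj groupX.
  rewrite Dj -expgM chiX // mulnC exprM c1_2 expr1n mul1r sym ?(subsetP sBZ _ Bz) //.
  by rewrite defs chiX ?(subsetP sBZ _ Bz) // orth // expr1n.
move=> b Zb; have [i _ ->] := c1E b Zb; rewrite c1N.
by rewrite -signr_odd; case: (odd i); rewrite ?expr1 ?eqxx ?orbT.
Qed.

End CenterPairing.

(** * Rational classes and cyclic subgroups *)

Section CyclicCounts.

Local Open Scope group_scope.

Variables (gT : finGroupType) (m1 m2 m3 m4 : nat) (G : {group gT}).
Variables (t1 t2 t3 t4 x y s : gT).
Hypothesis D5 : D5_structure m1 m2 m3 m4 G t1 t2 t3 t4 x y s.

Local Notation Z := 'Z(G).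
Local Notation cs := (coset G^`(1)).
Local Notation cyc := (fun g : gT => <[cs g]>%G).

Lemma D5_pgroup : 2.-group G.
Proof. by rewrite /pgroup (D5_card D5) pnatX. Qed.

Let Zs : s \in Z. Proof. by case: (D5_s D5). Qed.
Let ss : s * s = 1. Proof. by case: (D5_s D5). Qed.
Let s1 : s != 1. Proof. by case: (D5_s D5). Qed.
Let os : #[s] = 2. Proof. exact: nt_prime_order. Qed.
Let Gs : s \in G. Proof. exact: subsetP (center_sub G) s Zs. Qed.
Let ZG z : z \in Z -> z \in G. Proof. exact: subsetP (center_sub G) z. Qed.
Let Zcomm z g : z \in Z -> g \in G -> z * g = g * z.
Proof. by case/centerP=> _ c /c. Qed.

Let nG' : G \subset 'N(G^`(1)). Proof. exact: gFnorm. Qed.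

Let csM : {in G &, {morph cs : g h / g * h}}.
Proof. by move=> g h Gg Gh; rewrite morphM ?(subsetP nG'). Qed.

Let csX g i : g \in G -> cs (g ^+ i) = cs g ^+ i.
Proof. by move=> Gg; rewrite morphX ?(subsetP nG'). Qed.

Let mem_G' g : (g \in G^`(1)) = (g == 1) || (g == s).
Proof.
rewrite (D5_der D5); apply/cycleP/orP=> [[i ->] | [/eqP->|/eqP->]].
- rewrite -(odd_double_half i) expgD -mul2n expgM [s ^+ 2]ss expg1n mulg1.
  by case: (odd i); [right; rewrite expg1 | left].
- by exists 0.
by exists 1%N.
Qed.

Let cs_eq g h : g \in G -> h \in G -> cs g = cs h <-> h = g \/ h = s * g.
Proof.
move=> Gg Gh; have Ng := subsetP nG' g Gg; have Nh := subsetP nG' h Gh.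
split=> [/(rcoset_kercosetP Ng Nh) | [->|->] //]; last first.
  by rewrite csM // (coset_id (_ : s \in G^`(1))) ?mul1g // mem_G' eqxx orbT.
rewrite mem_rcoset mem_G' => /orP[] /eqP E.
  by left; rewrite -(mulgKV h g) E mul1g.
have Dg : g = s * h by rewrite -E mulgKV.
by right; rewrite Dg mulgA ss mul1g.
Qed.

Let cls g : {set gT} := [set g; s * g].

Lemma D5_class g : g \in G -> g \notin Z -> g ^: G = cls g.
Proof.
move=> Gg nZg; have conjs h : h \in G -> g ^ h = g \/ g ^ h = s * g.
  move=> Gh; have : [~ g, h] \in G^`(1) by apply: mem_commg.
  rewrite mem_G' => /orP[]/eqP E; [left | right].
    by rewrite conjg_mulR E mulg1.
  by rewrite conjg_mulR E (Zcomm Zs Gg).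
apply/setP=> u; rewrite !inE; apply/imsetP/orP=> [[h Gh ->] | [/eqP-> | /eqP->]].
- by case: (conjs h Gh) => ->; [left | right].
- by exists 1; rewrite ?group1 ?conjg1.
have [h Gh ngh] : exists2 h, h \in G & g ^ h != g.
  apply/exists_inP; apply: contraR nZg; rewrite negb_exists_in => /forall_inP h1.
  apply/centerP; split=> // h Gh; have := h1 h Gh; rewrite negbK => /eqP E.
  by rewrite /commute [LHS]conjgC E.
by exists h => //; case: (conjs h Gh) ngh => ->; rewrite ?eqxx.
Qed.

Let odd_exps g r : odd r -> g \in G -> (s * g) ^+ r = s * g ^+ r.
Proof.
move=> odd_r Gg; rewrite expgMn; last exact: Zcomm.
congr (_ * _); rewrite -(odd_double_half r) odd_r expgS -mul2n expgM.
by rewrite [s ^+ 2]ss expg1n mulg1.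
Qed.

Lemma D5_cyc_odd g h : g \in G -> h \in G ->
  cyc g = cyc h <-> exists2 r, odd r & h = g ^+ r \/ h = s * g ^+ r.
Proof.
move=> Gg Gh; have p2 : 2.-elt (cs g).
  by apply: mem_p_elt (quotient_pgroup _ D5_pgroup) _; apply: mem_quotient.
split=> [/(congr1 val)/= /(odd_generator _ p2)[r odd_r E] | [r odd_r E]].
  by exists r => //; apply/cs_eq; rewrite ?groupX // E csX.
apply/val_inj/(odd_generator _ p2); exists r => //.
by rewrite -csX //; apply/esym/cs_eq; rewrite ?groupX.
Qed.

Let sqZ g : g \in G -> g ^+ 2 \in Z.
Proof.
have [Gx Gy] := D5_mem D5; have [Zxx Zyy] := D5_squares D5.
case/(D5_cosets D5)=> z Zz Dg.
have sq w : w \in G -> w * w \in Z -> (z * w) ^+ 2 \in Z.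
  move=> Gw Zww; rewrite expgMn; last exact: Zcomm.
  by apply: groupM; [apply: groupX | apply: Zww].
case: Dg => ->; [exact: groupX | exact: sq | exact: sq |].
apply: sq; first exact: groupM.
have -> : x * y * (x * y) = s * (x * x) * (y * y).
  by rewrite -mulgA (mulgA y) (D5_yx D5) -(mulgA s) (mulgA x s) -(Zcomm Zs) // !mulgA.
by rewrite groupM // groupM.
Qed.

(** Squares are central, so odd powers do not leave a coset of Z(G). *)
Let odd_exp_coset g w r : odd r -> g \in Z :* w -> w \in G -> g ^+ r \in Z :* w.
Proof.
move=> odd_r gZw Gw; have Gg : g \in G.
  by case/rcosetP: gZw => z Zz ->; rewrite groupM // ZG.
rewrite -(odd_double_half r) odd_r expgS -mul2n expgM.
set Y := _ ^+ r./2; have ZY : Y \in Z by rewrite groupX ?sqZ.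
by rewrite mem_rcoset -(Zcomm ZY Gg) -mulgA groupM // -mem_rcoset.
Qed.

Let coset_split w : w \in G -> w \notin Z -> forall g, g \in Z :* w -> g \in G /\ g \notin Z.
Proof.
move=> Gw nZw g /rcosetP[z Zz ->]; split; first by apply: groupM => //; apply: ZG.
by rewrite groupMl.
Qed.

Section RationalClasses.

Variables (L : splittingFieldType rat) (zeta : L).
Hypothesis prim_zeta : (exponent G).-primitive_root%R zeta.

Lemma D5_coprime_exponent r : coprime r (exponent G) = odd r.
Proof.
have e2 : 2 %| exponent G.
  by rewrite -os dvdn_exponent.
have e2n : 2.-nat (exponent G) by rewrite pnat_exponent; apply: D5_pgroup.
apply/idP/idP=> [co | odd_r].
  by rewrite -coprime2n coprime_sym; apply: coprime_dvdr e2 co.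
by rewrite coprime_sym; apply: pnat_coprime e2n _; rewrite p'natE // dvdn2 odd_r.
Qed.

(** Over Q every odd exponent comes from a Galois automorphism. It is reduced modulo the exponent of
    G to fit the ordinal in [Kclass]. *)
Lemma mem_D5_Kclass g D : g \in G -> g \notin Z ->
  D \in Kclass zeta G (g ^: G) <-> exists2 r, odd r & D = cls (g ^+ r).
Proof.
move=> Gg nZg; rewrite D5_class //.
have im r : odd r -> [set h ^+ r | h in cls g] = cls (g ^+ r).
  by move=> odd_r; rewrite /cls imsetU1 imset_set1 odd_exps.
rewrite inE; split=> [/exists_inP[u Gu /existsP[r /andP[/eqP uz /eqP->]]] | [r odd_r ->]].
  have odd_r : odd r.
    rewrite -D5_coprime_exponent -(prim_root_exp_coprime r prim_zeta) -uz.
    by rewrite fmorph_primitive_root.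
  by exists r; rewrite ?im.
have e_gt0 := exponent_gt0 G.
have co : coprime (r %% exponent G) (exponent G) by rewrite coprime_modl D5_coprime_exponent.
have odd_r' : odd (r %% exponent G) by rewrite -D5_coprime_exponent.
have [u Gu uz] := rat_cyclotomic_gal prim_zeta co.
apply/exists_inP; exists u => //; apply/existsP; exists (Ordinal (ltn_pmod r e_gt0)).
rewrite /= uz eqxx im //=; apply/eqP; congr (cls _); apply/eqP.
rewrite eq_expg_mod_order; apply/eqP.
by rewrite (modn_dvdm r (dvdn_exponent Gg)).
Qed.

(** A noncentral class {g, sg} is a coset of G', and the odd powers making up its Q-class are the
    generators of one cyclic subgroup of G/G'. *)
Lemma card_Kclasses_involving w : w \in G -> w \notin Z ->
  #|Kclasses_involving zeta G s w| = #|cyc @: (Z :* w)|.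
Proof.
move=> Gw nZw; have sp := coset_split Gw nZw.
have clsP g : g \in Z :* w -> cls g \in [set [set a * w; s * a * w] | a in Z].
  case/rcosetP=> z Zz ->; apply/imsetP; exists z => //.
  by rewrite /cls mulgA.
have refl g : g \in G -> g \notin Z -> g ^: G \in Kclass zeta G (g ^: G).
  by move=> Gg nZg; apply/mem_D5_Kclass => //; exists 1%N; rewrite // expg1 D5_class.
have -> : Kclasses_involving zeta G s w = (fun g => Kclass zeta G (g ^: G)) @: (Z :* w).
  apply/setP=> Q; rewrite inE; apply/andP/imsetP=> [[/imsetP[C /imsetP[g Gg ->] ->] sub]|].
    (* A central [g] would give the singleton class {g} = {aw, saw}, hence a central w. *)
    have nZg : g \notin Z.
      apply/negP => Zg.
      have e1 : 1 < exponent G.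
        by rewrite -os (dvdn_leq (exponent_gt0 G)) // dvdn_exponent.
      have inK : [set g] \in Kclass zeta G (g ^: G).
        rewrite inE; apply/exists_inP; exists 1; rewrite ?group1 //.
        apply/existsP; exists (Ordinal e1); rewrite gal_id expr1 eqxx /=.
        have -> : g ^: G = [set g].
          apply/setP=> h; rewrite inE; apply/imsetP/eqP=> [[k Gk ->]|->].
            by rewrite conjgE (Zcomm Zg Gk) mulKg.
          by exists 1; rewrite ?group1 ?conjg1.
        by rewrite imset_set1 expg1.
      have /imsetP[a Za /setP/(_ (a * w))] := subsetP sub _ inK.
      rewrite !inE eqxx => /eqP aw; case/negP: nZw.
      by rewrite -(mulKg a w) aw groupM ?groupV.
    exists g => //; have /imsetP[a Za] := subsetP sub _ (refl g Gg nZg).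
    rewrite D5_class // => /setP/(_ g); rewrite !inE eqxx /= => /esym/orP[] /eqP->.
      by rewrite mem_rcoset mulgK.
    by rewrite mem_rcoset mulgK groupM.
  case=> g Zwg ->; have [Gg nZg] := sp g Zwg; split.
    by apply: imset_f; apply: mem_classes.
  apply/subsetP=> D /(mem_D5_Kclass _ Gg nZg)[r odd_r ->].
  by apply: clsP; apply: odd_exp_coset.
apply: eq_card_imset => g h Zg Zh; have [Gg nZg] := sp g Zg; have [Gh nZh] := sp h Zh.
have sub a b : a \in Z :* w -> b \in Z :* w -> cyc a = cyc b ->
    Kclass zeta G (b ^: G) \subset Kclass zeta G (a ^: G).
  move=> Za Zb; have [Ga nZa] := sp a Za; have [Gb nZb] := sp b Zb.
  case/(D5_cyc_odd Ga Gb)=> r odd_r Eb.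
  apply/subsetP=> D /(mem_D5_Kclass _ Gb nZb)[k odd_k ->]; apply/mem_D5_Kclass => //.
  exists (r * k)%N; first by rewrite oddM odd_r.
  rewrite expgM; case: Eb => ->; rewrite // odd_exps ?groupX //.
  by rewrite /cls mulgA ss mul1g setUC.
split=> [E|E]; last by apply/eqP; rewrite eqEsubset !sub.
have := refl h Gh nZh; rewrite -E => /(mem_D5_Kclass _ Gg nZg)[r odd_r].
rewrite D5_class // => /setP/(_ h); rewrite !inE eqxx /= => /esym Eh.
by apply/D5_cyc_odd => //; exists r => //; case/orP: Eh => /eqP; [left | right].
Qed.

End RationalClasses.

Lemma D5_noncentral : [/\ x \notin Z, y \notin Z & x * y \notin Z].
Proof.
have [Gx Gy] := D5_mem D5.
have nxy : x * y != y * x.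
  rewrite (D5_yx D5); apply: contra s1 => /eqP E; apply/eqP.
  by apply: (mulIg (x * y)); rewrite -E mul1g.
split; apply: contra nxy => Zw; first by rewrite (Zcomm Zw Gy).
  by rewrite (Zcomm Zw Gx).
have /eqP := Zcomm Zw Gx; rewrite -mulgA (inj_eq (mulgI x)) => /eqP ->.
by [].
Qed.

Lemma D5_cyc_coset w g h : w \in G -> g \in G -> h \in G -> cyc g = cyc h ->
  (g \in Z :* w) = (h \in Z :* w).
Proof.
move=> Gw Gg Gh E.
have half a b : a \in G -> b \in G -> cyc a = cyc b -> a \in Z :* w -> b \in Z :* w.
  move=> Ga Gb /(D5_cyc_odd Ga Gb)[r odd_r Eb] Za; have := odd_exp_coset odd_r Za Gw.
  by case: Eb => -> // ; rewrite !mem_rcoset => Zg; rewrite -mulgA groupMl.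
by apply/idP/idP; apply: half.
Qed.

(** Generators of one cyclic subgroup of G/G' lift to elements of a single coset of Z(G), so the
    four cosets contribute disjoint families. *)
Lemma card_cyclic_quotient : #|cyclic_subgroups (G / G^`(1))| =
  (#|cyc @: Z| + #|cyc @: (Z :* x)| + #|cyc @: (Z :* y)| + #|cyc @: (Z :* (x * y))|)%N.
Proof.
have [Gx Gy] := D5_mem D5; have [nZx nZy nZxy] := D5_noncentral.
have -> : cyclic_subgroups (G / G^`(1)) = cyc @: G.
  apply/setP=> C; rewrite inE; apply/andP/imsetP=> [[sC /cyclicP[u Cu]]|[g Gg ->]].
    have /morphimP[g _ Gg Du] : u \in G / G^`(1) by apply: (subsetP sC); rewrite Cu cycle_id.
    by exists g => //; apply: val_inj; rewrite /= Cu Du.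
  by rewrite /= cycle_subG mem_quotient // cycle_cyclic.
have memw z w w' : z \in Z -> (z * w \in Z :* w') = (w \in Z :* w').
  by move=> Zz; rewrite !mem_rcoset -mulgA groupMl.
have sZG w : w \in G -> Z :* w \subset G.
  by move=> Gw; apply/subsetP=> _ /rcosetP[z Zz ->]; apply: groupM => //; apply: ZG.
have inv w : w \in G -> {in G &, forall g h, cyc g = cyc h -> (g \in Z :* w) = (h \in Z :* w)}.
  by move=> Gw g h Gg Gh; apply: D5_cyc_coset.
have xZy : (x \in Z :* y) = false.
  apply/negP; rewrite mem_rcoset => Zxy; case/negP: nZxy.
  by rewrite -(mulgKV y x) -mulgA groupM // (D5_squares D5).2.
have xyZx : (x * y \in Z :* x) = false.
  apply/negP => /rcosetP[z Zz]; rewrite (Zcomm Zz Gx) => /mulgI E.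
  by case/negP: nZy; rewrite E.
have xyZy : (x * y \in Z :* y) = false.
  by apply/negP => /rcosetP[z Zz] /mulIg E; case/negP: nZx; rewrite E.
have nZw w z : w \notin Z -> z \in Z -> (z * w \in Z) = false.
  by move=> nw Zz; rewrite groupMl // (negPf nw).
rewrite (card_imsetID (S := G) (B := Z)); last first.
  by move=> g h Gg Gh E; have := inv 1 (group1 G) g h Gg Gh E; rewrite !rcoset1.
rewrite (setIidPr (center_sub G)) -!addnA; congr (_ + _)%N.
have sub B : {subset G :\: B <= G} by move=> g /setDP[].
rewrite (card_imsetID (S := G :\: Z) (B := Z :* x)); last first.
  by move=> g h /sub Gg /sub Gh; apply: inv.
have -> : (G :\: Z) :&: (Z :* x) = Z :* x.
  apply/setIidPr/subsetP=> g Zg; rewrite inE (subsetP (sZG x Gx)) // andbT.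
  by case/rcosetP: Zg => z Zz ->; rewrite nZw.
congr (_ + _)%N; rewrite (card_imsetID (S := (G :\: Z) :\: (Z :* x)) (B := Z :* y)); last first.
  by move=> g h /setDP[/sub Gg _] /setDP[/sub Gh _]; apply: inv.
have -> : ((G :\: Z) :\: (Z :* x)) :&: (Z :* y) = Z :* y.
  apply/setIidPr/subsetP=> g Zg; rewrite !in_setD (subsetP (sZG y Gy)) // andbT.
  case/rcosetP: Zg => z Zz ->; rewrite nZw // memw // andbT mem_rcoset.
  by apply: contraFN xZy => Zyx; rewrite mem_rcoset -groupV invMg invgK.
suff -> : ((G :\: Z) :\: (Z :* x)) :\: (Z :* y) = Z :* (x * y) by [].
apply/setP=> g; rewrite !in_setD; apply/idP/idP=> [/and4P[nZyg nZxg nZg Gg]|Zg].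
  have [z Zz] := D5_cosets D5 Gg; case=> Dg.
  - by rewrite Dg Zz in nZg.
  - by rewrite Dg memw // rcoset_refl in nZxg.
  - by rewrite Dg memw // rcoset_refl in nZyg.
  by rewrite Dg memw // rcoset_refl.
rewrite (subsetP (sZG _ (groupM Gx Gy))) // andbT.
by case/rcosetP: Zg => z Zz ->; rewrite !(memw z) // xyZx xyZy nZw.
Qed.

Section CenterCount.

Variables (E : fieldType) (e : nat) (zeta : E).
Hypothesis prim_zeta : e.-primitive_root%R zeta.
Hypothesis m1_ge3 : 3 <= m1.
Hypothesis expGe : exponent G %| e.

(** The map [phi] of [center_pairing] and the projection to G/G' have the same kernel <s> on Z(G),
    so [same_kernel_cycle] identifies the counts. *)
Lemma center_pairing_count : exists chi : gT -> gT -> E,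
  [/\ self_pairing e Z chi,
      {in Z, forall b, (chi b s == 1%R) || (chi b s == -1)%R}
    & #|(fun b : gT => <[b]>%G) @: [set b in Z | chi b s == 1%R]| = #|cyc @: Z|].
Proof.
have [chi [phi [P phiM phi1 [phiZ phi_im] chis]]] := center_pairing prim_zeta m1_ge3 D5 expGe.
exists chi; split=> //.
have sZ : phi @: Z \subset Z.
  apply/subsetP=> _ /imsetP[z Zz ->]; exact: phiZ.
have -> : [set b in Z | chi b s == 1%R] = phi @: Z.
  apply/setP=> b; rewrite inE; apply/andP/idP=> [[Zb]|Pb]; first by rewrite phi_im.
  by have Zb := subsetP sZ b Pb; rewrite phi_im.
rewrite -imset_comp; apply: eq_card_imset.
apply: same_kernel_cycle => // [u v Zu Zv|z Zz]; first by rewrite csM ?ZG.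
rewrite (phi1 z Zz) -(D5_der D5) /=; split=> [/coset_id // | cz1].
by rewrite coset_idr // (subsetP nG') ?ZG.
Qed.

End CenterCount.

End CyclicCounts.

(** * Decomposition of the group ring *)

Section PairingIdempotents.

Local Open Scope ring_scope.

Variables (F : fieldType) (E : splittingFieldType F) (e : nat) (zeta : E).
Hypothesis prim_zeta : e.-primitive_root zeta.
Variables (gT : finGroupType) (G : {group gT}).

Local Notation aE := (regular_repr E G).

(** Summing over all characters first leaves, by orthogonality, only the elements on which [pi] is
    trivial. *)
Lemma sum_pairing_idem (aT : finGroupType) (H : {group gT}) (A : {group aT})
    (pi : gT -> aT) (chi : aT -> aT -> E) :
    self_pairing e A chi -> {in H, forall h, pi h \in A} ->
  \sum_(b in A) chi_idem G H (fun b h => chi b (pi h)) b =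
    (#|H|%:R^-1 * #|A|%:R) *: \sum_(h in H | pi h^-1%g == 1%g) aE h.
Proof.
move=> chiP piA; rewrite /chi_idem -scaler_sumr exchange_big -scalerA /=; congr (_ *: _).
rewrite scaler_sumr big_mkcondr /=; apply: eq_bigr => h Hh.
rewrite -scaler_suml (sum_pairing prim_zeta chiP) ?piA ?groupV //.
by case: eqP; rewrite // scale0r.
Qed.

Variables (m1 m2 m3 m4 : nat) (t1 t2 t3 t4 x y s : gT).
Hypothesis D5 : D5_structure m1 m2 m3 m4 G t1 t2 t3 t4 x y s.
Hypothesis nzG : (#|G|%:R : F) != 0.
Hypothesis nz2 : (2%:R : F) != 0.

Local Notation Z := 'Z(G)%g.
Local Notation A := (G / G^`(1))%g.

(** The first sum is (1 + s)/2 and the second (1 - s)/2. *)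
Lemma sum_D5_idem (chiQ : coset_of G^`(1)%g -> coset_of G^`(1)%g -> E) (chi : gT -> gT -> E) :
    self_pairing e A chiQ -> self_pairing e Z chi ->
    {in Z, forall b, (chi b s == 1) || (chi b s == -1)} ->
  \sum_(b in A) chi_idem G G (fun b g => chiQ b (coset G^`(1)%g g)) b +
  \sum_(b in [set b in Z | chi b s == -1]) chi_idem G Z chi b = 1%:M.
Proof.
move=> chiQP chiP chis; have [Zs ss s1] := D5_s D5.
have nzE n : (n%:R : F) != 0 -> (n%:R : E) != 0.
  by move=> nz; rewrite -(rmorph_nat (in_alg E)) fmorph_eq0.
have nz2E : (2%:R : E) != 0 := nzE 2 nz2.
have Gs : s \in G by rewrite (subsetP (center_sub G)).
have nG' g : g \in G -> g \in 'N(G^`(1))%g by apply: subsetP; apply: gFnorm.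
have half (M : 'M[E]_#|G|) : 2%:R^-1 *: (M + M) = M.
  by rewrite -mulr2n -[M *+ 2]scaler_nat scalerA mulVf ?scale1r.
rewrite (sum_pairing_idem (pi := coset _) chiQP); last first.
  by move=> g Gg; apply: mem_quotient.
have -> : \sum_(h in G | coset G^`(1)%g h^-1%g == 1%g) aE h = 1%:M + aE s.
  have mem_s h : (h \in G) && (coset G^`(1)%g h^-1%g == 1%g) = (h \in [set 1%g; s]).
    apply/andP/idP=> [[Gh /eqP/coset_idr G'h]|].
      have : h \in G^`(1)%g by rewrite -groupV G'h ?groupV ?nG'.
      rewrite (D5_der D5); case/cycleP=> i ->.
      by rewrite !inE -(odd_double_half i) expgD -mul2n expgM
        [(s ^+ 2)%g]ss expg1n mulg1; case: (odd i); rewrite ?expg1 ?eqxx ?orbT.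
    rewrite !inE => /orP[] /eqP->; first by rewrite group1 invg1 morph1.
    split=> //; apply/eqP/coset_id; rewrite groupV /= (D5_der D5); exact: cycle_id.
  rewrite (eq_bigl _ _ mem_s) big_setU1 ?inE 1?eq_sym //= big_set1.
  by rewrite repr_mx1.
have oG : #|G| = (2 * #|A|)%N.
  have oG' : #|G^`(1)%g| = 2 by rewrite (D5_der D5) -orderE (@nt_prime_order _ 2).
  by rewrite -(Lagrange (der_sub 1 G)) oG' card_quotient ?gFnorm.
have -> : (#|G|%:R^-1 * #|A|%:R : E) = 2%:R^-1.
  have nzA : (#|A|%:R : E) != 0.
    by apply: contraTneq (nzE _ nzG) => A0; rewrite oG natrM A0 mulr0 eqxx.
  by rewrite oG natrM invfM -mulrA mulVf ?mulr1.
have -> : \sum_(b in [set b in Z | chi b s == -1]) chi_idem G Z chi b =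
    2%:R^-1 *: (1%:M - aE s).
  have [m _ _ _] := chiP.
  have c1 b : b \in Z -> {in Z &, forall g h, chi b (g * h)%g = chi b g * chi b h}.
    by move=> Zb g h Zg Zh; rewrite (pairingMr chiP).
  have sZG := center_sub G.
  (* e_b - s e_b is 2 e_b or 0 according to the sign of chi(b, s), so the restricted sum becomes a
     sum over all of Z(G). *)
  have -> : \sum_(b in [set b in Z | chi b s == -1]) chi_idem G Z chi b =
      2%:R^-1 *: \sum_(b in Z) (chi_idem G Z chi b - aE s *m chi_idem G Z chi b).
    rewrite (eq_bigl (fun b => (b \in Z) && (chi b s == -1))); last first.
      by move=> b; rewrite inE.
    rewrite big_mkcondr scaler_sumr; apply: eq_bigr => b Zb.
    rewrite (mul_chi_idem sZG c1) //; have [->|n1] := eqVneq (chi b s) (-1).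
      by rewrite scaleN1r opprK half.
    by have := chis b Zb; rewrite (negPf n1) orbF => /eqP->; rewrite scale1r subrr scaler0.
  rewrite sumrB -mulmx_sumr (sum_pairing_idem (pi := id) chiP) //.
  have nzZ : (#|Z|%:R : E) != 0.
    by apply: contraTneq (nzE _ nzG) => Z0; rewrite -(Lagrange sZG) natrM Z0 mul0r eqxx.
  rewrite mulVf // scale1r (big_pred1 1%g) => [|h]; last first.
    by rewrite /= invg_eq1; case: eqP => [->|]; rewrite ?group1 ?andbF.
  by rewrite repr_mx1 mulmx1.
by rewrite -scalerDr addrACA subrr addr0 half.
Qed.

End PairingIdempotents.

Section D5Components.

Local Open Scope ring_scope.

Variables (gT : finGroupType) (m1 m2 m3 m4 : nat) (G : {group gT}).
Variables (t1 t2 t3 t4 x y s : gT).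
Hypothesis m1_ge3 : (3 <= m1)%N.
Hypothesis D5 : D5_structure m1 m2 m3 m4 G t1 t2 t3 t4 x y s.
Variables (F : fieldType) (E : splittingFieldType F) (zeta : E).
Hypothesis galE : galois 1 {:E}.
Hypothesis prim_zeta : (exponent G).-primitive_root zeta.
Hypothesis nz2 : (2%:R : F) != 0.

(* [f] separates the Galois orbits of characters, once these are indexed by the
   elements of a group by means of a self-pairing. *)
Variables (X : finGroupType -> finType) (f : forall aT : finGroupType, aT -> X aT).
Hypothesis fP : forall (aT : finGroupType) (b c : aT),
    (2.-elt b)%g -> (#[b]%g %| exponent G)%N ->
  (exists2 u : gal_of {:E}, u \in 'Gal({:E} / 1)%g &
     exists2 r, u zeta = zeta ^+ r & c = (b ^+ r)%g) <-> f b = f c.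

Local Notation Z := 'Z(G)%g.
Local Notation A := (G / G^`(1))%g.

(** [S2] indexes the characters with chi(s) = -1. It varies with [E] and the pairing; the
    cardinality identity is what makes its number of cyclic subgroups intrinsic. *)
Lemma D5_components : exists S2 : {set gT},
  [/\ S2 \subset Z,
      forall b r, b \in S2 -> odd r -> (b ^+ r)%g \in S2,
      forall b, b \in S2 -> (b ^+ 4)%g != 1%g,
      (#|(fun b : gT => <[b]>%G) @: Z| = #|(fun b : gT => <[b]>%G) @: S2| +
         #|(fun b : gT => <[coset G^`(1)%g b]>%G) @: Z|)%N
    & forall I1 I2 : finType, #|I1| = #|@f _ @: A| -> #|I2| = #|@f _ @: S2| ->
        exists R : I1 + I2 -> 'A[F]_#|G|,
        [/\ Wedderburn_decomposition (group_ring F G) R,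
            forall i, is_field_algebra (R (inl i)),
            forall j, is_quaternion_algebra (R (inr j))
          & (forall (L : fieldExtType F) (a b : L), a != 0 -> b != 0 ->
               exists c d : L, a * c ^+ 2 + b * d ^+ 2 = 1) ->
            forall j, is_matrix2_algebra (R (inr j))]].
Proof.
have [Zs ss s1] := D5_s D5; have [Gx Gy] := D5_mem D5; have [Zxx Zyy] := D5_squares D5.
have sZG := center_sub G; have Gs := subsetP sZG s Zs.
have ZG := subsetP sZG.
have [Zt1 Zt4] : t1 \in Z /\ t4 \in Z.
  rewrite -!cycle_subG; have dZ := D5_center D5; split.
    by rewrite -!dprodA in dZ; have [[_ B _ ->] /= <- _ _] := dprodP dZ; rewrite mulG_subl.
  by have [[B _ -> _] /= <- _ _] := dprodP dZ; rewrite mulG_subr.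
have [chi [chiP chis cardS1]] := center_pairing_count D5 prim_zeta m1_ge3 (dvdnn _).
have oQ g : g \in G -> (#[coset G^`(1) g]%g %| exponent G)%N.
  move=> Gg; apply: dvdn_trans (dvdn_exponent Gg); rewrite order_dvdn.
  by rewrite -morphX ?expg_order ?morph1 // (subsetP (gFnorm _ _)).
have [chiQ chiQP] : exists chiQ : coset_of G^`(1)%g -> coset_of G^`(1)%g -> E,
    self_pairing (exponent G) A chiQ.
  have [B [chiQ [_ chiQP _]]] := pairing_dprod4 prim_zeta (D5_abel D5)
    (And4 (oQ _ (ZG _ Zt1)) (oQ _ Gx) (oQ _ Gy) (oQ _ (ZG _ Zt4))).
  by exists chiQ.
pose S2 := [set b in Z | chi b s == -1].
have Zb b : b \in S2 -> b \in Z by rewrite inE => /andP[].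
have bs b : b \in S2 -> chi b s = -1 by rewrite inE => /andP[_ /eqP].
have S2X b r : b \in S2 -> odd r -> (b ^+ r)%g \in S2.
  move=> Sb odd_r; have Zb' := Zb b Sb.
  rewrite inE groupX //= (pairingXl prim_zeta chiP) // (bs b Sb).
  by rewrite -signr_odd odd_r expr1.
have p2G := D5_pgroup D5; have p2Z b : b \in Z -> (2.-elt b)%g.
  by move/(subsetP sZG); apply: mem_p_elt.
have nz1 : (1 : E) != -1.
  rewrite -subr_eq0 opprK -mulr2n -(rmorph_nat (in_alg E) 2) fmorph_eq0 //.
exists S2; split=> //.
- exact/subsetP.
- move=> b Sb; apply: contraNneq nz1 => b4.
  (* [u] is a fourth root of s, available since m1 >= 3; hence chi(b^4, u) = chi(b, s) = -1. *)
  pose u := (t1 ^+ (2 ^ (m1 - 3)))%g; have Zu : u \in Z by apply: groupX.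
  have -> : -1 = chi (b ^+ 4)%g u.
    have Zb' := Zb b Sb; rewrite -(bs b Sb) (D5_sE D5) (pairingXl prim_zeta chiP) //.
    have -> : (t1 ^+ (2 ^ m1.-1))%g = (u ^+ 4)%g.
      rewrite -expgM -(expnD 2 _ 2) addn2; congr (_ ^+ (2 ^ _))%g.
      by rewrite -{1}(subnK m1_ge3) addn3.
    have [_ sym _ _] := chiP; rewrite sym ?groupX //.
    by rewrite (pairingXl prim_zeta chiP) // sym.
  by rewrite b4 (pairing1l prim_zeta chiP).
- rewrite (card_imsetID (S := Z) (B := S2)); last first.
    have half b c : b \in Z -> c \in Z -> <[b]>%G = <[c]>%G -> b \in S2 -> c \in S2.
      move=> Zb' Zc /(congr1 val) /= /(odd_generator _ (p2Z b Zb'))[r odd_r ->] Sb.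
      exact: S2X.
    by move=> b c Zb' Zc E'; apply/idP/idP; apply: half.
  rewrite (setIidPr _); last exact/subsetP.
  rewrite -cardS1; suff -> : [set b in Z | chi b s == 1] = Z :\: S2 by [].
  apply/setP=> b; rewrite in_setD [b \in S2]in_set [LHS]in_set.
  case Zb': (b \in Z); last by rewrite andbF.
  case/orP: (chis b Zb') => /eqP->; first by rewrite !eqxx nz1.
  by rewrite !eqxx [-1 == 1]eq_sym (negPf nz1).
move=> I1 I2 oI1 oI2.
have nG' g : g \in G -> g \in 'N(G^`(1))%g by apply: subsetP; apply: gFnorm.
have csM : {in G &, {morph coset G^`(1)%g : g h / (g * h)%g}}.
  by move=> g h Gg Gh; rewrite morphM ?nG'.
have cs_im : coset G^`(1)%g @: G = A by rewrite -morphimEsub ?gFnorm.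
have idM : {in Z &, {morph id : g h / (g * h)%g}} by [].
have id_im : id @: Z = Z by rewrite imset_id.
have exp_odd r : coprime r (exponent G) -> odd r by rewrite (D5_coprime_exponent D5).
pose chi1 b g := chiQ b (coset G^`(1)%g g).
have chi1P : galois_characters G A chi1.
  apply: (pairing_galois_characters prim_zeta chiQP csM cs_im) => // b r Ab _.
  exact: groupX.
have chi2P : galois_characters Z S2 chi.
  apply: (pairing_galois_characters prim_zeta chiP idM id_im) => [|b r Sb /exp_odd].
    exact/subsetP.
  exact: S2X.
have [rep1 rep1P] : exists rep : I1 -> _, orbit_reps G A chi1 rep.
  apply: (orbit_reps_of (f := @f _)) oI1 => b c Ab Ac.
  rewrite (gal_conj_pairingP prim_zeta chiQP cs_im Ab Ac).
  apply: fP; first by apply: mem_p_elt Ab; apply: quotient_pgroup.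
  by have /morphimP[g _ Gg ->] := Ab; apply: oQ.
have [rep2 rep2P] : exists rep : I2 -> _, orbit_reps Z S2 chi rep.
  apply: (orbit_reps_of (f := @f _)) oI2 => b c Sb Sc.
  rewrite (gal_conj_pairingP prim_zeta chiP id_im (Zb b Sb) (Zb c Sc)).
  apply: fP; first exact/p2Z/Zb.
  by apply: dvdn_exponent; apply/ZG/Zb.
have nzG : (#|G|%:R : F) != 0 by rewrite (D5_card D5) natrX expf_neq0.
have chi1s b : b \in A -> chi1 b s = 1.
  move=> Ab; rewrite /chi1 coset_id ?(pairing1r prim_zeta chiQP) //.
  by rewrite (D5_der D5) cycle_id.
have total := sum_D5_idem prim_zeta D5 nzG nz2 chiQP chiP chis.
exists (component G Z A chi1 rep1 S2 chi rep2); split.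
- exact: (component_Wedderburn galE nzG nz2 (subxx _) Zs Gx Gy Zxx Zyy (D5_yx D5)
    (D5_cosets D5) chi1P chi1s rep1P chi2P bs rep2P total).
- move=> i; exact: (linear_component galE nzG chi1P rep1P).
- move=> j; exact: (quaternion_component galE nzG nz2 (subxx _) Zs Gx Gy Zxx Zyy (D5_yx D5)
    (D5_cosets D5) chi2P bs rep2P).
move=> squares j; exact: (split_quaternion_component galE nzG nz2 (subxx _) Zs Gx Gy Zxx Zyy
  (D5_yx D5) (D5_cosets D5) chi2P bs rep2P).
Qed.

End D5Components.

Section OrbitInvariants.

Local Open Scope ring_scope.

Lemma Wedderburn_reindex (F : fieldType) (n m : nat) (A : 'A[F]_(m, n)) (I J : finType)
    (h : J -> I) (R : I -> 'A[F]_n) :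
    bijective h -> Wedderburn_decomposition A R ->
  Wedderburn_decomposition A (R \o h).
Proof.
move=> bij_h [sumR dxR idR simR].
have sumh : (\sum_j R (h j) = \sum_i R i)%MS by rewrite [RHS](reindex h (onW_bij _ bij_h)).
split=> [||j|j] //=; first by rewrite sumh.
apply/mxdirectP; rewrite /= sumh (mxdirectP dxR) /=.
by rewrite (reindex h (onW_bij _ bij_h)).
Qed.

Lemma cyclic_subgroupsE (gT : finGroupType) (A : {group gT}) :
  cyclic_subgroups A = (fun b : gT => <[b]>%G) @: A.
Proof.
apply/setP=> C; rewrite inE; apply/andP/imsetP=> [[sC /cyclicP[u Cu]]|[u Au ->]].
  by exists u; [apply: (subsetP sC); rewrite Cu cycle_id | apply: val_inj].
by rewrite /= cycle_subG cycle_cyclic.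
Qed.

Lemma odd_finField_nat2 (K : finFieldType) : odd #|K| -> (2%:R : K) != 0.
Proof.
apply: contraL => /eqP K2; have pK : 2 \in [pchar K] by rewrite inE /= K2 eqxx.
have := finNzRing_gt1 K; rewrite (card_pprimeChar pK).
by case: logn => // k _; rewrite oddX.
Qed.

Lemma rat_orbit_cycle (L : splittingFieldType rat) (e : nat) (zeta : L)
    (aT : finGroupType) (b c : aT) :
    e.-primitive_root zeta -> (forall r, coprime r e = odd r) ->
    (2.-elt b)%g ->
  (exists2 u : gal_of {:L}, u \in 'Gal({:L} / 1)%g &
     exists2 r, u zeta = zeta ^+ r & c = (b ^+ r)%g) <-> <[b]>%G = <[c]>%G.
Proof.
move=> prim_zeta coe p2b; split=> [[u _ [r uz ->]]|/(congr1 val)].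
  apply/val_inj/(odd_generator _ p2b); exists r => //.
  by rewrite -coe -(prim_root_exp_coprime r prim_zeta) -uz fmorph_primitive_root.
case/(odd_generator _ p2b)=> r odd_r ->.
have [u Gu uz] : exists2 u : gal_of {:L}, u \in 'Gal({:L} / 1)%g & u zeta = zeta ^+ r.
  by apply: rat_cyclotomic_gal prim_zeta _; rewrite coe.
by exists u => //; exists r.
Qed.

Lemma finField_orbit_power (K : finFieldType) (E : splittingFieldType K) (e : nat)
    (zeta : E) (aT : finGroupType) (b c : aT) :
    e.-primitive_root zeta -> odd #|K| -> (2.-elt b)%g -> (#[b]%g %| e)%N ->
  (exists2 u : gal_of {:E}, u \in 'Gal({:E} / 1)%g &
     exists2 r, u zeta = zeta ^+ r & c = (b ^+ r)%g) <->
  power_orbit #|K| b = power_orbit #|K| c.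
Proof.
move=> prim_zeta odd_q p2b be; have [_ galX Xgal] := finField_gal_frobenius E.
have p2 d : d \in <[b]>%g -> (2.-elt d)%g by apply: mem_p_elt.
rewrite (power_orbit_eqP p2 odd_q c (cycle_id b)).
split=> [[u Gu [r uz ->]]|[i ->]].
  have [i uX] := galX u Gu; exists i; apply/eqP; rewrite eq_expg_mod_order.
  move: uz; rewrite uX => /eqP; rewrite (eq_prim_root_expr prim_zeta) => /eqP E'.
  by rewrite -(modn_dvdm r be) -E' modn_dvdm.
by have [u Gu uX] := Xgal i; exists u => //; exists (#|K| ^ i)%N.
Qed.

End OrbitInvariants.

Theorem theorem9p2
  (m1 m2 m3 m4 : nat)
  (hm1 : (3 <= m1)%N) (hm2 : (3 <= m2)%N) (hm3 : (3 <= m3)%N) (hm4 : (3 <= m4)%N)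
  (gT : finGroupType) (G0 G : {group gT}) (t1 t2 t3 t4 x y s : gT)
  (hG0 : type_D5 m1 m2 m3 G0 t1 t2 t3 x y)
  (hs : s = (t1 ^+ (2 ^ m1.-1))%g)
  (ht4 : #[t4]%g = (2 ^ m4)%N)
  (hG : (G0 \x <[t4]>)%g = G)
  (* the field Q(zeta), zeta a primitive e-th root of unity, e the exponent of G *)
  (L : splittingFieldType rat) (zeta : L)
  (hzeta : (exponent G).-primitive_root%R zeta)
  (hL : <<1; zeta>>%VS = fullv)
  (N1 N2 N3 N4 N N0 M M0 : nat)
  (hN1 : N1 = #|cyclic_subgroups 'Z(G)%g|)
  (hN2 : N2 = #|Kclasses_involving zeta G s x|)
  (hN3 : N3 = #|Kclasses_involving zeta G s y|)
  (hN4 : N4 = #|Kclasses_involving zeta G s (x * y)%g|)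
  (hN : N = (N1 + N2 + N3 + N4)%N)
  (hN0 : N0 = #|cyclic_subgroups (G / G^`(1))%g|)
  (hM : M = (2 * N - 136)%N)
  (hM0 : M0 = (2 * N0 - 136)%N)
  (K : finFieldType) (q : nat) (hq : q = #|K|) (hq_odd : odd q) :
  (* the centre of G *)
  [/\ (<[t1]> \x <[t2]> \x <[t3]> \x <[t4]>)%g = 'Z(G)%g,
      #[t1]%g = (2 ^ m1)%N, #[t2]%g = (2 ^ m2)%N & #[t3]%g = (2 ^ m3)%N] /\
  (* the subtractions below are not truncated *)
  [/\ (N0 <= N)%N, (136 <= 2 * N0)%N & (M - M0 = 2 * (N - N0))%N] /\
  (* Q G *)
  (exists R : 'I_N0 + 'I_(N - N0) -> 'A[rat]_#|G|,
    [/\ Wedderburn_decomposition (group_ring rat G) R,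
        forall i, is_field_algebra (R (inl i))
      & forall j, is_quaternion_algebra (R (inr j))]) /\
  (* K G : lower bound on the number of simple components *)
  ((exists (n : nat) (R : 'I_n -> 'A[K]_#|G|),
      Wedderburn_decomposition (group_ring K G) R) /\
   (forall (n : nat) (R : 'I_n -> 'A[K]_#|G|),
      Wedderburn_decomposition (group_ring K G) R -> (M <= n)%N)) /\
  (* K G : the case q = 3 mod 8 *)
  (q = 3 %[mod 8] ->
   exists R : 'I_M0 + 'I_(M - M0) -> 'A[K]_#|G|,
    [/\ Wedderburn_decomposition (group_ring K G) R,
        forall i, is_field_algebra (R (inl i)),
        forall j, is_quaternion_algebra (R (inr j))
      & forall j, is_matrix2_algebra (R (inr j))]).
Proof.
have D5 := type_D5_structure (ltn_trans (ltn0Sn 1) hm1) hG0 hs ht4 hG.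
have [o1 o2 o3 o4] := D5_orders D5.
have [Gx Gy] := D5_mem D5; have [nZx nZy nZxy] := D5_noncentral D5.
have coe := D5_coprime_exponent D5.
pose cyc (aT : finGroupType) (b : aT) := <[b]>%G.
pose A := (G / G^`(1))%G; pose Z := 'Z(G)%G.
have N0E : N0 = #|cyc _ @: A| by rewrite hN0 cyclic_subgroupsE.
have N1E : N1 = #|cyc _ @: Z| by rewrite hN1 cyclic_subgroupsE.
have N0sum : N0 = (#|(fun b : gT => <[coset G^`(1)%g b]>%G) @: Z| + N2 + N3 + N4)%N.
  have Gxy := groupM Gx Gy.
  by rewrite hN0 (card_cyclic_quotient D5) hN2 hN3 hN4 !(card_Kclasses_involving D5 hzeta).
have p2A b : b \in A -> (2.-elt b)%g.
  by apply: mem_p_elt; apply: quotient_pgroup; apply: D5_pgroup D5.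
have AX b r : b \in A -> odd r -> (b ^+ r)%g \in A by move=> Ab _; apply: groupX.
have A4 : #|cyc _ @: (A :&: [set b | b ^+ 4 == 1]%g)| = 136.
  have [e1 ex ey e4] := D5_abel_orders D5.
  apply: card_cycles_torsion4 (D5_abel D5) _.
  by rewrite e1 ex ey e4; split; rewrite (@dvdn_exp2l 2 2) //; lia.
have N0_ge : (136 <= N0)%N.
  by rewrite -A4 N0E subset_leq_card // imsetS // subsetIl.
have e2 : (2.-nat (exponent G))%N by rewrite pnat_exponent; apply: D5_pgroup D5.
have nzK : (2%:R : K)%R != 0%R by apply: odd_finField_nat2; rewrite -hq.
have [E [xi prim_xi]] : exists (E : splittingFieldType K) (xi : E),
    (exponent G).-primitive_root%R xi.
  apply: finField_primitive_extension; first exact: exponent_gt0.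
  by have /p_natP[k ->] := e2; rewrite natrX expf_neq0.
have [galE _ _] := finField_gal_frobenius E.
have odd_K : odd #|K| by rewrite -hq.
have fPK (aT : finGroupType) (b c : aT) p2b be :=
  @finField_orbit_power K E _ xi aT b c prim_xi odd_K p2b be.
have [S2 [sS2Z S2X S24 cardS2 decK]] :=
  D5_components hm1 D5 galE prim_xi nzK (X := fun aT => {set aT}) fPK.
have p2S b : b \in S2 -> (2.-elt b)%g.
  move/(subsetP sS2Z)/(subsetP (center_sub G)); apply: mem_p_elt; exact: D5_pgroup D5.
have S2_0 : #|cyc _ @: (S2 :&: [set b | b ^+ 4 == 1]%g)| = 0.
  rewrite (_ : S2 :&: _ = set0) ?imset0 ?cards0 //; apply/setP=> b; rewrite !inE.
  by apply/andP=> [[/S24 /negP]].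
have NE : N = (#|cyc _ @: S2| + N0)%N by rewrite hN N0sum N1E {1}/cyc cardS2 -!addnA.
pose n1 := #|power_orbit #|K| @: A|; pose n2 := #|power_orbit #|K| @: S2|.
have le1 : 2 * N0 <= n1 + 136.
  by rewrite -A4 N0E; apply: leq_power_orbits.
have le2 : 2 * #|cyc _ @: S2| <= n2.
  by have := leq_power_orbits p2S S2X odd_K; rewrite S2_0 addn0.
split; first by split=> //; rewrite (D5_center D5).
(* No subtraction truncates because G/G' alone has 136 cyclic subgroups of order at most 4. *)
split; first by rewrite hM hM0; split; move: NE N0_ge; clear; lia.
split.
  have fPL (aT : finGroupType) (b c : aT) p2b (_ : (#[b]%g %| exponent G)%N) :=
    @rat_orbit_cycle L _ zeta aT b c hzeta coe p2b.
  have nzQ : (2%:R : rat)%R != 0%R by [].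
  have [S2' [_ _ _ cardS2' decL]] := D5_components hm1 D5 (splitting_field_rat_galois L)
    hzeta nzQ (X := fun aT => {group aT}) fPL.
  (* [S2] and [S2'] come from pairings in unrelated fields, but each completes the same count of
     cyclic subgroups of Z(G). *)
  have cardS2E : #|cyc _ @: S2| = #|cyc _ @: S2'|.
    by apply: (@addIn #|(fun b : gT => <[coset G^`(1)%g b]>%G) @: Z|); rewrite -cardS2 -cardS2'.
  have [||R [wR fR qR _]] := decL 'I_N0 'I_(N - N0)%N.
  - by rewrite card_ord N0E.
  - by rewrite card_ord NE cardS2E addnK.
  by exists R.
split.
  have [||R [wR _ _ _]] := decK 'I_n1 'I_n2; rewrite ?card_ord //.
  (* No decomposition has fewer than n1 + n2 components, and 2N = 2 N0 + 2 |cyc S2| <= (n1 + 136) +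
     n2. *)
  split=> [|n R' wR']; last first.
    have := Wedderburn_card_leq wR wR'; rewrite card_sum !card_ord.
    by move: NE N0_ge le1 le2; rewrite hM; clear; lia.
  exists (n1 + n2)%N, (R \o @split n1 n2); apply: Wedderburn_reindex wR.
  by exists unsplit; [apply: splitK | apply: unsplitK].
move=> q3; have q3K : #|K| = 3 %[mod 8] by rewrite -hq.
have eq1 : 2 * N0 = n1 + 136.
  by rewrite -A4 N0E; apply: card_power_orbits.
have eq2 : 2 * #|cyc _ @: S2| = n2.
  by have := card_power_orbits p2S S2X odd_K q3K; rewrite S2_0 addn0.
have [||R [wR fR qR mR]] := decK 'I_M0 'I_(M - M0)%N.
- by rewrite card_ord hM0 eq1 addnK.
- by rewrite card_ord hM hM0 NE -/n2; move: N0_ge eq1 eq2; clear; lia.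
exists R; split=> //; apply: mR => L' a b; exact: finField_fieldExt_two_squares.
Qed.
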